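(* Let $x:M^2\to\mathbb{R}^3$ be a locally strongly convex centroaffine surface which has parallel cubic form. Then $x$ is locally centroaffinely equivalent to one of the following hypersurfaces, where $\alpha_1,\alpha_2,\alpha_3$ are real constants and $(x_1,x_2,x_3)$ are the coordinates of $\mathbb{R}^3$: (i) quadrics ($C=0$); (ii) $x_1^{\alpha_1}x_2^{\alpha_2}x_3^{\alpha_3}=1$, where either $\alpha_i>0$ for $i=1,2,3$, or $\alpha_1<0$, $\alpha_2,\alpha_3>0$ and $\alpha_1+\alpha_2+\alpha_3<0$; (iii) $x_1^{\alpha_1}(x_2^2+x_3^2)^{\alpha_2}\exp\left(\alpha_3\arctan\frac{x_2}{x_3}\right)=1$, where $\alpha_1<0$ and $\alpha_1+2\alpha_2>0$; (iv) $x_3=x_1(\ln x_1-\alpha_2\ln x_2)$, where $0<\alpha_2<1$; (v) $x_3=\frac{1}{2x_1}x_2^2+x_1\ln x_1$.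
   Context: Let $D$ be the standard flat connection of $\mathbb{R}^{3}$ and $O$ the origin. An immersion $x:M^2\to\mathbb{R}^{3}$ of a smooth surface is a centroaffine surface if at each point the position vector $x$ is transversal to the tangent plane. For $\varepsilon\in\{1,-1\}$ the Gauss formula $D_Xx_*(Y)=x_*(\nabla_XY)+h(X,Y)(-\varepsilon x)$ defines the induced connection $\nabla$ and the centroaffine metric $h$. The surface is locally strongly convex if $h$ is definite; then $\varepsilon$ is chosen so that $h$ is positive definite. $\hat\nabla$ is the Levi-Civita connection of $h$ and $C=\nabla h$ is the cubic form; ''parallel cubic form'' means $\hat\nabla C=0$. Two surfaces are centroaffinely equivalent if they correspond under an element of $\mathrm{GL}(3,\mathbb{R})$ (an affine transformation fixing $O$); ''locally'' means open parts correspond. *)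

(* Defs.v *)
From HB Require Import structures.
From mathcomp Require Import all_boot all_order all_algebra.
From mathcomp Require Import all_classical all_reals all_analysis.

Set Implicit Arguments.
Unset Strict Implicit.
Unset Printing Implicit Defensive.
Import Order.TTheory GRing.Theory Num.Theory.
Import numFieldNormedType.Exports.
Local Open Scope classical_set_scope.
Local Open Scope ring_scope.

Section Calculus.
Context {R : realType}.

Definition pd {V : normedModType R} (i : 'I_2) (f : 'rV[R]_2 -> V)
  (u : 'rV[R]_2) : V := 'D_(delta_mx 0 i) f u.

(* C^oo on D (used for D open): every iterated partial derivative is
   differentiable, hence continuous, on D. *)
Definition smooth_on {V : normedModType R} (D : set 'rV[R]_2)
  (f : 'rV[R]_2 -> V) : Prop :=
  forall (s : seq 'I_2) u, D u -> differentiable (foldr pd f s) u.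

End Calculus.

Section Surfaces.
Variable R : realType.

(* The values of chart_map outside chart_dom and of chart_inv outside chart_img
   are irrelevant. *)
Record chart (M : topologicalType) := Chart {
  chart_dom : set M;
  chart_img : set 'rV[R]_2;
  chart_map : M -> 'rV[R]_2;
  chart_inv : 'rV[R]_2 -> M;
  chart_dom_open : open chart_dom;
  chart_img_open : open chart_img;
  chart_map_img : forall p, chart_dom p -> chart_img (chart_map p);
  chart_inv_dom : forall u, chart_img u -> chart_dom (chart_inv u);
  chart_mapK : forall p, chart_dom p -> chart_inv (chart_map p) = p;
  chart_invK : forall u, chart_img u -> chart_map (chart_inv u) = u;
  chart_map_cont : forall p, chart_dom p -> {for p, continuous chart_map};
  chart_inv_cont : forall u, chart_img u -> {for u, continuous chart_inv}
}.

(* Connectedness and maximality of the atlas are not required. *)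
Record smooth_surface := SmoothSurface {
  surface_carrier :> topologicalType;
  surface_hausdorff : hausdorff_space surface_carrier;
  surface_second_countable : @second_countable surface_carrier;
  atlas : set (chart surface_carrier);
  atlas_cover : forall p, exists2 c, atlas c & chart_dom c p;
  atlas_compat : forall c d, atlas c -> atlas d ->
    smooth_on (chart_img c `&` chart_inv c @^-1` chart_dom d)
              (chart_map d \o chart_inv c)
}.

End Surfaces.

(* Local centroaffine geometry of a parametrization y, in the coordinates u;
   vectors of R^3 are rows. *)
Section LocalFormulas.
Context {R : realType}.
Variables (eps : R) (y : 'rV[R]_2 -> 'rV[R]_3).

(* Row k is the k-th coordinate tangent vector. *)
Definition tangent (u : 'rV[R]_2) : 'M[R]_(2, 3) :=
  \matrix_(k < 2) pd k y u.

Definition frame (u : 'rV[R]_2) : 'M[R]_(2 + 1) :=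
  col_mx (tangent u) (- eps *: y u).

(* Components of D_i y_*(d_j) on the frame (y_*(d_0), y_*(d_1), - eps y). *)
Definition gauss_coef (i j : 'I_2) (u : 'rV[R]_2) : 'rV[R]_(2 + 1) :=
  pd i (pd j y) u *m invmx (frame u).

(* Christoffel symbol Gamma^k_{ij} of the induced connection. *)
Definition conn (k i j : 'I_2) (u : 'rV[R]_2) : R :=
  lsubmx (gauss_coef i j u) 0 k.

Definition metric (i j : 'I_2) (u : 'rV[R]_2) : R :=
  rsubmx (gauss_coef i j u) 0 0.

Definition metric_mx (u : 'rV[R]_2) : 'M[R]_2 :=
  \matrix_(i, j) metric i j u.

(* Christoffel symbol of the Levi-Civita connection of the metric. *)
Definition LC (k i j : 'I_2) (u : 'rV[R]_2) : R :=
  2^-1 * \sum_(l < 2) invmx (metric_mx u) k l *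
    (pd i (metric j l) u + pd j (metric i l) u - pd l (metric i j) u).

(* (nabla_i h)(d_j, d_k) *)
Definition cubic (i j k : 'I_2) (u : 'rV[R]_2) : R :=
  pd i (metric j k) u
  - \sum_(l < 2) (conn l i j u * metric l k u + conn l i k u * metric j l u).

(* (hat-nabla_m C)(d_i, d_j, d_k) *)
Definition dcubic (m i j k : 'I_2) (u : 'rV[R]_2) : R :=
  pd m (cubic i j k) u
  - \sum_(l < 2) (LC l m i u * cubic l j k u + LC l m j u * cubic i l k u
                  + LC l m k u * cubic i j l u).

Lemma frame_unit (u : 'rV[R]_2) : eps != 0 -> row_free (tangent u) ->
  ~~ (y u <= tangent u)%MS -> frame u \in unitmx.
Proof.
move=> e0 T0 yT.
have ey : ((- eps *: y u) :=: y u)%MS by apply: eqmx_scale; rewrite oppr_eq0.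
have Tlt : (tangent u < tangent u + y u)%MS.
  by rewrite /ltmx addsmxSl addsmx_sub submx_refl.
rewrite -row_full_unit -col_leq_rank /frame -addsmxE.
rewrite (adds_eqmx (eqmx_refl _) ey).
by have := rank_ltmx Tlt; rewrite (eqP T0).
Qed.

Lemma gauss_formula (i j : 'I_2) (u : 'rV[R]_2) : frame u \in unitmx ->
  pd i (pd j y) u =
    \sum_(k < 2) conn k i j u *: pd k y u + metric i j u *: (- eps *: y u).
Proof.
move=> fU.
have -> : pd i (pd j y) u = gauss_coef i j u *m frame u.
  by rewrite /gauss_coef mulmxKV.
rewrite -{1}[gauss_coef i j u]hsubmxK mul_row_col mulmx_sum_row.
congr (_ + _); first by apply: eq_bigr => k _; rewrite rowK.
by rewrite [rsubmx _]mx11_scalar mul_scalar_mx.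
Qed.

End LocalFormulas.

Section Centroaffine.
Context {R : realType} {M : smooth_surface R}.
Implicit Types (x : M -> 'rV[R]_3) (eps : R) (W : set M) (S : set 'rV[R]_3).

Definition immersion x : Prop :=
  forall c, atlas c ->
    smooth_on (chart_img c) (x \o chart_inv c) /\
    forall u, chart_img c u -> row_free (tangent (x \o chart_inv c) u).

Definition centroaffine_surface x : Prop :=
  immersion x /\
  forall c u, atlas c -> chart_img c u ->
    ~~ (x (chart_inv c u) <= tangent (x \o chart_inv c) u)%MS.

(* The metric associated with the sign eps is positive definite. *)
Definition locally_strongly_convex eps x : Prop :=
  forall c u, atlas c -> chart_img c u ->
  forall v : 'rV[R]_2, v != 0 ->
    0 < (v *m metric_mx eps (x \o chart_inv c) u *m v^T) 0 0.

Definition parallel_cubic_form eps x : Prop :=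
  forall c u, atlas c -> chart_img c u ->
  forall m i j k, dcubic eps (x \o chart_inv c) m i j k u = 0.

Definition cubic_form_vanishes_on eps x W : Prop :=
  forall c u, atlas c -> chart_img c u -> W (chart_inv c u) ->
  forall i j k, cubic eps (x \o chart_inv c) i j k u = 0.

(* Each point of W has a neighbourhood U such that an element of GL(3,R) maps
   x(U) bijectively onto a relatively open part of S. *)
Definition locally_equivalent_on W x S : Prop :=
  forall p, W p ->
  exists (A : 'M[R]_3) (U : set M) (V : set 'rV[R]_3),
    [/\ A \in unitmx, open U, U p, open V & {in U &, injective x}] /\
    (fun q => x q *m A) @` U = S `&` V.

End Centroaffine.

Section Models.
Context {R : realType}.

(* The zero set of a polynomial of degree 2, given by the symmetric matrix of
   its homogenization. *)
Definition quadric (B : 'M[R]_(3 + 1)) : set 'rV[R]_3 :=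
  [set z | (row_mx z 1%:M *m B *m (row_mx z 1%:M)^T) 0 0 = 0].

Definition nondegenerate_sym (B : 'M[R]_(3 + 1)) : Prop :=
  B^T = B /\ B \in unitmx.

Definition coord1 (z : 'rV[R]_3) : R := z 0 0.
Definition coord2 (z : 'rV[R]_3) : R := z 0 1.
Definition coord3 (z : 'rV[R]_3) : R := z 0 2%:R.

(* The sign conditions in the four models below delimit the domains of the
   real powers, of ln and of the quotients, where the library functions are
   total. *)
Definition model_power (a1 a2 a3 : R) : set 'rV[R]_3 :=
  [set z | [/\ 0 < coord1 z, 0 < coord2 z, 0 < coord3 z &
     coord1 z `^ a1 * coord2 z `^ a2 * coord3 z `^ a3 = 1]].

Definition model_arctan (a1 a2 a3 : R) : set 'rV[R]_3 :=
  [set z | [/\ 0 < coord1 z, coord3 z != 0 &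
     coord1 z `^ a1 * (coord2 z ^+ 2 + coord3 z ^+ 2) `^ a2
       * expR (a3 * atan (coord2 z / coord3 z)) = 1]].

Definition model_log (a2 : R) : set 'rV[R]_3 :=
  [set z | [/\ 0 < coord1 z, 0 < coord2 z &
     coord3 z = coord1 z * (ln (coord1 z) - a2 * ln (coord2 z))]].

Definition model_parab_log : set 'rV[R]_3 :=
  [set z | 0 < coord1 z /\
     coord3 z = (2 * coord1 z)^-1 * coord2 z ^+ 2
                + coord1 z * ln (coord1 z)].

End Models.

(* Main.v *)
From HB Require Import structures.
Require Import Defs.
From mathcomp Require Import all_boot all_order all_algebra.
From mathcomp Require Import all_classical all_reals all_analysis.
From mathcomp Require Import ring lra.

Set Implicit Arguments.
Unset Strict Implicit.
Unset Printing Implicit Defensive.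
Import Order.TTheory GRing.Theory Num.Theory.
Import numFieldNormedType.Exports.
Local Open Scope classical_set_scope.
Local Open Scope ring_scope.

(** The argument first determines the surface near one point, in a chart, and then
    shows that the model obtained does not change along a connected set.

    In a chart the Gauss formula is a linear system for the tangent vectors and the
    position vector. Its integrability conditions make the cubic form totally symmetric
    ([codazzi]), and the difference of the induced and the Levi-Civita connection is
    the cubic form, up to a factor and a raised index ([difference_cubic]). On an
    orthonormal frame the components of a parallel cubic form change only through the
    rotation of the frame ([pd_frame_cubic]). So the norm of the form is locally
    constant, and if the form is not zero its components form a pair of functions that
    rotates with the frame; the argument of this pair is an angle by which the frame can
    be turned to become parallel ([parallel_frame_near]). A surface with nonzero
    parallel cubic form is thus flat, and on a suitable parallel frame the cubic form
    has constant components with one of them equal to zero ([normal_parallel_frame]).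

    Then the derivatives of the moving frame, that is, of the two tangent vectors and
    the position vector, are constant matrices times the moving frame. These matrices
    commute, since the parallel fields do, and they depend on three numbers with one
    relation ([exponential_structure]). They are the multiplication matrices of a
    commutative associative algebra of dimension three with unit, and the position
    vector is an orbit of its exponential group. The characters of the algebra are given
    by the roots of a quadratic equation besides one that is always there, and the
    discriminant distinguishes the cases ([nonquadric_cases]): three real characters
    give the powers, a real one and a complex pair the arctangent, a double one the
    logarithm, a triple one the last model. In coordinates adapted to the characters the
    logarithm of the defining function has derivative zero, and since the model is a
    graph over two coordinates in which the surface is locally invertible, the surface
    is an open part of it ([graph_embedded]).

    If the cubic form vanishes, the moving frame satisfies the equations of an
    orthonormal frame of a constant quadratic form, which takes a constant value on the
    position vector ([quadric_form_constant]); conversely the cubic form vanishes on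
    such a quadric ([cubic_vanishes_in_quadric]).

    All models, with the stated signs, are homogeneous: two of their points have
    neighbourhoods that correspond under a linear map. Hence two points in the domain
    of one local model are modelled on the same sets ([modelled_transfer]), so that the
    points modelled on a given set are open and closed ([modelled_connected]), and one
    model serves for the whole of a connected set. *)

(** * Differentiability in epsilon form *)

Section EpsilonDifferential.
Context {R : realType} {V W : normedModType R}.

Lemma differentiable_eps (f : V -> W) (u : V) : differentiable f u ->
  forall e, 0 < e ->
  \forall w \near u, `|f w - f u - 'd f u (w - u)| <= e * `|w - u|.
Proof.
case=> -[_]; rewrite lim_id // => dfE e e0.
have h := (eqaddoP _ _ _ _).1 dfE e e0; apply: filterS h => w.
rewrite /= [X in `|X| <= _](_ : _ = f w - (f u + 'd f u (w - u))) //.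
by rewrite opprD addrA.
Qed.

Lemma eps_differentiable (f : V -> W) (df : {linear V -> W}) (u : V) :
  continuous df ->
  (forall e, 0 < e ->
     \forall w \near u, `|f w - f u - df (w - u)| <= e * `|w - u|) ->
  differentiable f u.
Proof.
move=> dfc h; apply/diffP.
apply: (@getPex _ (fun (df : {linear V -> W}) => continuous df /\
  forall y, f y = f (lim (nbhs u)) + df (y - lim (nbhs u))
                  +o_(y \near u) (y - lim (nbhs u)))).
exists df; split=> // y; move: y; rewrite lim_id //.
apply: eqaddoEx; apply/funeqP; apply/(@eqaddoP _ _ _ _ (nbhs u)) => e e0.
have := h e e0; apply: filterS => w.
by rewrite /= opprD addrA.
Qed.

Lemma near_eq_differentiable (f g : V -> W) (u : V) :
  (\near u, f u = g u) -> differentiable f u -> differentiable g u.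
Proof.
move=> fg df; have dfc := diff_continuous df.
apply: (eps_differentiable dfc) => e e0.
have fgu := nbhs_singleton fg.
near=> w; rewrite -fgu -(near fg w) //.
by near: w; apply: differentiable_eps.
Unshelve. all: by end_near. Qed.

End EpsilonDifferential.

(** * Calculus of scalar functions of two variables *)

Section PlaneCalculus.
Context {R : realType}.
Local Notation plane := 'rV[R]_2.
Implicit Types (f g : plane -> R) (u v : plane) (D : set plane).

Definition has_dir_deriv f u v (d : R) : Prop :=
  differentiable f u /\ 'D_v f u = d.

Lemma has_dir_deriv_of f u v : differentiable f u ->
  has_dir_deriv f u v ('D_v f u).
Proof. by []. Qed.

Lemma has_dir_deriv_cst (c : R) u v : has_dir_deriv (fun _ => c) u v 0.
Proof.
split; first exact: differentiable_cst.
exact: derive_cst.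
Qed.

Lemma has_dir_derivD f g u v a b :
  has_dir_deriv f u v a -> has_dir_deriv g u v b ->
  has_dir_deriv (fun w => f w + g w) u v (a + b).
Proof.
move=> [df <-] [dg <-]; split; first exact: differentiableD.
by rewrite -deriveD //; apply: diff_derivable.
Qed.

Lemma has_dir_derivN f u v a :
  has_dir_deriv f u v a -> has_dir_deriv (fun w => - f w) u v (- a).
Proof.
move=> [df <-]; split; first exact: differentiableN.
by rewrite -deriveN //; apply: diff_derivable.
Qed.

Lemma has_dir_derivB f g u v a b :
  has_dir_deriv f u v a -> has_dir_deriv g u v b ->
  has_dir_deriv (fun w => f w - g w) u v (a - b).
Proof. by move=> hf hg; apply: has_dir_derivD => //; apply: has_dir_derivN. Qed.

Lemma has_dir_derivM f g u v a b :
  has_dir_deriv f u v a -> has_dir_deriv g u v b ->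
  has_dir_deriv (fun w => f w * g w) u v (a * g u + f u * b).
Proof.
move=> [df <-] [dg <-]; split; first exact: differentiableM.
rewrite (_ : (fun w => f w * g w) = f * g) // deriveM; try exact: diff_derivable.
by rewrite addrC /GRing.scale /= [g u * _]mulrC.
Qed.

Lemma has_dir_derivZ c f u v a :
  has_dir_deriv f u v a -> has_dir_deriv (fun w => c * f w) u v (c * a).
Proof.
move=> hf; have := has_dir_derivM (has_dir_deriv_cst c u v) hf.
by rewrite mul0r add0r.
Qed.

Lemma has_dir_deriv_comp (phi : R -> R) f u v a b :
  is_derive (f u) 1 phi b -> has_dir_deriv f u v a ->
  has_dir_deriv (fun w => phi (f w)) u v (b * a).
Proof.
move=> [dphi phib] [df <-].
have dphi' : differentiable phi (f u) by apply/derivable1_diffP.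
split; first exact: differentiable_comp.
rewrite (deriveE v (differentiable_comp df dphi')) diff_comp //= deriveE //.
rewrite -{1}[('d f u v)]mulr1 [LHS]linearZ /= -(deriveE _ dphi') phib.
by rewrite mulrC.
Qed.

Lemma has_dir_derivV f u v a : f u != 0 ->
  has_dir_deriv f u v a ->
  has_dir_deriv (fun w => (f w)^-1) u v (- (f u) ^- 2 * a).
Proof.
move=> fu hf; apply: has_dir_deriv_comp hf.
have := is_deriveV fu (is_derive_id (f u) 1).
by rewrite /GRing.scale /= mulr1.
Qed.

Lemma has_dir_deriv_eq f u v a b : has_dir_deriv f u v a -> a = b ->
  has_dir_deriv f u v b.
Proof. by move=> ? <-. Qed.

Lemma has_dir_deriv_sum (I : Type) (r : seq I) (P : pred I)
    (F : I -> plane -> R) (d : I -> R) u v :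
  (forall i, P i -> has_dir_deriv (F i) u v (d i)) ->
  has_dir_deriv (fun w => \sum_(i <- r | P i) F i w) u v (\sum_(i <- r | P i) d i).
Proof.
move=> h; elim: r => [|i r ih].
  rewrite big_nil (_ : (fun _ => _) = fun=> 0); first exact: has_dir_deriv_cst.
  by apply/funext => w; rewrite big_nil.
rewrite big_cons.
rewrite (_ : (fun _ => _) = fun w =>
   if P i then F i w + \sum_(i <- r | P i) F i w else \sum_(i <- r | P i) F i w).
  by case: ifP => // Pi; apply: has_dir_derivD => //; apply: h.
by apply/funext => w; rewrite big_cons.
Qed.

Lemma dir_deriv_linear f u v : differentiable f u ->
  'D_v f u = v 0 0 * pd 0 f u + v 0 1 * pd 1 f u.
Proof.
move=> df; rewrite /pd !deriveE // {1}(row_sum_delta v) big_ord_recl big_ord1.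
by rewrite linearD !linearZ /= (_ : lift ord0 ord0 = 1) //; apply/val_inj.
Qed.

Lemma open_eq_differentiable D f g u : open D -> (forall w, D w -> f w = g w) ->
  D u -> differentiable f u -> differentiable g u.
Proof.
move=> oD fg Du; apply: near_eq_differentiable.
by near=> w; apply: fg; near: w; apply: open_nbhs_nbhs.
Unshelve. all: by end_near. Qed.

Lemma open_eq_pd D f g u i : open D -> (forall w, D w -> f w = g w) ->
  D u -> pd i f u = pd i g u.
Proof.
move=> oD fg Du; apply: near_eq_derive.
by near=> w; apply: fg; near: w; apply: open_nbhs_nbhs.
Unshelve. all: by end_near. Qed.

End PlaneCalculus.

(** * Functions of class C^n on an open set *)

Section IteratedDifferentiability.
Context {R : realType}.
Local Notation plane := 'rV[R]_2.
Variable (D : set plane).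
Hypothesis oD : open D.
Implicit Types (f g : plane -> R) (u v : plane).

(** Existence of differentiable partial derivatives up to order [n], rather than
    continuity of the last ones: a condition that is stable under the operations
    below by a plain induction on [n]. *)
Fixpoint diff_upto (n : nat) f : Prop :=
  (forall u, D u -> differentiable f u) /\
  (if n is m.+1 then forall i, diff_upto m (pd i f) else True).

Lemma diff_upto_differentiable n f u : diff_upto n f -> D u ->
  differentiable f u.
Proof. by case: n => [|n] [h _] /h. Qed.

Lemma diff_upto_dir n f u v : diff_upto n f -> D u -> has_dir_deriv f u v ('D_v f u).
Proof. by move=> df Du; split=> //; exact: diff_upto_differentiable df Du. Qed.

Lemma diff_upto_pd n f i : diff_upto n.+1 f -> diff_upto n (pd i f).
Proof. by move=> [_ h]; apply: h. Qed.

Lemma diff_uptoS n f : diff_upto n.+1 f -> diff_upto n f.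
Proof.
elim: n f => [|n ih] f [df pf]; first by split.
by split=> // i; apply: ih.
Qed.

Lemma diff_upto_eq n f g : (forall u, D u -> f u = g u) ->
  diff_upto n f -> diff_upto n g.
Proof.
elim: n f g => [|n ih] f g fg [df pf].
  by split=> // u Du; apply: (open_eq_differentiable oD fg) => //; apply: df.
split=> [u Du|i]; first by apply: (open_eq_differentiable oD fg) => //; apply: df.
by apply: ih (pf i) => u Du; apply: (open_eq_pd _ oD fg).
Qed.

Lemma diff_upto_cst n c : diff_upto n (fun=> c).
Proof.
elim: n c => [|n ih] c; first by split=> // u _; apply: differentiable_cst.
split=> [u _|i]; first exact: differentiable_cst.
apply: diff_upto_eq (ih 0) => u _; rewrite /pd.
by rewrite /pd; have [_ ->] := has_dir_deriv_cst c u (delta_mx 0 i).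
Qed.

Lemma diff_uptoD n f g : diff_upto n f -> diff_upto n g ->
  diff_upto n (fun u => f u + g u).
Proof.
elim: n f g => [|n ih] f g hf hg.
  by split=> // u Du; apply: differentiableD; apply: (@diff_upto_differentiable 0).
split=> [u Du|i].
  by apply: differentiableD; apply: (@diff_upto_differentiable n.+1).
apply: diff_upto_eq (ih _ _ (diff_upto_pd i hf) (diff_upto_pd i hg)) => u Du.
have hfu := diff_upto_dir (delta_mx 0 i) hf Du.
have hgu := diff_upto_dir (delta_mx 0 i) hg Du.
by rewrite /pd; have [_ ->] := has_dir_derivD hfu hgu.
Qed.

Lemma diff_uptoM n f g : diff_upto n f -> diff_upto n g ->
  diff_upto n (fun u => f u * g u).
Proof.
elim: n f g => [|n ih] f g hf hg.
  by split=> // u Du; apply: differentiableM; apply: (@diff_upto_differentiable 0).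
split=> [u Du|i].
  by apply: differentiableM; apply: (@diff_upto_differentiable n.+1).
have h1 := ih _ _ (diff_upto_pd i hf) (diff_uptoS hg).
have h2 := ih _ _ (diff_uptoS hf) (diff_upto_pd i hg).
apply: diff_upto_eq (diff_uptoD h1 h2) => u Du.
have hfu := diff_upto_dir (delta_mx 0 i) hf Du.
have hgu := diff_upto_dir (delta_mx 0 i) hg Du.
by rewrite /pd; have [_ ->] := has_dir_derivM hfu hgu.
Qed.

Lemma diff_uptoZ n c f : diff_upto n f -> diff_upto n (fun u => c * f u).
Proof. by move=> hf; apply: diff_uptoM => //; apply: diff_upto_cst. Qed.

Lemma diff_uptoB n f g : diff_upto n f -> diff_upto n g ->
  diff_upto n (fun u => f u - g u).
Proof.
move=> hf /(diff_uptoZ (-1)) hg.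
by apply: diff_upto_eq (diff_uptoD hf hg) => u _; rewrite mulN1r.
Qed.

Lemma diff_uptoV n f : (forall u, D u -> f u != 0) -> diff_upto n f ->
  diff_upto n (fun u => (f u)^-1).
Proof.
move=> f0; have dV m u : diff_upto m f -> D u -> differentiable (fun w => (f w)^-1) u.
  by move=> hf Du; have [] := has_dir_derivV (f0 _ Du) (diff_upto_dir 0 hf Du).
elim: n => [|n ih] hf; first by split=> // u; exact: dV hf.
split=> [u|i]; first exact: dV hf.
have hV := ih (diff_uptoS hf).
apply: diff_upto_eq
  (diff_uptoM (diff_uptoZ (-1) (diff_uptoM hV hV)) (diff_upto_pd i hf)) => u Du.
have hfu := diff_upto_dir (delta_mx 0 i) hf Du.
rewrite /pd; have [_ ->] := has_dir_derivV (f0 _ Du) hfu.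
by rewrite mulN1r expr2 invfM.
Qed.

Lemma diff_upto_sum n (I : Type) (r : seq I) (P : pred I) (F : I -> plane -> R) :
  (forall i, P i -> diff_upto n (F i)) ->
  diff_upto n (fun u => \sum_(i <- r | P i) F i u).
Proof.
move=> h; elim: r => [|i r ih].
  by apply: diff_upto_eq (diff_upto_cst n 0) => u _; rewrite big_nil.
case Pi : (P i).
  by apply: diff_upto_eq (diff_uptoD (h i Pi) ih) => u _; rewrite big_cons Pi.
by apply: diff_upto_eq ih => u _; rewrite big_cons Pi.
Qed.

Lemma diff_upto_prod n (I : Type) (r : seq I) (P : pred I) (F : I -> plane -> R) :
  (forall i, P i -> diff_upto n (F i)) ->
  diff_upto n (fun u => \prod_(i <- r | P i) F i u).
Proof.
move=> h; elim: r => [|i r ih].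
  by apply: diff_upto_eq (diff_upto_cst n 1) => u _; rewrite big_nil.
case Pi : (P i).
  by apply: diff_upto_eq (diff_uptoM (h i Pi) ih) => u _; rewrite big_cons Pi.
by apply: diff_upto_eq ih => u _; rewrite big_cons Pi.
Qed.

Definition mx_diff_upto (n p q : nat) (A : plane -> 'M[R]_(p, q)) : Prop :=
  forall i j, diff_upto n (fun u => A u i j).

Lemma mx_diff_upto_mul n p q r (A : plane -> 'M[R]_(p, q))
    (B : plane -> 'M[R]_(q, r)) :
  mx_diff_upto n A -> mx_diff_upto n B -> mx_diff_upto n (fun u => A u *m B u).
Proof.
move=> hA hB i j.
apply: (diff_upto_eq (f := fun u => \sum_k A u i k * B u k j)).
  by move=> u _; rewrite mxE.
by apply: diff_upto_sum => k _; apply: diff_uptoM.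
Qed.

Lemma diff_upto_det n p (A : plane -> 'M[R]_p) :
  mx_diff_upto n A -> diff_upto n (fun u => \det (A u)).
Proof.
move=> hA; apply: diff_upto_sum => s _; apply: diff_uptoZ.
by apply: diff_upto_prod => i _; apply: hA.
Qed.

(** The adjugate formula makes the inverse a rational function of the entries. *)
Lemma mx_diff_upto_inv n p (A : plane -> 'M[R]_p) :
  (forall u, D u -> A u \in unitmx) -> mx_diff_upto n A ->
  mx_diff_upto n (fun u => invmx (A u)).
Proof.
move=> uA hA i j.
apply: (diff_upto_eq (f := fun u => (\det (A u))^-1 * cofactor (A u) j i)).
  by move=> u Du; rewrite /invmx uA // !mxE.
apply: diff_uptoM.
  apply: diff_uptoV => [u Du|]; last exact: diff_upto_det.
  by have := uA _ Du; rewrite unitmxE unitfE.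
apply: diff_uptoZ; apply: diff_upto_det => k l.
by apply: diff_upto_eq (hA (lift j k) (lift i l)) => u _; rewrite !mxE.
Qed.

End IteratedDifferentiability.

Lemma diff_upto_sub {R : realType} (D D' : set 'rV[R]_2) n (f : 'rV[R]_2 -> R) :
  D' `<=` D -> diff_upto D n f -> diff_upto D' n f.
Proof.
move=> DD; elim: n f => [|n ih] f [df pf].
  by split=> // u /DD/df.
by split=> [u /DD/df //|i]; apply: ih; apply: pf.
Qed.

Section SmoothComponents.
Context {R : realType} {p q : nat}.
Implicit Types (D : set 'rV[R]_2) (F : 'rV[R]_2 -> 'M[R]_(p.+1, q.+1)).

Lemma mx_entry_differentiable F u i j :
  differentiable F u -> differentiable (fun w => F w i j) u.
Proof.
move=> dF; exact: (@differentiable_comp _ _ _ _ F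
  (fun M : 'M[R]_(p.+1, q.+1) => M i j) _ dF (differentiable_coord _ i j)).
Qed.

Lemma mx_entry_derive F u v i j :
  differentiable F u -> 'D_v F u i j = 'D_v (fun w => F w i j) u.
Proof. by move=> dF; rewrite derive_mx ?mxE //; apply: diff_derivable. Qed.

Lemma smooth_on_pd D F k : smooth_on D F -> smooth_on D (pd k F).
Proof. by move=> hF s u Du; rewrite -foldr_rcons; apply: hF. Qed.

Lemma smooth_on_diff_upto D F n : open D -> smooth_on D F -> mx_diff_upto D n F.
Proof.
move=> oD; elim: n F => [|n ih] F hF i j.
  by split=> // u Du; apply: mx_entry_differentiable; apply: (hF [::]).
split=> [u Du|k]; first by apply: mx_entry_differentiable; apply: (hF [::]).
apply: (diff_upto_eq oD) (ih _ (smooth_on_pd k hF) i j) => u Du.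
by rewrite /pd mx_entry_derive //; apply: (hF [::]).
Qed.

End SmoothComponents.

(** * Mean values, symmetry of second derivatives, local inversion *)

Section MeanValue.
Context {R : realType}.
Local Notation plane := 'rV[R]_2.
Implicit Types (f g : plane -> R) (u v w a b : plane).

Lemma is_derive_line f a v t : differentiable f (a + t *: v) ->
  is_derive t 1 (fun s => f (a + s *: v)) ('D_v f (a + t *: v)).
Proof.
move=> df.
have E : (fun h : R => h^-1 *: (((fun s => f (a + s *: v)) \o shift t) (h *: 1)
            - f (a + t *: v))) =
    (fun h : R => h^-1 *: ((f \o shift (a + t *: v)) (h *: v) - f (a + t *: v))).
  apply/funext => h /=; congr (_ *: (f _ - _)).
  by rewrite [h *: 1]mulr1 scalerDl addrCA.
split; first by rewrite /derivable E; apply: diff_derivable.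
by rewrite /derive E.
Qed.

Lemma mean_value f a v :
  (forall t : R, 0 <= t <= 1 -> differentiable f (a + t *: v)) ->
  exists2 c, 0 <= c <= 1 & f (a + v) - f a = 'D_v f (a + c *: v).
Proof.
move=> df; pose g (t : R) := f (a + t *: v).
have dg (t : R) : 0 <= t <= 1 -> is_derive t 1 g ('D_v f (a + t *: v)).
  by move=> /df; apply: is_derive_line.
have [| |c c01] := @MVT_segment R g (fun t => 'D_v f (a + t *: v)) 0 1 ler01.
- by move=> t; rewrite in_itv /= => /andP[t0 t1]; apply: dg; rewrite !ltW.
- apply: derivable_within_continuous => t; rewrite in_itv /= => t01.
  by have [] := dg t t01.
rewrite /g scale1r scale0r addr0 subr0 mulr1 => E.
by exists c => //; rewrite in_itv in c01.
Qed.

Lemma norm_coord_le (p q : nat) (v : 'M[R]_(p.+1, q.+1)) i j : `|v i j| <= `|v|.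
Proof. by rewrite [leRHS]/Num.Def.normr /= mx_normrE (le_bigmax _ _ (i, j)). Qed.

Lemma norm_coord_max (p q : nat) (v : 'M[R]_(p.+1, q.+1)) e :
  0 <= e -> (forall i j, `|v i j| <= e) -> `|v| <= e.
Proof.
move=> e0 h; rewrite [leLHS]/Num.Def.normr /= mx_normrE.
by apply: bigmax_le => // -[i j] _; apply: h.
Qed.

Lemma ball_segment u r a b t : ball u r a -> ball u r b -> 0 <= t <= 1 ->
  ball u r (a + t *: (b - a)).
Proof.
rewrite -!ball_normE /= => ua ub /andP[t0 t1].
have -> : u - (a + t *: (b - a)) = (1 - t) *: (u - a) + t *: (u - b).
  by apply/rowP => i; rewrite !mxE; ring.
apply: le_lt_trans (ler_normD _ _) _; rewrite !normrZ !ger0_norm ?subr_ge0 //.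
have [->|t'] := eqVneq t 0; first by rewrite mul0r addr0 subr0 mul1r.
rewrite [ltRHS](_ : r = (1 - t) * r + t * r); last by ring.
apply: ler_ltD; first by rewrite ler_wpM2l ?subr_ge0 // ltW.
by rewrite ltr_pM2l // lt0r t'.
Qed.

Lemma dir_deriv_bound f u v e : differentiable f u ->
  (forall i, `|pd i f u| <= e) -> `|'D_v f u| <= 2 * e * `|v|.
Proof.
move=> df he; rewrite dir_deriv_linear //.
apply: le_trans (ler_normD _ _) _; rewrite !normrM.
have h0 := ler_pM (normr_ge0 (v 0 0)) (normr_ge0 _) (norm_coord_le v 0 0) (he 0).
have h1 := ler_pM (normr_ge0 (v 0 1)) (normr_ge0 _) (norm_coord_le v 0 1) (he 1).
by apply: le_trans (lerD h0 h1) _; rewrite le_eqVlt; apply/orP; left; apply/eqP; ring.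
Qed.

Lemma ball_lipschitz f u r e a b :
  (forall w, ball u r w -> differentiable f w /\ forall i, `|pd i f w| <= e) ->
  ball u r a -> ball u r b -> `|f b - f a| <= 2 * e * `|b - a|.
Proof.
move=> h ua ub; have [|c c01 E] := @mean_value f a (b - a).
  by move=> t t01; have [] := h _ (ball_segment ua ub t01).
have [df he] := h _ (ball_segment ua ub c01).
by rewrite subrKC in E; rewrite E; apply: dir_deriv_bound.
Qed.

Lemma gradient0_constant f u r :
  (forall w, ball u r w -> differentiable f w /\ forall i, pd i f w = 0) ->
  forall w, ball u r w -> f w = f u.
Proof.
move=> h w uw.
have r0 : 0 < r by move: uw; rewrite -ball_normE /=; apply: le_lt_trans.
have hl : `|f w - f u| <= 2 * 0 * `|w - u|.
  apply: (@ball_lipschitz f u r 0 u w) => //; last exact: ballxx.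
  by move=> w' /h[df E]; split=> // i; rewrite E normr0.
by apply/eqP; rewrite -subr_eq0 -normr_eq0 eq_le normr_ge0 (le_trans hl) // mulr0 mul0r.
Qed.

Lemma derive_translate f c v a :
  'D_v (fun z => f (z + c)) a = 'D_v f (a + c).
Proof.
rewrite /derive.
suff -> : (fun h : R => h^-1 *: (((fun z => f (z + c)) \o shift a) (h *: v)
    - f (a + c))) =
  (fun h : R => h^-1 *: ((f \o shift (a + c)) (h *: v) - f (a + c))) by [].
by apply/funext => h /=; rewrite addrA.
Qed.

(** The second difference of [f] over a small parallelogram is, to second order,
    the iterated derivative taken in either order. *)
Lemma second_difference f u v w e : 0 < e ->
  (\near u, differentiable f u) -> differentiable ('D_v f) u ->
  \forall t \near 0^'+,
    `|f (u + t *: v + t *: w) - f (u + t *: v) - f (u + t *: w) + f u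
      - t ^+ 2 * 'D_w ('D_v f) u| <= e * t ^+ 2.
Proof.
move=> e0 df dp.
pose N := `|v| + `|w| + 1.
have N0 : 0 < N by rewrite /N ltr_wpDl // addr_ge0.
pose e' := e / (2 * N).
have e'0 : 0 < e' by rewrite /e' divr_gt0 // mulr_gt0.
have := differentiable_eps dp e'0.
move=> /(filterI df) /nbhs_ballP[r r0 hr].
have tv0 : 0 < r / N by rewrite divr_gt0.
near=> t.
have t0 : 0 < t by near: t; apply: nbhs_right_gt.
have tr : t < r / N by near: t; apply: nbhs_right_lt.
have inb (c d : R) : 0 <= c <= 1 -> 0 <= d <= 1 ->
    `|c *: (t *: v) + d *: (t *: w)| <= t * N.
  move=> /andP[c0 c1] /andP[d0 d1]; apply: le_trans (ler_normD _ _) _.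
  rewrite !normrZ !(ger0_norm c0, ger0_norm d0, gtr0_norm t0).
  have := normr_ge0 v; have := normr_ge0 w; rewrite /N => W V.
  have : c * (t * `|v|) <= t * `|v| by rewrite ler_piMl // mulr_ge0 // ltW.
  have : d * (t * `|w|) <= t * `|w| by rewrite ler_piMl // mulr_ge0 // ltW.
  by move=> h1 h2; rewrite /N; lra.
have inB (c d : R) : 0 <= c <= 1 -> 0 <= d <= 1 ->
    ball u r (u + (c *: (t *: v) + d *: (t *: w))).
  move=> c01 d01; rewrite -ball_normE /= opprD addrA subrr sub0r normrN.
  by apply: le_lt_trans (inb c d c01 d01) _; rewrite -ltr_pdivlMr.
have i0 : 0 <= (0 : R) <= 1 by rewrite lexx ler01.
have i1 : 0 <= (1 : R) <= 1 by rewrite ler01 lexx.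
pose g (z : plane) := f (z + t *: w) - f z.
have dgt (s : R) : 0 <= s <= 1 -> has_dir_deriv g (u + s *: (t *: v)) (t *: v)
    (t * ('D_v f (u + s *: (t *: v) + t *: w) - 'D_v f (u + s *: (t *: v)))).
  move=> s01.
  have d1 : differentiable f (u + s *: (t *: v) + t *: w).
    by have [] := hr _ (inB s 1 s01 i1); rewrite scale1r addrA.
  have d2 : differentiable f (u + s *: (t *: v)).
    by have [] := hr _ (inB s 0 s01 i0); rewrite scale0r addr0.
  have d1' : differentiable (fun z => f (z + t *: w)) (u + s *: (t *: v)).
    by apply: (@differentiable_comp _ _ _ _ (fun z : plane => z + t *: w) f).
  split; first exact: differentiableB.
  rewrite deriveB; try exact: diff_derivable.
  have sc (h : plane -> R) (z : plane) : differentiable h z -> 'D_(t *: v) h z = t * 'D_v h z :> R.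
    by move=> dh; rewrite !deriveE // linearZ.
  rewrite (sc _ _ d1') (sc _ _ d2) derive_translate.
  by rewrite -mulrBr.
have [|c c01] := @mean_value g u (t *: v).
  by move=> s s01; have [] := dgt s s01.
have [_ ->] := dgt c c01.
rewrite /g => E.
have -> : f (u + t *: v + t *: w) - f (u + t *: v) - f (u + t *: w) + f u =
  t * ('D_v f (u + c *: (t *: v) + t *: w) - 'D_v f (u + c *: (t *: v))).
  by rewrite -E; ring.
have [_] := hr _ (inB c 1 c01 i1); have [_] := hr _ (inB c 0 c01 i0).
rewrite scale1r scale0r addr0 !addrA.
set d := 'd _ u.
have q (a : plane) : u + a - u = a by rewrite addrAC subrr add0r.
have q2 (a b : plane) : u + a + b - u = a + b by rewrite -[u + a + b]addrA q.
rewrite q q2.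
have L (k : R) (z : plane) : d (k *: z) = k * d z by rewrite linearZ.
have L2 (z z' : plane) : d (z + z') = d z + d z' by rewrite linearD.
rewrite L2 !L.
have := inb c 1 c01 i1; have := inb c 0 c01 i0; rewrite scale1r scale0r addr0.
rewrite (deriveE w dp) -/d.
set n1 := `|c *: _|; set n2 := `|_ + t *: w|.
set A := 'D_v f (u + _); set B := 'D_v f (u + _ + _).
rewrite !ler_norml => n1N n2N /andP[a1 a2] /andP[b1 b2].
have m1 : e' * n1 <= t * e / 2.
  apply: le_trans (ler_wpM2l (ltW e'0) n1N) _.
  by rewrite /e' le_eqVlt; apply/orP; left; apply/eqP; field; rewrite gt_eqF.
have m2 : e' * n2 <= t * e / 2.
  apply: le_trans (ler_wpM2l (ltW e'0) n2N) _.
  by rewrite /e' le_eqVlt; apply/orP; left; apply/eqP; field; rewrite gt_eqF.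
have [k1 k2] : - (t * e) <= B - A - t * d w /\ B - A - t * d w <= t * e.
  move: a1 a2 b1 b2 m1 m2; move: (d v) (d w) ('D_v f u) (e' * n1) (e' * n2).
  by clear; move: A B => A B dv dw df0 N1 N2 *; split; lra.
have -> : e * t ^+ 2 = t * (t * e) by ring.
have -> : t * (B - A) - t ^+ 2 * d w = t * (B - A - t * d w) by ring.
by rewrite -[- (t * (t * e))]mulrN !ler_pM2l // k1 k2.
Unshelve. all: by end_near. Qed.

Lemma dir_deriv_commute f u v w : (\near u, differentiable f u) ->
  differentiable ('D_v f) u -> differentiable ('D_w f) u ->
  'D_w ('D_v f) u = 'D_v ('D_w f) u.
Proof.
move=> df dv dw; apply/eqP; rewrite -subr_eq0 -normr_eq0.
apply/negPn/negP => ne; set x := `|_| in ne.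
have x0 : 0 < x by rewrite lt0r ne normr_ge0.
have x3 : 0 < x / 3 by rewrite divr_gt0.
have h1 := second_difference w x3 df dv.
have h2 := second_difference v x3 df dw.
have [t [[+ +] t0]] := filter_ex (filterI (filterI h1 h2) (nbhs_right_gt (0 : R))).
rewrite [u + t *: w + t *: v]addrAC.
move: (f _) (f (u + t *: v)) (f (u + t *: w)) (f u) => S1 S2 S3 S4.
have : `|'D_w ('D_v f) u - 'D_v ('D_w f) u| = x by [].
move: ('D_w ('D_v f) u) ('D_v ('D_w f) u) => p q pqx k3 k4.
have : `|t ^+ 2 * (p - q)| <= 2 * (x / 3) * t ^+ 2.
  move: k3 k4; rewrite !ler_norml => /andP[a1 a2] /andP[b1 b2].
  by clear - a1 a2 b1 b2; apply/andP; split; lra.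
rewrite normrM pqx ger0_norm ?sqr_ge0 //.
have : 0 < t ^+ 2 * x by rewrite mulr_gt0 // exprn_gt0.
by clear; lra.
Qed.

End MeanValue.

Section LocalInversion.
Context {R : realType}.
Local Notation plane := 'rV[R]_2.
Implicit Types (u v w a b : plane).

(* Registers the row vectors as a complete normed module, the setting of the
   contraction principle. *)
HB.instance Definition _ (p q : nat) := Complete.on 'M[R]_(p.+1, q.+1).

Section NearIdentity.
Variables (h : plane -> plane) (u : plane) (r : R).
Hypothesis h_lip : forall a b, ball u r a -> ball u r b ->
  `|h a - h b| <= 2^-1 * `|a - b|.

Lemma near_identity_injective a b : ball u r a -> ball u r b ->
  a + h a = b + h b -> a = b.
Proof.
move=> ua ub E; have := h_lip ua ub.
have -> : h a - h b = b - a.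
  by apply/eqP; rewrite subr_eq addrAC -E addrAC subrr add0r.
rewrite distrC => H; apply/eqP; rewrite -subr_eq0 -normr_eq0.
have := normr_ge0 (a - b); move: `|a - b| H => z *.
by apply/eqP; lra.
Qed.

(** The equation [w + h w = p] is the fixed point equation of [w |-> p - h w], a
    contraction of a small closed ball. *)
Lemma near_identity_open (O : set plane) : open O -> O `<=` ball u r ->
  open ((fun w => w + h w) @` O).
Proof.
move=> oO Ou; rewrite openE => _ [v Ov <-].
have /open_nbhs_nbhs/nbhs_ballP[d d0 dO] : open_nbhs v O by [].
have d20 : 0 < d / 2 by rewrite divr_gt0.
pose U := [set w | `|w - v| <= d / 2].
have UO : U `<=` O.
  move=> w /= wv; apply: dO; rewrite -ball_normE /= distrC.
  by apply: le_lt_trans wv _; lra.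
apply/nbhs_ballP; exists (d / 4); first by rewrite /= divr_gt0.
move=> p; rewrite -ball_normE /= => pv.
pose T (w : plane) := p - h w.
have Ulip a b : U a -> U b -> `|T a - T b| <= 2^-1 * `|a - b|.
  move=> Ua Ub; rewrite /T opprB addrC addrA subrK distrC.
  by apply: h_lip; apply: Ou; apply: UO.
have UT : set_fun U U T.
  move=> w Uw; rewrite /U /= /T.
  have -> : p - h w - v = (p - (v + h v)) + (h v - h w).
    by rewrite opprD !addrA subrK addrAC.
  have Uv : U v by rewrite /U /= subrr normr0 ltW.
  apply: le_trans (ler_normD _ _) _.
  have := h_lip (Ou _ (UO _ Uv)) (Ou _ (UO _ Uw)).
  move: Uw pv; rewrite /U /= distrC => k1; rewrite distrC => k2 k3.
  lra.
pose TF : {fun U >-> U} := mkfun UT.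
have cT : is_contraction TF.
  exists (2^-1)%:nng; split; first by rewrite /= invf_lt1 // ltr1n.
  by move=> [a b] [/= Ua Ub]; apply: Ulip.
have cU : closed U.
  rewrite (_ : U = closed_ball v (d / 2)); first exact: closed_ball_closed.
  by rewrite closed_ballE //; apply/funext => w; rewrite /U /closed_ball_ /= distrC.
have U0 : U !=set0 by exists v; rewrite /U /= subrr normr0 ltW.
have [w Uw E] := banach_fixed_point cT cU U0.
exists w; first exact: UO.
by rewrite {1}E /= /T subrK.
Qed.

End NearIdentity.

Lemma plane_norm_le v e : 0 <= e -> (forall j, `|v 0 j| <= e) -> `|v| <= e.
Proof. by move=> e0 h; apply: norm_coord_max => // i j; rewrite ord1. Qed.

(** The difference of [F] and the identity has small derivatives near [u]. *)
Lemma identity_gradient_inversion (D : set plane) (F : plane -> plane) u :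
  open D -> D u -> mx_diff_upto D 1 F ->
  (forall i j, pd i (fun w => F w 0 j) u = (i == j)%:R) ->
  exists2 r, 0 < r & [/\ ball u r `<=` D,
    (forall a b, ball u r a -> ball u r b -> F a = F b -> a = b) &
    forall O, open O -> O `<=` ball u r -> open (F @` O)].
Proof.
move=> oD Du dF F1.
pose h w := F w - w.
have hE j : (fun w => h w 0 j) = (fun w => F w 0 j - w 0 j).
  by apply/funext => w; rewrite !mxE.
have cd (w : plane) i j : has_dir_deriv (fun w => w 0 j) w (delta_mx 0 i) (i == j)%:R.
  split; first exact: differentiable_coord.
  rewrite -(mx_entry_derive (F := id)); last first.
    exact: ex_diff.
  by rewrite derive_id !mxE eqxx eq_sym.
have hd w i j : D w -> has_dir_deriv (fun w => h w 0 j) w (delta_mx 0 i)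
    (pd i (fun w => F w 0 j) w - (i == j)%:R).
  move=> Dw; rewrite hE; apply: has_dir_derivB; last exact: cd.
  by apply: has_dir_deriv_of; apply: diff_upto_differentiable (dF 0 j) Dw.
have small i j : \forall w \near u,
    `|pd i (fun w => F w 0 j) w - (i == j)%:R| <= 4^-1.
  have dp : differentiable (pd i (fun w => F w 0 j)) u.
    by have [_ /(_ i) [h1 _]] := dF 0 j; apply: h1.
  have /cvgrPdist_le := differentiable_continuous dp.
  move=> /(_ 4^-1 ltac:(by rewrite invr_gt0)); apply: filterS => w.
  by rewrite F1 distrC.
have h1 : \forall w \near u, D w by exact: open_nbhs_nbhs.
have h2 : \forall w \near u, forall i j : 'I_2,
    `|pd i (fun w => F w 0 j) w - (i == j)%:R| <= 4^-1.
  apply: (@filter_forall _ _ (fun i w => forall j : 'I_2,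
    `|pd i (fun w => F w 0 j) w - (i == j)%:R| <= 4^-1) (nbhs u)) => i.
  apply: (@filter_forall _ _
    (fun j w => `|pd i (fun w => F w 0 j) w - (i == j)%:R| <= 4^-1) (nbhs u)) => j.
  exact: small.
have /nbhs_ballP[r /= r0 hr] : nbhs u (fun w => D w /\ forall i j : 'I_2,
    `|pd i (fun w => F w 0 j) w - (i == j)%:R| <= 4^-1) by exact: filterI h1 h2.
have hlip a b : ball u r a -> ball u r b -> `|h a - h b| <= 2^-1 * `|a - b|.
  move=> ua ub; apply: plane_norm_le => [|j]; first by rewrite mulr_ge0.
  have := @ball_lipschitz R (fun w => h w 0 j) u r 4^-1 b a _ ub ua.
  rewrite !mxE => L; apply: le_trans (L _) _ => [w uw|].
    have [Dw sw] := hr _ uw; split; first by have [] := hd w 0 j Dw.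
    by move=> i; rewrite /pd; have [_ ->] := hd w i j Dw; apply: sw.
  by rewrite (_ : 2 * 4^-1 = 2^-1) //; lra.
have FE : F = (fun w => w + h w).
  by apply/funext => w; rewrite /h addrC subrK.
exists r => //; split.
- by move=> w /hr[].
- move=> a b ua ub; rewrite FE.
  exact: (near_identity_injective hlip).
- by move=> O; rewrite FE; apply: near_identity_open.
Qed.

Lemma mulmxr_continuous (p q s : nat) (A : 'M[R]_(q.+1, s.+1)) :
  continuous (fun z : 'M[R]_(p.+1, q.+1) => z *m A).
Proof.
move=> z B /nbhs_ballP[e /= e0 eB].
pose C := \sum_k \sum_j `|A k j| + 1.
have C0 : 0 < C by rewrite ltr_wpDl // sumr_ge0 // => k _; rewrite sumr_ge0.
apply/nbhs_ballP; exists (e / C); first by rewrite /= divr_gt0.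
move=> w; rewrite -ball_normE /= ltr_pdivlMr // => zw.
apply: eB; rewrite -ball_normE /= -mulmxBl; apply: le_lt_trans zw.
apply: norm_coord_max => [|i j]; first by rewrite mulr_ge0 // ltW.
rewrite mxE; apply: le_trans (ler_norm_sum _ _ _) _.
rewrite mulrDr mulr1 mulr_sumr.
apply: (@le_trans _ _ (\sum_k `|z - w| * \sum_j `|A k j|)); last by rewrite lerDl.
apply: ler_sum => k _; rewrite normrM; apply: ler_pM => //.
  exact: norm_coord_le.
by rewrite (bigD1 j) //= lerDl sumr_ge0.
Qed.

Definition jacobian_mx (F : plane -> plane) u : 'M[R]_2 :=
  \matrix_(i, j) pd i (fun w => F w 0 j) u.

Lemma local_inversion (D : set plane) (F : plane -> plane) u :
  open D -> D u -> mx_diff_upto D 1 F -> jacobian_mx F u \in unitmx ->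
  exists2 r, 0 < r & [/\ ball u r `<=` D,
    (forall a b, ball u r a -> ball u r b -> F a = F b -> a = b) &
    forall O, open O -> O `<=` ball u r -> open (F @` O)].
Proof.
move=> oD Du dF uJ; set J := jacobian_mx F u in uJ.
pose G w := F w *m invmx J.
have dG : mx_diff_upto D 1 G.
  by apply: mx_diff_upto_mul => // i j; apply: diff_upto_cst.
have G1 i j : pd i (fun w => G w 0 j) u = (i == j)%:R.
  have -> : (i == j)%:R = (J *m invmx J) i j by rewrite mulmxV // mxE.
  have -> : (fun w => G w 0 j) = (fun w => \sum_k (F w 0 k * invmx J k j)).
    by apply/funext => w; rewrite mxE.
  rewrite {1}/pd; have [_ ->] : has_dir_deriv (fun w => \sum_k F w 0 k * invmx J k j) u
      (delta_mx 0 i) (\sum_k (pd i (fun w => F w 0 k) u * invmx J k j)).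
    apply: has_dir_deriv_sum => k _.
    have k1 := diff_upto_dir (delta_mx 0 i) (dF 0 k) Du.
    have := has_dir_derivM k1 (has_dir_deriv_cst (invmx J k j) u (delta_mx 0 i)).
    by rewrite mulr0 addr0.
  by rewrite mxE; apply: eq_bigr => k _; rewrite mxE.
have [r r0 [rD inj opn]] := identity_gradient_inversion oD Du dG G1.
have FG w : F w = G w *m J by rewrite /G mulmxKV.
exists r => //; split=> // [a b ua ub E|O oO Or].
  by apply: inj => //; rewrite /G E.
rewrite (_ : F @` O = (fun z => z *m invmx J) @^-1` (G @` O)).
  apply: open_comp; last exact: opn.
  by move=> z _; apply: mulmxr_continuous.
apply/seteqP; split=> [_ [w Ow <-]|z [w Ow E]]; first by exists w.
by exists w => //; rewrite FG E mulmxKV.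
Qed.

End LocalInversion.

(** * Entrywise derivatives of matrix functions *)

Section MatrixDerivative.
Context {R : realType}.
Local Notation plane := 'rV[R]_2.
Variable (D : set plane).
Hypothesis oD : open D.

Definition mxd (p q : nat) (m : 'I_2) (A : plane -> 'M[R]_(p, q)) (u : plane) :
  'M[R]_(p, q) := \matrix_(i, j) pd m (fun w => A w i j) u.

Lemma mxd_eq p q m (A B : plane -> 'M[R]_(p, q)) u :
  (forall w, D w -> A w = B w) -> D u -> mxd m A u = mxd m B u.
Proof.
move=> AB Du; apply/matrixP => i j; rewrite !mxE.
by apply: (open_eq_pd m oD) => // w Dw; rewrite AB.
Qed.

Lemma mxd_cst p q m (A : 'M[R]_(p, q)) u : mxd m (fun=> A) u = 0.
Proof.
apply/matrixP => i j; rewrite !mxE /pd.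
by have [_ ->] := has_dir_deriv_cst (A i j) u (delta_mx 0 m).
Qed.

Lemma mxd_tr p q m (A : plane -> 'M[R]_(p, q)) u :
  mxd m (fun w => (A w)^T) u = (mxd m A u)^T.
Proof.
apply/matrixP => i j; rewrite !mxE; congr (pd m _ u).
by apply/funext => w; rewrite mxE.
Qed.

Lemma mxdM p q r m n (A : plane -> 'M[R]_(p, q)) (B : plane -> 'M[R]_(q, r)) u :
  mx_diff_upto D n A -> mx_diff_upto D n B -> D u ->
  mxd m (fun w => A w *m B w) u = mxd m A u *m B u + A u *m mxd m B u.
Proof.
move=> dA dB Du; apply/matrixP => i j; rewrite !mxE.
have -> : (fun w => (A w *m B w) i j) = (fun w => \sum_k A w i k * B w k j).
  by apply/funext => w; rewrite mxE.
have [_] : has_dir_deriv (fun w => \sum_k A w i k * B w k j) u (delta_mx 0 m)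
   (\sum_k (pd m (fun w => A w i k) u * B u k j + A u i k * pd m (fun w => B w k j) u)).
  apply: has_dir_deriv_sum => k _.
  by apply: has_dir_derivM; apply: has_dir_deriv_of;
    [apply: diff_upto_differentiable (dA i k) Du|apply: diff_upto_differentiable (dB k j) Du].
move=> E; apply: etrans E _; rewrite big_split /=; congr (_ + _);
  by apply: eq_bigr => k _; rewrite !mxE.
Qed.

Lemma mx_diff_upto_cst n p q (A : 'M[R]_(p, q)) : mx_diff_upto D n (fun=> A).
Proof. by move=> i j; apply: diff_upto_cst. Qed.

Lemma mx_diff_upto_tr n p q (A : plane -> 'M[R]_(p, q)) :
  mx_diff_upto D n A -> mx_diff_upto D n (fun w => (A w)^T).
Proof. by move=> dA i j; apply: (diff_upto_eq oD) (dA j i) => w _; rewrite mxE. Qed.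

Lemma mx_diff_uptoS n p q (A : plane -> 'M[R]_(p, q)) :
  mx_diff_upto D n.+1 A -> mx_diff_upto D n A.
Proof. by move=> dA i j; apply: diff_uptoS. Qed.

Lemma pd_commute (f : plane -> R) i j u : diff_upto D 1 f -> D u ->
  pd i (pd j f) u = pd j (pd i f) u.
Proof.
move=> df Du; have dp k : differentiable (pd k f) u.
  by apply: diff_upto_differentiable (diff_upto_pd k df) Du.
apply: dir_deriv_commute; [|exact: dp|exact: dp].
near=> w; apply: (diff_upto_differentiable df).
by near: w; apply: open_nbhs_nbhs.
Unshelve. all: by end_near. Qed.

End MatrixDerivative.

Lemma mxd0_constant {R : realType} (p q : nat) (A : 'rV[R]_2 -> 'M[R]_(p, q)) u r n :
  mx_diff_upto (ball u r) n A ->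
  (forall w, ball u r w -> forall m, mxd m A w = 0) ->
  forall w, ball u r w -> A w = A u.
Proof.
move=> dA A0 w uw; apply/matrixP => i j.
apply: (@gradient0_constant _ (fun w => A w i j) u r) uw => v uv; split.
  exact: diff_upto_differentiable (dA i j) uv.
by move=> m; move/matrixP: (A0 v uv m) => /(_ i j); rewrite !mxE.
Qed.

Lemma sum_ord2 {R : pzSemiRingType} (F : 'I_2 -> R) : \sum_(i < 2) F i = F 0 + F 1.
Proof.
by rewrite big_ord_recl big_ord1; congr (_ + F _); apply/val_inj.
Qed.

Lemma mulmx2E {R : pzSemiRingType} p q (A : 'M[R]_(p, 2)) (B : 'M[R]_(2, q)) i j :
  (A *m B) i j = A i 0 * B 0 j + A i 1 * B 1 j.
Proof. by rewrite mxE sum_ord2. Qed.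

Lemma row_comb_entry {R : comPzRingType} n (P Y : 'rV[R]_n) (a : 'I_2 -> R)
    (Q : 'I_2 -> 'rV[R]_n) b e c :
  P = \sum_k a k *: Q k + b *: (- e *: Y) ->
  P 0 c = a 0 * Q 0 0 c + a 1 * Q 1 0 c - e * b * Y 0 c.
Proof. by move=> ->; rewrite !mxE summxE sum_ord2 !mxE; ring. Qed.

Lemma unit_frame_independent {R : comUnitRingType} (T : 'M[R]_(2, 3)) (Y : 'rV[R]_3)
    e a0 a1 b : e * e = 1 -> (col_mx T (- e *: Y) : 'M[R]_(2 + 1)) \in unitmx ->
  (forall c, a0 * T 0 c + a1 * T 1 c + b * Y 0 c = 0) -> [/\ a0 = 0, a1 = 0 & b = 0].
Proof.
move=> e2 uF E; set F := col_mx _ _ in uF.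
pose v : 'rV[R]_(2 + 1) := row_mx (\row_(k < 2) if k == 0 then a0 else a1) (- e * b)%:M.
have vF : v *m F = 0.
  rewrite mul_row_col; apply/rowP => c; rewrite !mxE sum_ord2 big_ord1 !mxE /= -[RHS](E c).
  by rewrite mulr1n; ring: e2.
have v0 : v = 0 by rewrite -[v]mulmx1 -(mulmxV uF) mulmxA vF mul0mx.
have c0 i : v 0 i = 0 by rewrite v0 mxE.
have := c0 (lshift 1 0); have := c0 (lshift 1 1); have := c0 (rshift 2 0).
rewrite /v row_mxEr !row_mxEl !mxE /= mulr1n => b0 -> ->; split=> //.
by rewrite -[b]mul1r -e2 -mulrA -[e * b]opprK -mulNr b0 oppr0 mulr0.
Qed.

Lemma sqr1_neq0 {R : nzRingType} (e : R) : e * e = 1 -> e != 0.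
Proof.
by move=> e2; apply/eqP => e0; move: e2; rewrite e0 mulr0 => /eqP; rewrite eq_sym oner_eq0.
Qed.

Lemma half_sum_swap {R : realFieldType} (a b c d : R) :
  b = a -> a = 2^-1 * (a + c - d) + 2^-1 * (b + d - c).
Proof. by move=> ->; lra. Qed.

Lemma ord2P (P : 'I_2 -> Prop) : P 0 -> P 1 -> forall i, P i.
Proof.
move=> P0 P1 [[|[|k]] hk] //.
  by rewrite (_ : Ordinal hk = 0) //; apply/val_inj.
by rewrite (_ : Ordinal hk = 1) //; apply/val_inj.
Qed.

Lemma pdE {R : realType} {V : normedModType R} i (f : 'rV[R]_2 -> V) u :
  pd i f u = 'D_(delta_mx 0 i) f u.
Proof. by []. Qed.

Lemma pd_case {R : realType} m (f : 'rV[R]_2 -> R) u :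
  pd m f u = (m == 0)%:R * pd 0 f u + (m == 1)%:R * pd 1 f u.
Proof. by move: m; apply: ord2P; rewrite ?eqxx /= mul1r mul0r ?addr0 ?add0r. Qed.

(* Keeps unification from unfolding limits of difference quotients. *)
Local Opaque pd derive.

(** * Local centroaffine geometry in a chart *)

(** What a chart of the surface provides, apart from the parallelism of the cubic
    form. *)
Record convex_patch {R : realType} (eps : R) (D : set 'rV[R]_2)
    (y : 'rV[R]_2 -> 'rV[R]_3) : Prop := ConvexPatch {
  patch_eps2 : eps * eps = 1;
  patch_open : open D;
  patch_smooth : smooth_on D y;
  patch_free : forall u, D u -> row_free (tangent y u);
  patch_transversal : forall u, D u -> ~~ (y u <= tangent y u)%MS;
  patch_convex : forall u, D u -> forall v : 'rV[R]_2, v != 0 ->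
    0 < (v *m metric_mx eps y u *m v^T) 0 0
}.

Section ChartGeometry.
Context {R : realType}.
Local Notation plane := 'rV[R]_2.
Variables (eps : R) (D : set plane) (y : plane -> 'rV[R]_3).
Hypothesis patch : convex_patch eps D y.

Let eps2 := patch_eps2 patch.
Let oD := patch_open patch.
Let smooth_y := patch_smooth patch.

Local Notation h := (metric eps y).
Local Notation G := (conn eps y).
Local Notation L := (LC eps y).
Local Notation C := (cubic eps y).
Local Notation H := (metric_mx eps y).

Lemma eps_neq0 : eps != 0.
Proof. exact: sqr1_neq0 eps2. Qed.

Lemma frame_unitmx u : D u -> frame eps y u \in unitmx.
Proof.
move=> Du; apply: frame_unit; first exact: eps_neq0.
  exact: (patch_free patch).
exact: (patch_transversal patch).
Qed.

Lemma diff_upto_y n : mx_diff_upto D n y.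
Proof. exact: smooth_on_diff_upto. Qed.

Lemma diff_upto_pd_y n k : mx_diff_upto D n (pd k y).
Proof. by apply: smooth_on_diff_upto => //; apply: smooth_on_pd. Qed.

Lemma diff_upto_pd2_y n i j : mx_diff_upto D n (pd i (pd j y)).
Proof.
by apply: smooth_on_diff_upto => //; apply: smooth_on_pd; apply: smooth_on_pd.
Qed.

Lemma diff_upto_tangent n : mx_diff_upto D n (tangent y).
Proof.
by move=> k j; apply: (diff_upto_eq oD) (diff_upto_pd_y n k 0 j) => u _; rewrite !mxE.
Qed.

Lemma diff_upto_frame n : mx_diff_upto D n (frame eps y).
Proof.
move=> i j; rewrite /frame; case: (split_ordP i) => k ->.
  by apply: (diff_upto_eq oD) (diff_upto_tangent n k j) => u _; rewrite col_mxEu.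
apply: (diff_upto_eq oD) (diff_uptoZ oD (- eps) (diff_upto_y n 0 j)) => u _.
by rewrite col_mxEd !mxE ord1.
Qed.

Lemma diff_upto_gauss_coef n i j : mx_diff_upto D n (gauss_coef eps y i j).
Proof.
apply: mx_diff_upto_mul => //; first exact: diff_upto_pd2_y.
apply: mx_diff_upto_inv => //; [exact: frame_unitmx|exact: diff_upto_frame].
Qed.

Lemma diff_upto_metric n i j : diff_upto D n (h i j).
Proof.
apply: (diff_upto_eq oD) (diff_upto_gauss_coef n i j 0 (rshift 2 0)) => u _.
by rewrite [RHS]mxE.
Qed.

Lemma diff_upto_conn n k i j : diff_upto D n (G k i j).
Proof.
apply: (diff_upto_eq oD) (diff_upto_gauss_coef n i j 0 (lshift 1 k)) => u _.
by rewrite [RHS]mxE.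
Qed.

Lemma diff_upto_metric_mx n : mx_diff_upto D n H.
Proof.
by move=> i j; apply: (diff_upto_eq oD) (diff_upto_metric n i j) => u _; rewrite mxE.
Qed.

Lemma diff_upto_cubic n i j k : diff_upto D n (C i j k).
Proof.
apply: diff_uptoB => //; first by apply: diff_upto_pd; apply: diff_upto_metric.
apply: diff_upto_sum => // l _; apply: diff_uptoD => //; apply: diff_uptoM => //;
  first [exact: diff_upto_conn|exact: diff_upto_metric].
Qed.

Lemma pd_entry k u c : D u -> pd k y u 0 c = pd k (fun w => y w 0 c) u.
Proof. by move=> Du; rewrite !pdE mx_entry_derive //; apply: (smooth_y [::]). Qed.

Lemma pd2_entry i j u c : D u ->
  pd i (pd j y) u 0 c = pd i (pd j (fun w => y w 0 c)) u.
Proof.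
move=> Du; rewrite [in LHS]pdE mx_entry_derive; last by apply: (smooth_y [:: j]).
by apply: (open_eq_pd i oD) => // w Dw; apply: pd_entry.
Qed.

Lemma pd2_commute i j u : D u -> pd i (pd j y) u = pd j (pd i y) u.
Proof.
move=> Du.
have E := pd_commute oD i j (diff_upto_y 1 0 _) Du.
apply/rowP => c.
have E1 := pd2_entry i j c Du.
have E2 := pd2_entry j i c Du.
apply: etrans E1 _.
apply: etrans (esym E2).
exact: E.
Qed.

Lemma metric_coef_sym i j u : D u -> h i j u = h j i u.
Proof. by move=> Du; rewrite /metric /gauss_coef pd2_commute. Qed.

Lemma conn_sym k i j u : D u -> G k i j u = G k j i u.
Proof. by move=> Du; rewrite /conn /gauss_coef pd2_commute. Qed.

Local Opaque metric conn.

(** The Gauss formula in scalar form, to which the calculus of scalar functions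
    applies. *)
Lemma gauss_entry i j u c : D u -> let f w := y w 0 c in
  pd i (pd j f) u = G 0 i j u * pd 0 f u + G 1 i j u * pd 1 f u - eps * h i j u * f u.
Proof.
move=> Du f; apply: etrans (esym (pd2_entry i j c Du)) _.
have E := row_comb_entry c (gauss_formula i j (frame_unitmx Du)).
apply: etrans E _; congr (_ * _ + _ * _ - _); exact: pd_entry.
Qed.

Lemma frame_independent u a0 a1 b : D u ->
  (forall c, a0 * pd 0 (fun w => y w 0 c) u + a1 * pd 1 (fun w => y w 0 c) u
             + b * y u 0 c = 0) -> [/\ a0 = 0, a1 = 0 & b = 0].
Proof.
move=> Du E; apply: (unit_frame_independent eps2 (frame_unitmx Du)) => c.
rewrite -[RHS](E c) [tangent y u 0 c]mxE [tangent y u 1 c]mxE.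
by congr (_ * _ + _ * _ + _); apply: pd_entry.
Qed.

Lemma cubicE i j k u : C i j k u = pd i (h j k) u
  - (G 0 i j u * h 0 k u + G 0 i k u * h j 0 u)
  - (G 1 i j u * h 1 k u + G 1 i k u * h j 1 u).
Proof. by rewrite /cubic sum_ord2 opprD addrA. Qed.

Lemma dcubicE m i j k u : dcubic eps y m i j k u = pd m (C i j k) u
  - (L 0 m i u * C 0 j k u + L 0 m j u * C i 0 k u + L 0 m k u * C i j 0 u)
  - (L 1 m i u * C 1 j k u + L 1 m j u * C i 1 k u + L 1 m k u * C i j 1 u).
Proof. by rewrite /dcubic sum_ord2 opprD addrA. Qed.

Lemma LC_sym k i j u : D u -> L k i j u = L k j i u.
Proof.
move=> Du.
have E l : pd i (h j l) u + pd j (h i l) u - pd l (h i j) u =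
    pd j (h i l) u + pd i (h j l) u - pd l (h j i) u.
  apply: (f_equal2 (fun a b => a - b)); first exact: addrC.
  by apply: (open_eq_pd l oD _ Du) => w Dw; apply: metric_coef_sym.
rewrite /LC; apply: (f_equal (fun s => 2^-1 * s)).
apply: eq_bigr => l _; apply: (f_equal (fun s => _ * s)); exact: E.
Qed.

Lemma metric_unitmx u : D u -> H u \in unitmx.
Proof.
move=> Du; rewrite -row_free_unit -kermx_eq0; apply/negPn/negP.
move=> /rowV0Pn[v vH v0].
have := patch_convex patch Du v0.
by move/sub_kermxP: vH => ->; rewrite mul0mx mxE ltxx.
Qed.

Lemma metric_mx_sym u : D u -> (H u)^T = H u.
Proof. by move=> Du; apply/matrixP => i j; rewrite !mxE; apply: metric_coef_sym. Qed.

(** Christoffel matrix: [row j] holds the components of the covariant derivative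
    of the [j]-th coordinate field along the [m]-th one. *)
Definition LC_mx m u : 'M[R]_2 := \matrix_(j, k) L k m j u.

Lemma LC_lowered m j p u : D u ->
  (LC_mx m u *m H u) j p =
  2^-1 * (pd m (h j p) u + pd j (h m p) u - pd p (h m j) u).
Proof.
move=> Du.
pose w : 'rV[R]_2 :=
  \row_l (2^-1 * (pd m (h j l) u + pd j (h m l) u - pd l (h m j) u)).
have rowE : row j (LC_mx m u) = w *m (invmx (H u))^T.
  apply/rowP => k; rewrite !mxE /LC mulr_sumr; apply: eq_bigr => l _.
  by rewrite ![w _ _]mxE [(invmx _)^T _ _]mxE mulrCA mulrC.
have -> : (LC_mx m u *m H u) j p = (row j (LC_mx m u) *m H u) 0 p.
  by rewrite -row_mul [RHS]mxE.
rewrite rowE trmx_inv metric_mx_sym // mulmxKV ?metric_unitmx //.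
by rewrite mxE.
Qed.

(** The Levi-Civita connection preserves the metric. *)
Lemma mxd_metric m u : D u ->
  mxd m H u = LC_mx m u *m H u + H u *m (LC_mx m u)^T.
Proof.
move=> Du; apply/matrixP => i j; rewrite [RHS]mxE [LHS]mxE.
have -> : (H u *m (LC_mx m u)^T) i j = (LC_mx m u *m H u) j i.
  by rewrite -{1}(metric_mx_sym Du) -trmx_mul mxE.
rewrite !LC_lowered //.
have E1 : pd m (fun w => H w i j) u = pd m (h i j) u.
  by apply: (open_eq_pd m oD _ Du) => w _; rewrite mxE.
have E2 : pd m (h j i) u = pd m (h i j) u.
  by apply: (open_eq_pd m oD _ Du) => w Dw; apply: metric_coef_sym.
apply: etrans E1 _; exact: (half_sum_swap _ _ E2).
Qed.

(** Differentiating the Gauss formula once more: both sides of the equality of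
    mixed third derivatives have the same component along the position vector. *)
Lemma codazzi m i j u : D u ->
  pd m (h i j) u + G 0 i j u * h m 0 u + G 1 i j u * h m 1 u =
  pd i (h m j) u + G 0 m j u * h i 0 u + G 1 m j u * h i 1 u.
Proof.
move=> Du.
have third (n k : 'I_2) c : let f w := y w 0 c in
  pd n (pd k (pd j f)) u =
   (pd n (G 0 k j) u + G 0 k j u * G 0 n 0 u + G 1 k j u * G 0 n 1 u
      - eps * h k j u * (n == 0)%:R) * pd 0 f u
   + (pd n (G 1 k j) u + G 0 k j u * G 1 n 0 u + G 1 k j u * G 1 n 1 u
      - eps * h k j u * (n == 1)%:R) * pd 1 f u
   - eps * (pd n (h k j) u + G 0 k j u * h n 0 u + G 1 k j u * h n 1 u) * f u.
  move=> f.
  have df l : differentiable (pd l f) u.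
    by apply: diff_upto_differentiable (diff_upto_pd l (diff_upto_y 1 0 c)) Du.
  have df0 : differentiable f u by apply: diff_upto_differentiable (diff_upto_y 0 0 c) Du.
  have e0 := has_dir_deriv_of (delta_mx 0 n) (df 0).
  have e1 := has_dir_deriv_of (delta_mx 0 n) (df 1).
  have ef := has_dir_deriv_of (delta_mx 0 n) df0.
  have eG l := diff_upto_dir (delta_mx 0 n) (diff_upto_conn 0 l k j) Du.
  have eh := diff_upto_dir (delta_mx 0 n) (diff_upto_metric 0 k j) Du.
  have := has_dir_derivB (has_dir_derivD (has_dir_derivM (eG 0) e0)
    (has_dir_derivM (eG 1) e1)) (has_dir_derivM (has_dir_derivZ eps eh) ef).
  rewrite -!pdE => -[_ E].
  have E0 := gauss_entry n 0 c Du; have E1 := gauss_entry n 1 c Du.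
  have -> : pd n (pd k (pd j f)) u =
    pd n (fun w => G 0 k j w * pd 0 f w + G 1 k j w * pd 1 f w - eps * h k j w * f w) u.
    by apply: (open_eq_pd n oD _ Du) => w Dw; apply: gauss_entry.
  rewrite [LHS]E.
  rewrite -/f in E0 E1; change (y u 0 c) with (f u) in E0, E1.
  rewrite E0 E1.
  rewrite (pd_case n f).
  set b0 := _%:R; set b1 := _%:R.
  generalize (pd 0 f u) (pd 1 f u) (pd n (G 0 k j) u) (pd n (G 1 k j) u) (pd n (h k j) u)
    (f u) (h k j u) (h n 0 u) (h n 1 u) (G 0 k j u) (G 1 k j u) (G 0 n 0 u)
    (G 1 n 0 u) (G 0 n 1 u) (G 1 n 1 u).
  by clear; intros; ring.
pose A k := (pd m (G k i j) u + G 0 i j u * G k m 0 u + G 1 i j u * G k m 1 u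
      - eps * h i j u * (m == k)%:R).
pose B k := (pd i (G k m j) u + G 0 m j u * G k i 0 u + G 1 m j u * G k i 1 u
      - eps * h m j u * (i == k)%:R).
pose X := pd m (h i j) u + G 0 i j u * h m 0 u + G 1 i j u * h m 1 u.
pose Y := pd i (h m j) u + G 0 m j u * h i 0 u + G 1 m j u * h i 1 u.
have [_ _ XY] : [/\ A 0 - B 0 = 0, A 1 - B 1 = 0 & - eps * (X - Y) = 0].
  apply: (frame_independent Du) => c; pose f w := y w 0 c.
  have T1 := third m i c; have T2 := third i m c.
  have T3 : pd m (pd i (pd j f)) u = pd i (pd m (pd j f)) u.
    apply: (pd_commute oD _ _ _ Du); apply: (@diff_upto_pd _ _ 1 f).
    exact: diff_upto_y.
  have alg (e a0 a1 c0 c1 x z p q r t1 t2 : R) : t1 = t2 ->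
      t1 = a0 * p + a1 * q - e * x * r -> t2 = c0 * p + c1 * q - e * z * r ->
      (a0 - c0) * p + (a1 - c1) * q + - e * (x - z) * r = 0.
    by clear; move=> -> E1 E2; rewrite -(subrr t2) {1}E1 E2; ring.
  exact: (alg _ _ _ _ _ _ _ _ _ _ _ _ T3 T1 T2).
suff : X = Y by [].
have e0 := eps_neq0; move: XY; move: X Y; clear -e0 => X Y /eqP.
by rewrite mulf_eq0 oppr_eq0 (negPf e0) subr_eq0 => /eqP.
Qed.

Lemma cubic_sym12 i j k u : D u -> C i j k u = C j i k u.
Proof.
move=> Du.
have alg (a p q b r s g0 g1 g0' g1' x z : R) : a + p + q = b + r + s ->
    g0 = g0' -> g1 = g1' ->
    a - (g0 * x + r) - (g1 * z + s) = b - (g0' * x + p) - (g1' * z + q).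
  by clear => E -> ->; lra.
apply: etrans (cubicE i j k u) _; apply: etrans (esym (cubicE j i k u)).
exact: (alg _ _ _ _ _ _ _ _ _ _ _ _ (codazzi i j k Du) (conn_sym 0 i j Du)
  (conn_sym 1 i j Du)).
Qed.

Lemma cubic_sym23 i j k u : D u -> C i j k u = C i k j u.
Proof.
move=> Du.
have alg (a b g0 g1 q0 q1 x0 x1 z0 z1 x0' x1' z0' z1' : R) : a = b ->
    x0 = x0' -> x1 = x1' -> z0 = z0' -> z1 = z1' ->
    a - (g0 * x0 + q0 * z0) - (g1 * x1 + q1 * z1) =
    b - (q0 * z0' + g0 * x0') - (q1 * z1' + g1 * x1').
  by clear => -> -> -> -> ->; ring.
apply: etrans (cubicE i j k u) _; apply: etrans (esym (cubicE i k j u)).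
apply: alg; try exact: metric_coef_sym.
by apply: (open_eq_pd i oD _ Du) => w Dw; apply: metric_coef_sym.
Qed.

End ChartGeometry.

(** * Parallel orthonormal frames *)

Section MoreMatrixDerivative.
Context {R : realType}.
Local Notation plane := 'rV[R]_2.
Variable (D : set plane).
Hypothesis oD : open D.

Lemma mxdD p q m n (A B : plane -> 'M[R]_(p, q)) u :
  mx_diff_upto D n A -> mx_diff_upto D n B -> D u ->
  mxd m (fun w => A w + B w) u = mxd m A u + mxd m B u.
Proof.
move=> dA dB Du; apply/matrixP => i j; rewrite !mxE.
have -> : (fun w => (A w + B w) i j) = (fun w => A w i j + B w i j).
  by apply/funext => w; rewrite mxE.
have [_ E] := has_dir_derivD
  (diff_upto_dir (delta_mx 0 m) (dA i j) Du)
  (diff_upto_dir (delta_mx 0 m) (dB i j) Du).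
exact: E.
Qed.

Lemma mxdZ p q m n (f : plane -> R) (A : plane -> 'M[R]_(p, q)) u :
  diff_upto D n f -> mx_diff_upto D n A -> D u ->
  mxd m (fun w => f w *: A w) u = pd m f u *: A u + f u *: mxd m A u.
Proof.
move=> df dA Du; apply/matrixP => i j; rewrite !mxE.
have -> : (fun w => (f w *: A w) i j) = (fun w => f w * A w i j).
  by apply/funext => w; rewrite mxE.
have [_ E] := has_dir_derivM
  (diff_upto_dir (delta_mx 0 m) df Du)
  (diff_upto_dir (delta_mx 0 m) (dA i j) Du).
exact: E.
Qed.

Lemma mxd_scale p q m n c (A : plane -> 'M[R]_(p, q)) u :
  mx_diff_upto D n A -> D u -> mxd m (fun w => c *: A w) u = c *: mxd m A u.
Proof.
move=> dA Du; rewrite (mxdZ m (diff_upto_cst oD n c) dA Du).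
have [_] := has_dir_deriv_cst c u (delta_mx 0 m); rewrite -pdE => ->.
by rewrite scale0r add0r.
Qed.

Lemma mx_diff_uptoD n p q (A B : plane -> 'M[R]_(p, q)) :
  mx_diff_upto D n A -> mx_diff_upto D n B ->
  mx_diff_upto D n (fun w => A w + B w).
Proof.
move=> dA dB i j.
by apply: (diff_upto_eq oD) (diff_uptoD oD (dA i j) (dB i j)) => w _; rewrite mxE.
Qed.

Lemma mx_diff_uptoZ n p q f (A : plane -> 'M[R]_(p, q)) :
  diff_upto D n f -> mx_diff_upto D n A ->
  mx_diff_upto D n (fun w => f w *: A w).
Proof.
move=> df dA i j.
by apply: (diff_upto_eq oD) (diff_uptoM oD df (dA i j)) => w _; rewrite mxE.
Qed.

Lemma mx_diff_upto_sub (D' : set plane) n p q (A : plane -> 'M[R]_(p, q)) :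
  D' `<=` D -> mx_diff_upto D n A -> mx_diff_upto D' n A.
Proof. by move=> DD dA i j; apply: diff_upto_sub DD (dA i j). Qed.

End MoreMatrixDerivative.

(** The structure equations of a convex patch with parallel cubic form, in matrix
    form: [H] is the metric, [L m] the matrix of the Levi-Civita connection in the
    [m]-th direction, [C m] that of the cubic form, and [N m] that of the
    difference of the two connections, all in coordinates. *)
Record structure_eqs {R : realType} (eps : R) (D : set 'rV[R]_2)
    (y : 'rV[R]_2 -> 'rV[R]_3) (T : 'rV[R]_2 -> 'M[R]_(2, 3))
    (H : 'rV[R]_2 -> 'M[R]_2) (L C N : 'I_2 -> 'rV[R]_2 -> 'M[R]_2) : Prop :=
    StructureEqs {
  str_eps2 : eps * eps = 1;
  str_open : open D;
  str_diff_y : mx_diff_upto D 3 y;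
  str_diff_H : mx_diff_upto D 2 H;
  str_diff_L : forall m, mx_diff_upto D 1 (L m);
  str_diff_C : forall m, mx_diff_upto D 1 (C m);
  str_frame : forall u, D u -> (col_mx (T u) (- eps *: y u) : 'M[R]_(2 + 1)) \in unitmx;
  str_H_sym : forall u, D u -> (H u)^T = H u;
  str_H_pos : forall u, D u -> forall v : 'rV[R]_2, v != 0 -> 0 < (v *m H u *m v^T) 0 0;
  str_L_sym : forall u, D u -> forall m j k, L m u j k = L j u m k;
  str_C_sym : forall u, D u -> forall m j k, C m u j k = C j u m k /\ C m u j k = C m u k j;
  str_dH : forall u, D u -> forall m, mxd m H u = L m u *m H u + H u *m (L m u)^T;
  str_dC : forall u, D u -> forall n m,
    mxd n (C m) u = L n u m 0 *: C 0 u + L n u m 1 *: C 1 u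
      + L n u *m C m u + C m u *m (L n u)^T;
  str_N : forall u, D u -> forall m, N m u *m H u = - 2^-1 *: C m u;
  str_dy : forall u, D u -> forall m, mxd m y u = row m (T u);
  str_dT : forall u, D u -> forall m,
    mxd m T u = (L m u + N m u) *m T u - eps *: ((row m (H u))^T *m y u)
}.

Section StructureOfPatch.
Context {R : realType}.
Local Notation plane := 'rV[R]_2.
Variables (eps : R) (D : set plane) (y : plane -> 'rV[R]_3).
Hypothesis patch : convex_patch eps D y.
Hypothesis parallel : forall u, D u -> forall m i j k, dcubic eps y m i j k u = 0.

Let oD := patch_open patch.

Definition cubic_mx m u : 'M[R]_2 := \matrix_(j, k) cubic eps y m j k u.

Definition difference_mx m u : 'M[R]_2 :=
  \matrix_(j, k) (conn eps y k m j u - LC eps y k m j u).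

Lemma diff_upto_LC n k i j : diff_upto D n (LC eps y k i j).
Proof.
apply: diff_uptoZ => //; apply: diff_upto_sum => // l _; apply: diff_uptoM => //.
  have dI : mx_diff_upto D n (fun w => invmx (metric_mx eps y w)).
    apply: mx_diff_upto_inv => //; first by move=> u Du; apply: metric_unitmx patch u Du.
    exact: diff_upto_metric_mx patch n.
  exact: dI.
have dm a b c : diff_upto D n (pd a (metric eps y b c)).
  by apply: diff_upto_pd; apply: diff_upto_metric patch n.+1 b c.
apply: diff_uptoB => //; first apply: diff_uptoD => //; exact: dm.
Qed.

(** As both connections are torsion free, their difference is symmetric in its lower
    arguments, and so is the cubic form. The metric is parallel for one of them, so the
    cubic form is the symmetrized lowered difference. *)
Lemma difference_cubic m u : D u ->
  difference_mx m u *m metric_mx eps y u = - 2^-1 *: cubic_mx m u.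
Proof.
move=> Du.
pose g k i j := conn eps y k i j u.
pose l k i j := LC eps y k i j u.
pose h i j := metric eps y i j u.
pose K i j k := (g 0 i j - l 0 i j) * h 0 k + (g 1 i j - l 1 i j) * h 1 k.
have Kcubic i j k : cubic eps y i j k u = - (K i j k + K i k j).
  apply: etrans (cubicE eps y i j k u) _.
  have e1 : pd i (metric eps y j k) u =
     (l 0 i j * h 0 k + l 1 i j * h 1 k) + (l 0 i k * h 0 j + l 1 i k * h 1 j).
    have e2 : pd i (metric eps y j k) u = pd i (fun w => metric_mx eps y w j k) u.
      by apply: (open_eq_pd i oD _ Du) => w _; rewrite mxE.
    have := mxd_metric patch i Du => /matrixP/(_ j k).
    rewrite [mxd _ _ _ _ _]mxE [RHS]mxE => e.
    apply: etrans e2 _; apply: etrans e _; congr (_ + _).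
      by rewrite mulmx2E !mxE.
    rewrite -[metric_mx eps y u](metric_mx_sym patch Du) -trmx_mul mxE.
    by rewrite mulmx2E !mxE.
  have h0 : h j 0 = h 0 j := metric_coef_sym patch j 0 Du.
  have h1 : h j 1 = h 1 j := metric_coef_sym patch j 1 Du.
  have alg (x l0 l1 l0' l1' g0 g1 g0' g1' a0 a1 b0 b1 c0 c1 : R) :
      x = (l0 * a0 + l1 * a1) + (l0' * b0 + l1' * b1) -> c0 = b0 -> c1 = b1 ->
      x - (g0 * a0 + g0' * c0) - (g1 * a1 + g1' * c1) =
      - (((g0 - l0) * a0 + (g1 - l1) * a1) + ((g0' - l0') * b0 + (g1' - l1') * b1)).
    by clear => -> -> ->; ring.
  exact: alg e1 h0 h1.
have Ksym i j k : K i j k = K j i k.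
  have q k' : g k' i j - l k' i j = g k' j i - l k' j i.
    by apply: (f_equal2 (fun a b => a - b));
      [exact: (conn_sym patch k' i j Du)|exact: (LC_sym patch k' i j Du)].
  by apply: (f_equal2 (fun a b => a * h 0 k + b * h 1 k)).
apply/matrixP => j k; rewrite mulmx2E.
have -> : (- 2^-1 *: cubic_mx m u) j k = - 2^-1 * cubic eps y m j k u by rewrite !mxE.
have -> : difference_mx m u j 0 * metric_mx eps y u 0 k +
   difference_mx m u j 1 * metric_mx eps y u 1 k = K m j k by rewrite !mxE.
have alg (a b c d e f x z t : R) : x = z -> x = t -> x = - (a + b) -> z = - (c + d) ->
    t = - (e + f) -> a = c -> b = e -> d = f -> a = - 2^-1 * x.
  by clear => *; lra.
apply: (alg _ _ _ _ _ _ _ _ _ (cubic_sym12 patch m j k Du) _ (Kcubic m j k)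
  (Kcubic j m k) (Kcubic k m j)).
- apply: etrans (cubic_sym23 patch m j k Du) _; exact: (cubic_sym12 patch m k j Du).
- exact: Ksym.
- exact: Ksym.
- exact: Ksym.
Qed.

Lemma patch_structure_eqs : structure_eqs eps D y (tangent y) (metric_mx eps y)
  (LC_mx eps y) cubic_mx difference_mx.
Proof.
split.
- exact: patch_eps2 patch.
- exact: oD.
- exact: diff_upto_y patch 3.
- exact: diff_upto_metric_mx patch 2.
- by move=> m j k; apply: (diff_upto_eq oD) (diff_upto_LC 1 k m j) => u _; rewrite mxE.
- move=> m j k.
  by apply: (diff_upto_eq oD) (diff_upto_cubic patch 1 m j k) => u _; rewrite mxE.
- exact: frame_unitmx patch.
- exact: metric_mx_sym patch.
- exact: patch_convex patch.
- move=> u Du m j k; rewrite [LHS]mxE [RHS]mxE; exact: (LC_sym patch k m j Du).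
- move=> u Du m j k; split; rewrite [LHS]mxE [RHS]mxE.
    exact: (cubic_sym12 patch m j k Du).
  exact: (cubic_sym23 patch m j k Du).
- by move=> u Du m; exact: (mxd_metric patch m Du).
- move=> u Du n m; apply/matrixP => j k.
  have e1 : mxd n (cubic_mx m) u j k = pd n (cubic eps y m j k) u.
    by rewrite mxE; apply: (open_eq_pd n oD _ Du) => w _; rewrite mxE.
  have e2 := etrans (esym (dcubicE eps y n m j k u)) (parallel Du n m j k).
  have alg (p a b c a' b' c' q : R) : q = a + a' + (b + b') + (c + c') ->
      p - (a + b + c) - (a' + b' + c') = 0 -> p = q.
    by clear => -> E; lra.
  apply: etrans e1 _; apply: alg e2.
  have ent (a b p q aj0 aj1 ak0 ak1 b0 b1 c0 c1 : R) (P Q A B : 'M[R]_2) :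
      P j k = p -> Q j k = q -> A j 0 = aj0 -> A j 1 = aj1 -> A k 0 = ak0 -> A k 1 = ak1 ->
      B 0 k = b0 -> B 1 k = b1 -> B j 0 = c0 -> B j 1 = c1 ->
      (a *: P + b *: Q + A *m B + B *m A^T) j k =
      a * p + b * q + (aj0 * b0 + aj1 * b1) + (ak0 * c0 + ak1 * c1).
    clear => <- <- <- <- <- <- <- <- <- <-; rewrite !mxE !sum_ord2 !mxE.
    by congr (_ + (_ + _)); rewrite mulrC.
  have l x z : LC_mx eps y n u x z = LC eps y z n x u by rewrite mxE.
  have c x z w : cubic_mx x u z w = cubic eps y x z w u by rewrite mxE.
  rewrite (l m 0) (l m 1).
  exact: (ent _ _ _ _ _ _ _ _ _ _ _ _ _ _ _ _ (c _ _ _) (c _ _ _) (l _ _) (l _ _)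
    (l _ _) (l _ _) (c _ _ _) (c _ _ _) (c _ _ _) (c _ _ _)).
- by move=> u Du m; apply: difference_cubic.
- move=> u Du m; apply/matrixP => i c; rewrite [LHS]mxE ord1 [RHS]mxE [RHS]mxE.
  exact: (esym (pd_entry patch m c Du)).
- move=> u Du m; apply/matrixP => j c; rewrite [LHS]mxE.
  have e1 : pd m (fun w => tangent y w j c) u = pd m (pd j (fun w => y w 0 c)) u.
    apply: (open_eq_pd m oD _ Du) => w Dw; rewrite mxE.
    exact: (pd_entry patch j c Dw).
  apply: etrans e1 _; apply: etrans (gauss_entry patch m j c Du) _.
  have e2 : (tangent y u) 0 c = pd 0 (fun w => y w 0 c) u.
    by rewrite mxE; apply: (pd_entry patch 0 c Du).
  have e3 : (tangent y u) 1 c = pd 1 (fun w => y w 0 c) u.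
    by rewrite mxE; apply: (pd_entry patch 1 c Du).
  have ent (e g0 g1 l0 l1 t0 t1 hm : R) (A B H : 'M[R]_2) (T : 'M[R]_(2, 3)) (Y : 'rV[R]_3) :
      T 0 c = t0 -> T 1 c = t1 -> A j 0 = l0 -> A j 1 = l1 -> B j 0 = g0 - l0 ->
      B j 1 = g1 - l1 -> H m j = hm ->
      g0 * t0 + g1 * t1 - e * hm * Y 0 c =
      ((A + B) *m T - e *: ((row m H)^T *m Y)) j c.
    clear => <- <- <- <- B0 B1 <-.
    by rewrite !mxE sum_ord2 big_ord1 !mxE B0 B1; ring.
  apply: (ent _ _ _ _ _ _ _ _ _ _ _ _ _ e2 e3); rewrite mxE //.
Qed.

End StructureOfPatch.

Lemma mx2P {R : Type} (A B : 'M[R]_2) :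
  A 0 0 = B 0 0 -> A 0 1 = B 0 1 -> A 1 0 = B 1 0 -> A 1 1 = B 1 1 -> A = B.
Proof. by move=> *; apply/matrixP; apply: ord2P; apply: ord2P. Qed.

Definition mx2 {R : Type} (a b c d : R) : 'M[R]_2 :=
  \matrix_(i, j) if i == 0 then if j == 0 then a else b else if j == 0 then c else d.

Lemma mx2E {R : Type} (a b c d : R) :
  (mx2 a b c d 0 0 = a) * (mx2 a b c d 0 1 = b) *
  (mx2 a b c d 1 0 = c) * (mx2 a b c d 1 1 = d).
Proof. by rewrite !mxE. Qed.

Lemma frame_expansion {R : comUnitRingType} p q m (X : 'I_2 -> 'M[R]_(p, q)) (e : 'M[R]_2) :
  e \in unitmx -> X m = invmx e m 0 *: (e 0 0 *: X 0 + e 0 1 *: X 1)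
                     + invmx e m 1 *: (e 1 0 *: X 0 + e 1 1 *: X 1).
Proof.
move=> ue; have inv j : invmx e m 0 * e 0 j + invmx e m 1 * e 1 j = (m == j)%:R.
  by rewrite -mulmx2E mulVmx // mxE.
rewrite !scalerDr !scalerA addrACA -!scalerDl !inv.
by move: m {inv}; apply: ord2P; rewrite /= scale1r scale0r ?addr0 ?add0r.
Qed.

(** The quarter turn, generator of the rotations of an orthonormal frame. *)
Definition quarter_turn {R : pzRingType} : 'M[R]_2 := mx2 0 1 (- 1) 0.

Definition rotation {R : realType} (t : R) : 'M[R]_2 :=
  mx2 (cos t) (sin t) (- sin t) (cos t).

Lemma form2E {R : pzRingType} (v : 'rV[R]_2) (A : 'M[R]_2) :
  (v *m A *m v^T) 0 0 = (v 0 0 * A 0 0 + v 0 1 * A 1 0) * v 0 0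
                      + (v 0 0 * A 0 1 + v 0 1 * A 1 1) * v 0 1.
Proof. by rewrite !mulmx2E !mxE. Qed.

Section OrthonormalFrames.
Context {R : realType}.
Local Notation plane := 'rV[R]_2.
Variables (eps : R) (D : set plane) (y : plane -> 'rV[R]_3).
Variables (T : plane -> 'M[R]_(2, 3)) (H : plane -> 'M[R]_2).
Variables (L C N : 'I_2 -> plane -> 'M[R]_2).
Hypothesis S : structure_eqs eps D y T H L C N.
Local Notation J := (@quarter_turn R).

Let oD := str_open S.

Definition orthonormal_frame (D' : set plane) (E : plane -> 'M[R]_2) : Prop :=
  [/\ open D', D' `<=` D, mx_diff_upto D' 0 E &
      forall u, D' u -> E u *m H u *m (E u)^T = 1%:M].

Lemma diff_upto0_sqrt (D' : set plane) (f : plane -> R) :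
  (forall u, D' u -> 0 < f u) -> diff_upto D' 0 f ->
  diff_upto D' 0 (fun u => Num.sqrt (f u)).
Proof.
move=> f0 df; split=> // u Du.
have [] := has_dir_deriv_comp (is_derive1_sqrt (f0 u Du))
  (diff_upto_dir 0 df Du).
by [].
Qed.

Lemma gram_schmidt : exists E, orthonormal_frame D E.
Proof.
pose a u := H u 0 0; pose b u := H u 0 1; pose d u := a u * H u 1 1 - b u ^+ 2.
have sym u : D u -> H u 1 0 = b u.
  by move=> /(str_H_sym S) /matrixP/(_ 1 0); rewrite mxE.
have a0 u : D u -> 0 < a u.
  move=> Du; have := str_H_pos S Du (v := delta_mx 0 0).
  rewrite form2E !mxE /= !(mul1r, mul0r, mulr1, mulr0, addr0, add0r); apply.
  by apply/eqP => /matrixP/(_ 0 0)/eqP; rewrite !mxE /= oner_eq0.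
have d0 u : D u -> 0 < d u.
  move=> Du; have an0 := a0 u Du.
  have v0 : (\row_i (if i == 0 then - b u else a u) : 'rV[R]_2) != 0.
    apply/eqP => /matrixP/(_ 0 1)/eqP; rewrite !mxE /=.
    by rewrite gt_eqF.
  have := str_H_pos S Du v0; rewrite form2E !mxE /= (sym u Du) -/(a u) -/(b u).
  rewrite (_ : _ + _ = a u * d u); last by rewrite /d; ring.
  by rewrite pmulr_rgt0.
have da : diff_upto D 0 a := mx_diff_uptoS (mx_diff_uptoS (str_diff_H S)) 0 0.
have db : diff_upto D 0 b := mx_diff_uptoS (mx_diff_uptoS (str_diff_H S)) 0 1.
have dc : diff_upto D 0 (fun u => H u 1 1) :=
  mx_diff_uptoS (mx_diff_uptoS (str_diff_H S)) 1 1.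
have dd : diff_upto D 0 d.
  by apply: diff_uptoB => //; apply: diff_uptoM => //; apply: diff_uptoM.
have dsa := diff_upto0_sqrt a0 da; have dsd := diff_upto0_sqrt d0 dd.
have sa0 u : D u -> Num.sqrt (a u) != 0 by move=> Du; rewrite sqrtr_eq0 -ltNge a0.
have sd0 u : D u -> Num.sqrt (d u) != 0 by move=> Du; rewrite sqrtr_eq0 -ltNge d0.
have dia := diff_uptoV oD sa0 dsa; have did := diff_uptoV oD sd0 dsd.
pose p u := (Num.sqrt (a u))^-1.
pose q u := (- 1) * b u * p u * (Num.sqrt (d u))^-1.
pose r u := Num.sqrt (a u) * (Num.sqrt (d u))^-1.
exists (fun u => mx2 (p u) 0 (q u) (r u)); split=> //.
  have dq : diff_upto D 0 q.
    by apply: diff_uptoM => //; apply: diff_uptoM => //; apply: diff_uptoZ.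
  have dr : diff_upto D 0 r by apply: diff_uptoM.
  apply: ord2P; apply: ord2P.
  - by apply: (diff_upto_eq oD) dia => u _; rewrite mx2E.
  - by apply: (diff_upto_eq oD) (diff_upto_cst oD 0 0) => u _; rewrite mx2E.
  - by apply: (diff_upto_eq oD) dq => u _; rewrite mx2E.
  - by apply: (diff_upto_eq oD) dr => u _; rewrite mx2E.
move=> u Du; have := sym u Du; have := sa0 u Du; have := sd0 u Du.
have : Num.sqrt (a u) ^+ 2 = a u by rewrite sqr_sqrtr // ltW // a0.
have : Num.sqrt (d u) ^+ 2 = a u * H u 1 1 - b u ^+ 2 by rewrite sqr_sqrtr // ltW // d0.
rewrite /r /q /p /b; move: (Num.sqrt (a u)) (Num.sqrt (d u)) => s t.
rewrite /a; clear => t2 s2 t0 s0 sym.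
have aE : H u 0 0 = s ^+ 2 by [].
have cE : H u 1 1 = (t ^+ 2 + H u 0 1 ^+ 2) / s ^+ 2.
  by rewrite t2 subrK s2 mulrC mulKf // -s2 expf_neq0.
by apply: mx2P; rewrite !mulmx2E !mxE /= sym aE ?cE; field; rewrite ?s0 ?t0.
Qed.

Section OneFrame.
Variables (D' : set plane) (E : plane -> 'M[R]_2).
Hypothesis frameE : orthonormal_frame D' E.

Let oD' : open D'. Proof. by case: frameE. Qed.
Let D'D : D' `<=` D. Proof. by case: frameE. Qed.
Let dE : mx_diff_upto D' 0 E. Proof. by case: frameE. Qed.

Lemma frame_dual u : D' u -> H u *m (E u)^T *m E u = 1%:M.
Proof.
by case: frameE => _ _ _ on /on; rewrite -mulmxA => /mulmx1C.
Qed.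

Lemma frame_mx_unit u : D' u -> E u \in unitmx.
Proof. by move=> /frame_dual/mulmx1_unit[]. Qed.

Definition rotation_form m u : R :=
  ((mxd m E u + E u *m L m u) *m H u *m (E u)^T) 0 1.

(** The covariant derivative of an orthonormal frame is an infinitesimal rotation. *)
Lemma frame_connection m u : D' u ->
  mxd m E u = rotation_form m u *: (J *m E u) - E u *m L m u.
Proof.
move=> Du; pose Om := (mxd m E u + E u *m L m u) *m H u *m (E u)^T.
have dH : mx_diff_upto D' 0 H.
  exact: mx_diff_upto_sub D'D (mx_diff_uptoS (mx_diff_uptoS (str_diff_H S))).
have skew : Om + Om^T = 0.
  have : mxd m (fun w => E w *m H w *m (E w)^T) u = 0.
    rewrite -[RHS](mxd_cst m (1%:M : 'M[R]_2) u).
    by apply: (mxd_eq oD') => // w Dw; case: frameE => _ _ _; apply.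
  rewrite (mxdM m (mx_diff_upto_mul oD' dE dH) (mx_diff_upto_tr oD' dE) Du).
  rewrite (mxdM m dE dH Du) mxd_tr (str_dH S (D'D Du)) => <-.
  rewrite /Om !trmx_mul trmxK linearD /= trmx_mul (str_H_sym S (D'D Du)).
  rewrite !mulmxDl !mulmxDr !mulmxDl !mulmxA.
  by rewrite [X in _ + X = _]addrC !addrA.
have OmE : Om = rotation_form m u *: J.
  have e i j : Om i j = - Om j i.
    by move/matrixP: skew => /(_ i j); rewrite !mxE => /eqP; rewrite addr_eq0 => /eqP.
  have diag i : Om i i = 0.
    by apply/eqP; have /eqP := e i i; rewrite -addr_eq0 -mulr2n mulrn_eq0.
  apply: mx2P; rewrite [RHS]mxE /quarter_turn mx2E ?diag ?mulr0 ?mulr1 //.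
  by rewrite e mulrN1.
have : Om *m E u = mxd m E u + E u *m L m u.
  by rewrite /Om -!mulmxA [_ *m (_ *m E u)]mulmxA frame_dual // mulmx1.
by rewrite OmE -scalemxAl => ->; rewrite addrK.
Qed.

(** The matrix, on the frame [E], of the cubic form with the [a]-th vector of [E] as
    its first argument. *)
Definition frame_cubic a u : 'M[R]_2 :=
  E u a 0 *: (E u *m C 0 u *m (E u)^T) + E u a 1 *: (E u *m C 1 u *m (E u)^T).

Lemma diff_upto_frame_cubic a : mx_diff_upto D' 0 (frame_cubic a).
Proof.
have dC m : mx_diff_upto D' 0 (C m).
  exact: mx_diff_upto_sub D'D (mx_diff_uptoS (str_diff_C S m)).
have d m : mx_diff_upto D' 0 (fun u => E u *m C m u *m (E u)^T).
  apply: mx_diff_upto_mul; [exact: oD'| |exact: mx_diff_upto_tr].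
  exact: mx_diff_upto_mul.
by apply: mx_diff_uptoD => //; apply: mx_diff_uptoZ => //; apply: dE.
Qed.

Lemma frame_cubic_sym u a b d : D' u ->
  frame_cubic a u b d = frame_cubic b u a d /\
  frame_cubic a u b d = frame_cubic a u d b.
Proof.
move=> Du; have s := str_C_sym S (D'D Du).
have s1 : C 0 u 1 0 = C 0 u 0 1 by case: (s 0 0 1).
have s2 : C 1 u 0 0 = C 0 u 0 1 by case: (s 0 1 0) => <-.
have s3 : C 1 u 0 1 = C 0 u 1 1 by case: (s 0 1 1).
have s4 : C 1 u 1 0 = C 0 u 1 1 by rewrite -s3; case: (s 1 0 1).
rewrite /frame_cubic !mxE !sum_ord2 !mxE !sum_ord2 s1 s2 s3 s4.
by split; ring.
Qed.

(** The cubic form being parallel, its components change only through the rotation of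
    the frame. *)
Lemma mxd_frame_cubic n a u : D' u ->
  mxd n (frame_cubic a) u = rotation_form n u *:
    (J a 0 *: frame_cubic 0 u + J a 1 *: frame_cubic 1 u
     + J *m frame_cubic a u + frame_cubic a u *m J^T).
Proof.
move=> Du; set t := rotation_form n u.
have dC m : mx_diff_upto D' 0 (C m).
  exact: mx_diff_upto_sub D'D (mx_diff_uptoS (str_diff_C S m)).
have dEC m : mx_diff_upto D' 0 (fun w => E w *m C m w) by apply: mx_diff_upto_mul.
have dEt : mx_diff_upto D' 0 (fun w => (E w)^T) by apply: mx_diff_upto_tr.
have d m : mx_diff_upto D' 0 (fun w => E w *m C m w *m (E w)^T).
  exact: mx_diff_upto_mul.
pose X m := E u *m C m u *m (E u)^T.
have dX m : mxd n (fun w => E w *m C m w *m (E w)^T) u =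
    t *: (J *m X m + X m *m J^T) + L n u m 0 *: X 0 + L n u m 1 *: X 1.
  rewrite (mxdM n (dEC m) dEt Du) (mxdM n dE (dC m) Du) mxd_tr.
  rewrite (frame_connection n Du) -/t (str_dC S (D'D Du)) /X.
  rewrite linearB /= linearZ /= !trmx_mul.
  rewrite !(mulmxDl, mulmxDr, mulmxBl, mulmxBr) -!scalemxAl -!scalemxAr -!scalemxAl !mulmxA.
  rewrite scalerDr !(mulNmx, mulmxN) !mulmxA.
  move: (t *: _) (t *: _) (L n u m 0 *: _) (L n u m 1 *: _)
    (E u *m L n u *m C m u *m (E u)^T) (E u *m C m u *m (L n u)^T *m (E u)^T).
  by clear => a b c d' e f; apply/matrixP => i j; rewrite !mxE; ring.
have dEa k : pd n (fun w => E w a k) u =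
    t * (J a 0 * E u 0 k + J a 1 * E u 1 k)
    - (E u a 0 * L n u 0 k + E u a 1 * L n u 1 k).
  have /matrixP/(_ a k) := frame_connection n Du.
  rewrite [mxd n E u a k]mxE => ->.
  by rewrite !mxE !sum_ord2 !mxE.
rewrite /frame_cubic.
rewrite (mxdD n (mx_diff_uptoZ oD' (dE a 0) (d 0)) (mx_diff_uptoZ oD' (dE a 1) (d 1)) Du).
rewrite (mxdZ n (dE a 0) (d 0) Du) (mxdZ n (dE a 1) (d 1) Du) !dX !dEa -/(X 0) -/(X 1).
rewrite !mulmxDl !mulmxDr -!scalemxAl -!scalemxAr.
generalize (X 0) (X 1) (E u) (L n u) (J a 0) (J a 1) t; clear => X0 X1 e l j0 j1 t.
move: (J *m X0) (J *m X1) (X0 *m J^T) (X1 *m J^T) => p q r s.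
by apply/matrixP => i j; rewrite !mxE; ring.
Qed.

End OneFrame.

End OrthonormalFrames.

Section ParallelFrames.
Context {R : realType}.
Local Notation plane := 'rV[R]_2.
Variables (eps : R) (D : set plane) (y : plane -> 'rV[R]_3).
Variables (T : plane -> 'M[R]_(2, 3)) (H : plane -> 'M[R]_2).
Variables (L C N : 'I_2 -> plane -> 'M[R]_2).
Hypothesis S : structure_eqs eps D y T H L C N.
Local Notation J := (@quarter_turn R).
Local Notation frame := (orthonormal_frame D H).
Local Notation tau := (rotation_form H L).

Definition cubic0 (E : plane -> 'M[R]_2) u := frame_cubic C E 0 u 0 0.
Definition cubic1 (E : plane -> 'M[R]_2) u := frame_cubic C E 0 u 0 1.
Definition cubic2 (E : plane -> 'M[R]_2) u := frame_cubic C E 0 u 1 1.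
Definition cubic3 (E : plane -> 'M[R]_2) u := frame_cubic C E 1 u 1 1.

Section FrameCubicEquations.
Variables (D' : set plane) (E : plane -> 'M[R]_2).
Hypothesis frameE : frame D' E.

Lemma frame_cubicE u : D' u ->
  frame_cubic C E 0 u = mx2 (cubic0 E u) (cubic1 E u) (cubic1 E u) (cubic2 E u) /\
  frame_cubic C E 1 u = mx2 (cubic1 E u) (cubic2 E u) (cubic2 E u) (cubic3 E u).
Proof.
move=> Du; have s := frame_cubic_sym S frameE _ _ _ Du.
have s1 : frame_cubic C E 0 u 1 0 = frame_cubic C E 0 u 0 1 by case: (s 0 1 0).
have s2 : frame_cubic C E 1 u 0 0 = frame_cubic C E 0 u 0 1 by rewrite -s1; case: (s 1 0 0).
have s3 : frame_cubic C E 1 u 0 1 = frame_cubic C E 0 u 1 1 by case: (s 1 0 1).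
have s4 : frame_cubic C E 1 u 1 0 = frame_cubic C E 0 u 1 1 by rewrite -s3; case: (s 1 1 0).
by split; apply: mx2P; rewrite mx2E.
Qed.

Lemma pd_frame_cubic n u : D' u -> let t := tau E n u in
  [/\ pd n (cubic0 E) u = t * (3 * cubic1 E u),
      pd n (cubic1 E) u = t * (2 * cubic2 E u - cubic0 E u),
      pd n (cubic2 E) u = t * (cubic3 E u - 2 * cubic1 E u) &
      pd n (cubic3 E) u = t * (- 3 * cubic2 E u)].
Proof.
move=> Du t; have [e0 e1] := frame_cubicE Du.
have d0 := mxd_frame_cubic S frameE n 0 Du.
have d1 := mxd_frame_cubic S frameE n 1 Du.
rewrite -/t e0 e1 /quarter_turn !mx2E in d0 d1.
have ent a b d : pd n (fun w => frame_cubic C E a w b d) u =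
    mxd n (frame_cubic C E a) u b d by rewrite mxE.
split; (apply: etrans (ent _ _ _) _; rewrite ?d0 ?d1).
all: rewrite [LHS]mxE; congr (_ * _).
all: by rewrite [LHS]mxE [X in X + _]mxE !mulmx2E !mxE /=; ring.
Qed.

Lemma diff_upto_cubics : [/\ diff_upto D' 0 (cubic0 E), diff_upto D' 0 (cubic1 E),
  diff_upto D' 0 (cubic2 E) & diff_upto D' 0 (cubic3 E)].
Proof. by have d := diff_upto_frame_cubic S frameE; split; apply: d. Qed.

Lemma rotate_frame psi : diff_upto D' 0 psi ->
  frame D' (fun w => rotation (psi w) *m E w) /\
  forall m u, D' u ->
    tau (fun w => rotation (psi w) *m E w) m u = pd m psi u + tau E m u.
Proof.
move=> dpsi; have [oD' D'D dE one] := frameE.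
have der u v : D' u ->
    has_dir_deriv (fun w => cos (psi w)) u v (- sin (psi u) * 'D_v psi u) /\
    has_dir_deriv (fun w => sin (psi w)) u v (cos (psi u) * 'D_v psi u).
  move=> Du; have dp := diff_upto_dir v dpsi Du.
  by split; apply: has_dir_deriv_comp dp.
have dc : diff_upto D' 0 (fun w => cos (psi w)).
  by split=> // u Du; have [[]] := der u 0 Du.
have ds : diff_upto D' 0 (fun w => sin (psi w)).
  by split=> // u Du; have [_ []] := der u 0 Du.
have dR : mx_diff_upto D' 0 (fun w => rotation (psi w)).
  apply: ord2P; apply: ord2P.
  - by apply: (diff_upto_eq oD') dc => u _; rewrite mx2E.
  - by apply: (diff_upto_eq oD') ds => u _; rewrite mx2E.
  - by apply: (diff_upto_eq oD') (diff_uptoZ oD' (- 1) ds) => u _; rewrite mx2E mulN1r.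
  - by apply: (diff_upto_eq oD') dc => u _; rewrite mx2E.
have mxdR m u : D' u -> mxd m (fun w => rotation (psi w)) u =
    pd m psi u *: (J *m rotation (psi u)).
  move=> Du; have [[_ e1] [_ e2]] := der u (delta_mx 0 m) Du.
  rewrite -!pdE in e1 e2.
  have eN : pd m (fun w => - sin (psi w)) u = - (cos (psi u) * pd m psi u).
    have [_] := has_dir_derivN (diff_upto_dir (delta_mx 0 m) ds Du).
    by rewrite -!pdE e2.
  have pd_ext (g f : plane -> R) : f =1 g -> pd m f u = pd m g u by move=> /funext ->.
  apply: mx2P; rewrite [LHS]mxE [RHS]mxE mulmx2E /quarter_turn /rotation !mx2E.
  - by rewrite (pd_ext (fun w => cos (psi w))) ?e1 => [|w]; [ring|rewrite mx2E].
  - by rewrite (pd_ext (fun w => sin (psi w))) ?e2 => [|w]; [ring|rewrite mx2E].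
  - by rewrite (pd_ext (fun w => - sin (psi w))) ?eN => [|w]; [ring|rewrite mx2E].
  - by rewrite (pd_ext (fun w => cos (psi w))) ?e1 => [|w]; [ring|rewrite mx2E].
have RJ t : rotation t *m J = J *m rotation t.
  by apply: mx2P; rewrite !mulmx2E /quarter_turn /rotation !mx2E; ring.
have RR t : rotation t *m (rotation t)^T = 1%:M.
  have := cos2Dsin2 t; rewrite /rotation => cs.
  by apply: mx2P; rewrite mulmx2E !mxE /= -?cs; ring.
have fr : frame D' (fun w => rotation (psi w) *m E w).
  split=> // [|u Du]; first exact: mx_diff_upto_mul.
  rewrite trmx_mul -!mulmxA [H u *m (_ *m _)]mulmxA.
  by rewrite [E u *m _]mulmxA [E u *m _]mulmxA one // mul1mx RR.
split=> // m u Du.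
rewrite {1}/rotation_form (mxdM m dR dE Du) mxdR // (frame_connection S frameE m Du).
have -> : (pd m psi u *: (J *m rotation (psi u)) *m E u +
   rotation (psi u) *m (tau E m u *: (J *m E u) - E u *m L m u) +
   rotation (psi u) *m E u *m L m u) =
   (pd m psi u + tau E m u) *: (J *m (rotation (psi u) *m E u)).
  rewrite mulmxBr !mulmxA addrA subrK scalerDl -!scalemxAl -!scalemxAr !mulmxA RJ.
  by [].
case: fr => _ _ _ /(_ u Du); move: (rotation (psi u) *m E u) => X XX.
by rewrite -!scalemxAl [LHS]mxE -!mulmxA [X *m _]mulmxA XX mulmx1 /quarter_turn mx2E mulr1.
Qed.

Lemma rotated_cubic1 (t : R) u : D' u ->
  cubic1 (fun w => rotation t *m E w) u =
  - cos t ^+ 2 * sin t * cubic0 E u + (cos t ^+ 3 - 2 * cos t * sin t ^+ 2) * cubic1 E u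
  + (2 * cos t ^+ 2 * sin t - sin t ^+ 3) * cubic2 E u
  + cos t * sin t ^+ 2 * cubic3 E u.
Proof.
move=> Du; have [e0 e1] := frame_cubicE Du.
have -> : cubic1 (fun w => rotation t *m E w) u =
   (rotation t 0 0 *: (rotation t *m frame_cubic C E 0 u *m (rotation t)^T)
  + rotation t 0 1 *: (rotation t *m frame_cubic C E 1 u *m (rotation t)^T)) 0 1.
  rewrite /cubic1 /frame_cubic; move: (rotation t) (E u) (C 0 u) (C 1 u); clear.
  move=> Q e c0 c1; rewrite trmx_mul !mulmxA.
  rewrite ![(Q *m e) 0 _]mulmx2E.
  rewrite !(mulmxDl, mulmxDr) -!scalemxAr -!scalemxAl !mulmxA.
  by move: (Q *m e *m c0 *m _ *m _) (Q *m e *m c1 *m _ *m _) => Z0 Z1; rewrite !mxE; ring.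
rewrite e0 e1 [LHS]mxE ![(_ *: _ : 'M[R]_2) _ _]mxE !mulmx2E [(_^T) 0 1]mxE [(_^T) 1 1]mxE.
by rewrite /rotation !mx2E; ring.
Qed.

End FrameCubicEquations.

End ParallelFrames.

Section ParallelFrameExistence.
Context {R : realType}.
Local Notation plane := 'rV[R]_2.
Variables (eps : R) (D : set plane) (y : plane -> 'rV[R]_3).
Variables (T : plane -> 'M[R]_(2, 3)) (H : plane -> 'M[R]_2).
Variables (L C N : 'I_2 -> plane -> 'M[R]_2).
Hypothesis S : structure_eqs eps D y T H L C N.
Local Notation frame := (orthonormal_frame D H).
Local Notation tau := (rotation_form H L).

Lemma open_ball_sub (D' : set plane) u : open D' -> D' u ->
  exists2 r, 0 < r & ball u r `<=` D'.
Proof.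
move=> oD' Du; have : nbhs u D' by apply: open_nbhs_nbhs.
by move=> /nbhs_ballP[r /= r0 hr]; exists r.
Qed.

Lemma frame_sub (D1 D2 : set plane) E : open D2 -> D2 `<=` D1 ->
  frame D1 E -> frame D2 E.
Proof.
move=> oD2 D21 [_ D1D dE one]; split; first exact: oD2.
- by move=> u /D21/D1D.
- exact: mx_diff_upto_sub D21 dE.
- by move=> u /D21/one.
Qed.

Lemma frame_cubic0 E u m : E u \in unitmx ->
  frame_cubic C E 0 u = 0 -> frame_cubic C E 1 u = 0 -> C m u = 0.
Proof.
move=> uE f0 f1; pose X k := E u *m C k u *m (E u)^T.
have X0 : X m = 0.
  rewrite (frame_expansion m X uE) -[X in _ *: X]/(frame_cubic C E 0 u) f0.
  by rewrite -[X in _ + _ *: X]/(frame_cubic C E 1 u) f1 !scaler0 addr0.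
have uEt : (E u)^T \in unitmx by rewrite unitmx_tr.
rewrite -[C m u](mulKmx uE) -[E u *m C m u](mulmxK uEt) -/(X m) X0.
by rewrite mul0mx mulmx0.
Qed.

(** The norm of the cubic form is constant, hence the form vanishes near a point
    at which it vanishes. *)
Lemma cubic_vanishes_near u0 : D u0 -> (forall m, C m u0 = 0) ->
  exists2 r, 0 < r & ball u0 r `<=` D /\ forall u, ball u0 r u -> forall m, C m u = 0.
Proof.
move=> Du0 C0; have [E frE] := gram_schmidt S.
have [r r0 rD] := open_ball_sub (str_open S) Du0.
exists r => //; split=> // u ur m.
have frB : frame (ball u0 r) E by apply: frame_sub frE => //; apply: ball_open.
pose q u := cubic0 C E u ^+ 2 + 3 * cubic1 C E u ^+ 2
          + 3 * cubic2 C E u ^+ 2 + cubic3 C E u ^+ 2.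
have qc : q u = q u0.
  apply: (@gradient0_constant _ q u0 r) ur => w wr.
  have [d0 d1 d2 d3] := diff_upto_cubics S frB.
  have sq (f : plane -> R) v : diff_upto (ball u0 r) 0 f ->
      has_dir_deriv (fun w => f w ^+ 2) w v (2 * f w * 'D_v f w).
    move=> df; have hf := diff_upto_dir v df wr.
    by apply: has_dir_deriv_eq (has_dir_derivM hf hf) _; ring.
  have dq v := has_dir_derivD (has_dir_derivD (has_dir_derivD (sq _ v d0)
    (has_dir_derivZ 3 (sq _ v d1))) (has_dir_derivZ 3 (sq _ v d2))) (sq _ v d3).
  split=> [|i]; first by have [] := dq 0.
  have [_] := dq (delta_mx 0 i); rewrite -!pdE => ->.
  have [-> -> -> ->] := pd_frame_cubic S frB i wr.
  by ring.
have fc0 a : frame_cubic C E a u0 = 0.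
  by rewrite /frame_cubic !C0 !mulmx0 !mul0mx !scaler0 addr0.
have q0 : q u = 0.
  by rewrite qc /q /cubic0 /cubic1 /cubic2 /cubic3 !fc0 !mxE; ring.
have := q0; rewrite /q => {}q0.
have z : [/\ cubic0 C E u = 0, cubic1 C E u = 0, cubic2 C E u = 0 & cubic3 C E u = 0].
  move: q0; move: (cubic0 _ _ _) (cubic1 _ _ _) (cubic2 _ _ _) (cubic3 _ _ _).
  clear => a b c d e.
  have p x : 0 <= x ^+ 2 :> R by apply: sqr_ge0.
  have := p a; have := p b; have := p c; have := p d => pd pc pb pa.
  by split; apply/eqP; rewrite -sqrf_eq0; apply/eqP; lra.
have [e0 e1] := frame_cubicE S frB ur.
have zero : mx2 0 0 0 0 = 0 :> 'M[R]_2 by apply: mx2P; rewrite !mxE.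
case: z => z0 z1 z2 z3; rewrite z0 z1 z2 z3 zero in e0 e1.
apply: frame_cubic0 e0 e1; exact: frame_mx_unit frB _ ur.
Qed.

(** If a pair of functions rotates [k] times as fast as the frame, its argument
    divided by [k] is an angle that makes the frame parallel. *)
Lemma unwinding_angle u0 r E k (f g : plane -> R) : 0 < r -> frame (ball u0 r) E ->
  k != 0 -> diff_upto (ball u0 r) 0 f -> diff_upto (ball u0 r) 0 g ->
  (forall u m, ball u0 r u -> pd m f u = tau E m u * (k * g u)) ->
  (forall u m, ball u0 r u -> pd m g u = tau E m u * (- k * f u)) ->
  0 < f u0 ^+ 2 + g u0 ^+ 2 ->
  exists s psi, [/\ 0 < s, ball u0 s `<=` ball u0 r, diff_upto (ball u0 s) 0 psi &
    forall u m, ball u0 s u -> pd m psi u = - tau E m u].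
Proof.
move=> r0 frE k0 df dg ef eg fg0.
pose F u := f u0 * f u + g u0 * g u.
pose G u := f u0 * g u + - g u0 * f u.
have ob : open (ball u0 r) by apply: ball_open.
have dF : diff_upto (ball u0 r) 0 F by apply: diff_uptoD => //; apply: diff_uptoZ.
have dG : diff_upto (ball u0 r) 0 G by apply: diff_uptoD => //; apply: diff_uptoZ.
have F0 : 0 < F u0 by rewrite /F -!expr2.
have : \forall u \near u0, 0 < F u.
  have cF := differentiable_continuous (diff_upto_differentiable dF (ballxx u0 r0)).
  exact: (cvgr_gt (F u0) cF 0 F0).
move=> nF; have : nbhs u0 (ball u0 r `&` [set u | 0 < F u]).
  by apply: filterI => //; apply: nbhsx_ballx.
move=> /nbhs_ballP[s /= s0 hs].
have sr : ball u0 s `<=` ball u0 r by move=> u /hs[].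
pose psi u := k^-1 * atan (G u * (F u)^-1).
have der u m : ball u0 s u -> has_dir_deriv psi u (delta_mx 0 m) (- tau E m u).
  move=> us; have [ur /= Fu] := hs u us.
  have Fn : F u != 0 by rewrite gt_eqF.
  have hf := diff_upto_dir (delta_mx 0 m) df ur.
  have hg := diff_upto_dir (delta_mx 0 m) dg ur.
  rewrite -pdE ef // in hf; rewrite -pdE eg // in hg.
  have hF := has_dir_derivD (has_dir_derivZ (f u0) hf) (has_dir_derivZ (g u0) hg).
  have hG := has_dir_derivD (has_dir_derivZ (f u0) hg) (has_dir_derivZ (- g u0) hf).
  have hq := has_dir_derivM hG (has_dir_derivV Fn hF).
  have hp := has_dir_derivZ k^-1 (has_dir_deriv_comp (is_derive1_atan _) hq).
  apply: (has_dir_deriv_eq hp); rewrite -/(F u) -/(G u).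
  set t := tau E m u.
  have -> : f u0 * (t * (k * g u)) + g u0 * (t * (- k * f u)) = t * k * G u by rewrite /G; ring.
  have -> : f u0 * (t * (- k * f u)) + - g u0 * (t * (k * g u)) = - t * k * F u by rewrite /F; ring.
  move: (F u) (G u) Fn Fu k0; clear => a b an ap k0.
  have p : a ^+ 2 + b ^+ 2 != 0.
    by rewrite gt_eqF //; apply: ltr_pwDl; [exact: exprn_gt0|exact: sqr_ge0].
  by field; rewrite an p k0.
exists s, psi; split=> // [|u m us]; last by have [_] := der u m us.
by split=> // u us; have [] := der u 0 us.
Qed.

(** A binary cubic form is the sum of a trace part, on which a rotation of the frame by
    an angle acts as the rotation by this angle, and of a trace free part, on which it
    acts as the rotation by three times the angle. *)
Lemma frame_cubic_nonzero u0 E : D u0 -> frame D E -> ~ (forall m, C m u0 = 0) ->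
  let t0 := cubic0 C E u0 + cubic2 C E u0 in
  let t1 := cubic1 C E u0 + cubic3 C E u0 in
  let s0 := cubic0 C E u0 + - 3 * cubic2 C E u0 in
  let s1 := cubic3 C E u0 + - 3 * cubic1 C E u0 in
  0 < t0 ^+ 2 + t1 ^+ 2 \/ 0 < s0 ^+ 2 + s1 ^+ 2.
Proof.
move=> Du0 frE Cn t0 t1 s0 s1.
have p (x z : R) : 0 <= x ^+ 2 + z ^+ 2 by rewrite addr_ge0 ?sqr_ge0.
have [tz|] := eqVneq (t0 ^+ 2 + t1 ^+ 2) 0; last by move=> n; left; rewrite lt0r n p.
have [sz|] := eqVneq (s0 ^+ 2 + s1 ^+ 2) 0; last by move=> n; right; rewrite lt0r n p.
exfalso; apply: Cn => m.
have z (x w : R) : x ^+ 2 + w ^+ 2 = 0 -> x = 0 /\ w = 0.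
  by move=> /eqP; rewrite paddr_eq0 ?sqr_ge0 // !sqrf_eq0 => /andP[/eqP-> /eqP->].
have [t0z t1z] := z _ _ tz; have [s0z s1z] := z _ _ sz.
have [z0 z2] : cubic0 C E u0 = 0 /\ cubic2 C E u0 = 0.
  have h : 4 * cubic2 C E u0 = t0 - s0 by rewrite /t0 /s0; ring.
  have z2 : cubic2 C E u0 = 0.
    by apply/eqP; move/eqP: h; rewrite t0z s0z subrr mulf_eq0 pnatr_eq0.
  by split=> //; rewrite -t0z /t0 z2 addr0.
have [z1 z3] : cubic1 C E u0 = 0 /\ cubic3 C E u0 = 0.
  have h : 4 * cubic1 C E u0 = t1 - s1 by rewrite /t1 /s1; ring.
  have z1 : cubic1 C E u0 = 0.
    by apply/eqP; move/eqP: h; rewrite t1z s1z subrr mulf_eq0 pnatr_eq0.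
  by split=> //; rewrite -t1z /t1 z1 add0r.
have [e0 e1] := frame_cubicE S frE Du0.
have zero : mx2 0 0 0 0 = 0 :> 'M[R]_2 by apply: mx2P; rewrite !mxE.
rewrite z0 z1 z2 z3 zero in e0 e1.
apply: frame_cubic0 e0 e1; exact: frame_mx_unit frE _ Du0.
Qed.

Lemma parallel_frame_near u0 : D u0 -> ~ (forall m, C m u0 = 0) ->
  exists r E, [/\ 0 < r, frame (ball u0 r) E &
    forall u m, ball u0 r u -> tau E m u = 0].
Proof.
move=> Du0 Cn; have [E frE] := gram_schmidt S.
have [r r0 rD] := open_ball_sub (str_open S) Du0.
have ob : open (ball u0 r) by apply: ball_open.
have frB : frame (ball u0 r) E by apply: frame_sub frE.
have [d0 d1 d2 d3] := diff_upto_cubics S frB.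
suff [s [psi [s0 sr dpsi epsi]]] : exists s psi, [/\ 0 < s, ball u0 s `<=` ball u0 r,
    diff_upto (ball u0 s) 0 psi & forall u m, ball u0 s u -> pd m psi u = - tau E m u].
  have frs : frame (ball u0 s) E by apply: frame_sub frB => //; apply: ball_open.
  have [fr' tE] := rotate_frame S frs dpsi.
  exists s, (fun w => rotation (psi w) *m E w); split=> // u m us.
  by rewrite tE // epsi // addNr.
have comb m u (f g : plane -> R) b : diff_upto (ball u0 r) 0 f -> diff_upto (ball u0 r) 0 g ->
    ball u0 r u -> pd m (fun w => f w + b * g w) u = pd m f u + b * pd m g u.
  move=> df dg ur; have [_] := has_dir_derivD (diff_upto_dir (delta_mx 0 m) df ur)
    (has_dir_derivZ b (diff_upto_dir (delta_mx 0 m) dg ur)).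
  by rewrite -!pdE.
have dcomb (f g : plane -> R) b : diff_upto (ball u0 r) 0 f -> diff_upto (ball u0 r) 0 g ->
    diff_upto (ball u0 r) 0 (fun w => f w + b * g w).
  by move=> df dg; apply: diff_uptoD => //; apply: diff_uptoZ.
have n3 : - 3 != 0 :> R by rewrite oppr_eq0 pnatr_eq0.
have [n|n] := frame_cubic_nonzero Du0 frE Cn.
  apply: (unwinding_angle r0 frB (oner_neq0 _) (dcomb _ _ 1 d0 d2) (dcomb _ _ 1 d1 d3)) => //.
  - by move=> u m ur; rewrite comb //; have [-> _ -> _] := pd_frame_cubic S frB m ur; ring.
  - by move=> u m ur; rewrite comb //; have [_ -> _ ->] := pd_frame_cubic S frB m ur; ring.
  by rewrite !mul1r.
apply: (unwinding_angle r0 frB n3 (dcomb _ _ (- 3) d0 d2) (dcomb _ _ (- 3) d3 d1)) => //.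
- by move=> u m ur; rewrite comb //; have [-> _ -> _] := pd_frame_cubic S frB m ur; ring.
- by move=> u m ur; rewrite comb //; have [_ -> _ ->] := pd_frame_cubic S frB m ur; ring.
Qed.

(** The component [cubic1] changes sign under a half turn, so it vanishes for some
    constant rotation of a parallel frame. *)
Lemma normal_parallel_frame u0 : D u0 -> ~ (forall m, C m u0 = 0) ->
  exists r E k0 k2 k3, [/\ 0 < r, frame (ball u0 r) E,
    forall u m, ball u0 r u -> mxd m E u = - (E u *m L m u) &
    forall u, ball u0 r u -> frame_cubic C E 0 u = mx2 k0 0 0 k2 /\
                             frame_cubic C E 1 u = mx2 0 k2 k2 k3].
Proof.
move=> Du0 Cn; have [r [E [r0 frE tE]]] := parallel_frame_near Du0 Cn.
have u0r : ball u0 r u0 by apply: ballxx.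
pose p t := - cos t ^+ 2 * sin t * cubic0 C E u0
  + (cos t ^+ 3 - 2 * cos t * sin t ^+ 2) * cubic1 C E u0
  + (2 * cos t ^+ 2 * sin t - sin t ^+ 3) * cubic2 C E u0
  + cos t * sin t ^+ 2 * cubic3 C E u0.
have [t pt] : exists t, p t = 0.
  have cp : {within `[0, pi], continuous p}.
    apply: derivable_within_continuous => t _.
    by rewrite /p; apply: ex_derive.
  have [|t _ pt] := IVT (pi_ge0 R) cp (v := 0); last by exists t.
  have p0 : p 0 = cubic1 C E u0 by rewrite /p cos0 sin0; ring.
  have p1 : p pi = - cubic1 C E u0 by rewrite /p cospi sinpi; ring.
  rewrite p0 p1; move: (cubic1 C E u0) => x.
  by rewrite ge_min le_max oppr_le0 oppr_ge0; case: (lerP 0 x) => [_|/ltW ->]; rewrite ?orbT.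
pose E' w := rotation t *m E w.
have ob : open (ball u0 r) by apply: ball_open.
have [frE' tE'] := rotate_frame S frE (diff_upto_cst ob 0 t).
rewrite -/E' in frE' tE'.
have tau0 u m : ball u0 r u -> tau E' m u = 0.
  move=> ur; rewrite tE' // tE // addr0.
  by have [_] := has_dir_deriv_cst t u (delta_mx 0 m); rewrite -pdE.
have [d0 d1 d2 d3] := diff_upto_cubics S frE'.
have cst (f : plane -> R) : diff_upto (ball u0 r) 0 f ->
    (forall u m, ball u0 r u -> pd m f u = 0) -> forall u, ball u0 r u -> f u = f u0.
  move=> df f0 u ur; apply: (@gradient0_constant _ f u0 r) ur => w wr.
  by split=> [|i]; [apply: diff_upto_differentiable df wr|apply: f0].
exists r, E', (cubic0 C E' u0), (cubic2 C E' u0), (cubic3 C E' u0); split=> //.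
  move=> u m ur; rewrite (frame_connection S frE' m ur) tau0 //.
  by rewrite scale0r add0r.
have c1 : cubic1 C E' u0 = 0 by rewrite (rotated_cubic1 S frE).
move=> u ur; have [-> ->] := frame_cubicE S frE' ur.
have [p0 p1 p2 p3] : [/\ cubic0 C E' u = cubic0 C E' u0, cubic1 C E' u = 0,
    cubic2 C E' u = cubic2 C E' u0 & cubic3 C E' u = cubic3 C E' u0].
  rewrite -c1; split; apply: cst ur => // w m wr;
  by have := pd_frame_cubic S frE' m wr; rewrite /= tau0 // !mul0r => -[].
by rewrite p0 p1 p2 p3.
Qed.

End ParallelFrameExistence.

(** * The position vector as the orbit of a commutative matrix algebra *)

Definition mx3 {R : Type} (a b c d e f g h i : R) : 'M[R]_3 :=
  \matrix_(k, l) nth a (nth [::] [:: [:: a; b; c]; [:: d; e; f]; [:: g; h; i]] k) l.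

Lemma ord3P (P : 'I_3 -> Prop) : P 0 -> P 1 -> P 2%:R -> forall i, P i.
Proof.
move=> P0 P1 P2 [[|[|[|k]]] hk] //.
- by rewrite (_ : Ordinal hk = 0) //; apply/val_inj.
- by rewrite (_ : Ordinal hk = 1) //; apply/val_inj.
- by rewrite (_ : Ordinal hk = 2%:R) //; apply/val_inj.
Qed.

Lemma sum_ord3 {R : pzSemiRingType} (F : 'I_3 -> R) :
  \sum_(i < 3) F i = F 0 + F 1 + F 2%:R.
Proof.
rewrite !big_ord_recl big_ord0 addr0 addrA; congr (_ + F _ + F _); exact/val_inj.
Qed.

Lemma mx3E {R : Type} (a b c d e f g h i : R) (M := mx3 a b c d e f g h i) :
  (M 0 0 = a) * (M 0 1 = b) * (M 0 2%:R = c) * (M 1 0 = d) * (M 1 1 = e) *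
  (M 1 2%:R = f) * (M 2%:R 0 = g) * (M 2%:R 1 = h) * (M 2%:R 2%:R = i).
Proof. by rewrite /M !mxE. Qed.

Lemma mulmx3E {R : pzSemiRingType} p q (A : 'M[R]_(p, 3)) (B : 'M[R]_(3, q)) i j :
  (A *m B) i j = A i 0 * B 0 j + A i 1 * B 1 j + A i 2%:R * B 2%:R j.
Proof. by rewrite mxE sum_ord3. Qed.

Lemma mx3P {R : Type} (A B : 'M[R]_3) :
  (forall j, A 0 j = B 0 j) -> (forall j, A 1 j = B 1 j) ->
  (forall j, A 2%:R j = B 2%:R j) -> A = B.
Proof. by move=> *; apply/matrixP; apply: ord3P. Qed.

Lemma det_mx2 {R : comPzRingType} (A : 'M[R]_2) :
  \det A = A 0 0 * A 1 1 - A 0 1 * A 1 0.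
Proof.
rewrite (expand_det_row _ 0) sum_ord2 /cofactor !det_mx11 !mxE /=.
rewrite (_ : lift 0 0 = 1 :> 'I_2); last exact/val_inj.
rewrite (_ : lift 1 0 = 0 :> 'I_2); last exact/val_inj.
by rewrite expr0 expr1; ring.
Qed.

Lemma det_mx3 {R : comPzRingType} (A : 'M[R]_3) : \det A =
  A 0 0 * (A 1 1 * A 2%:R 2%:R - A 1 2%:R * A 2%:R 1)
  - A 0 1 * (A 1 0 * A 2%:R 2%:R - A 1 2%:R * A 2%:R 0)
  + A 0 2%:R * (A 1 0 * A 2%:R 1 - A 1 1 * A 2%:R 0).
Proof.
rewrite (expand_det_row _ 0) sum_ord3 /cofactor !det_mx2 !mxE /=.
rewrite (_ : lift 0 0 = 1 :> 'I_3); last exact/val_inj.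
rewrite (_ : lift 0 1 = 2%:R :> 'I_3); last exact/val_inj.
rewrite (_ : lift 1 0 = 0 :> 'I_3); last exact/val_inj.
rewrite (_ : lift 1 1 = 2%:R :> 'I_3); last exact/val_inj.
rewrite (_ : lift 2%:R 0 = 0 :> 'I_3); last exact/val_inj.
rewrite (_ : lift 2%:R 1 = 1 :> 'I_3); last exact/val_inj.
rewrite /= addn0 !expr0 !expr1 !expr2; ring.
Qed.

(** Multiplication by the two unit vectors of the frame in the algebra spanned by
    them and the unit, in the basis formed by the frame and minus [eps] times the
    unit. *)
Definition mult0 {R : pzRingType} (eps la mu : R) : 'M[R]_3 :=
  mx3 la 0 1 0 mu 0 (- eps) 0 0.
Definition mult1 {R : pzRingType} (eps mu nu : R) : 'M[R]_3 :=
  mx3 0 mu 0 mu nu 1 0 (- eps) 0.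

Section ExponentialStructure.
Context {R : realType}.
Local Notation plane := 'rV[R]_2.
Variables (eps : R) (D : set plane) (y : plane -> 'rV[R]_3).
Variables (T : plane -> 'M[R]_(2, 3)) (H : plane -> 'M[R]_2).
Variables (L C N : 'I_2 -> plane -> 'M[R]_2).
Hypothesis S : structure_eqs eps D y T H L C N.
Local Notation frame := (orthonormal_frame D H).

Definition along (E : plane -> 'M[R]_2) a (p q : nat) (A : plane -> 'M[R]_(p, q)) u :
  'M[R]_(p, q) := E u a 0 *: mxd 0 A u + E u a 1 *: mxd 1 A u.

Lemma alongE E a p q (A : plane -> 'M[R]_(p, q)) u i j : along E a A u i j =
  E u a 0 * pd 0 (fun w => A w i j) u + E u a 1 * pd 1 (fun w => A w i j) u.
Proof. by rewrite [LHS]mxE [X in X + _]mxE [X in _ + X]mxE ![mxd _ _ _ _ _]mxE. Qed.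

Lemma diff_upto_T : mx_diff_upto D 2 T.
Proof.
move=> m c; apply: (diff_upto_eq (str_open S) _ (diff_upto_pd m (str_diff_y S 0 c))).
move=> u Du; have /matrixP/(_ 0 c) := str_dy S Du m.
by rewrite !mxE.
Qed.

Section OneParallelFrame.
Variables (D' : set plane) (E : plane -> 'M[R]_2) (k0 k2 k3 : R).
Hypothesis frameE : frame D' E.
Hypothesis parallelE : forall u m, D' u -> mxd m E u = - (E u *m L m u).
Hypothesis cubicE : forall u, D' u -> frame_cubic C E 0 u = mx2 k0 0 0 k2 /\
                                      frame_cubic C E 1 u = mx2 0 k2 k2 k3.

Let oD' : open D'. Proof. by case: frameE. Qed.
Let D'D : D' `<=` D. Proof. by case: frameE. Qed.
Let dE : mx_diff_upto D' 0 E. Proof. by case: frameE. Qed.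

Lemma diff_upto_parallel : mx_diff_upto D' 1 E.
Proof.
move=> a k; split=> [u Du|m]; first exact: diff_upto_differentiable (dE a k) Du.
have dL : mx_diff_upto D' 0 (L m).
  exact: mx_diff_upto_sub D'D (mx_diff_uptoS (str_diff_L S m)).
have d := diff_uptoZ oD' (- 1) (mx_diff_upto_mul oD' dE dL a k).
apply: (diff_upto_eq oD' _ d) => u Du.
have /matrixP/(_ a k) := parallelE m Du.
by rewrite [LHS]mxE [in RHS]mxE mulN1r => ->.
Qed.

(** The fields of a parallel frame commute, because the Levi-Civita connection is
    torsion free. *)
Lemma along_commute (f : plane -> R) u : diff_upto D' 1 f -> D' u ->
  let g a w := E w a 0 * pd 0 f w + E w a 1 * pd 1 f w in
  E u 0 0 * pd 0 (g 1) u + E u 0 1 * pd 1 (g 1) u =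
  E u 1 0 * pd 0 (g 0) u + E u 1 1 * pd 1 (g 0) u.
Proof.
move=> df Du g.
have dg m a : pd m (g a) u =
    - (E u a 0 * L m u 0 0 + E u a 1 * L m u 1 0) * pd 0 f u + E u a 0 * pd m (pd 0 f) u
    + (- (E u a 0 * L m u 0 1 + E u a 1 * L m u 1 1) * pd 1 f u + E u a 1 * pd m (pd 1 f) u).
  have hE k := diff_upto_dir (delta_mx 0 m) (dE a k) Du.
  have hf k := diff_upto_dir (delta_mx 0 m) (diff_upto_pd k df) Du.
  have [_ e] := has_dir_derivD (has_dir_derivM (hE 0) (hf 0)) (has_dir_derivM (hE 1) (hf 1)).
  apply: etrans e _.
  have eE k : pd m (fun w => E w a k) u = - (E u a 0 * L m u 0 k + E u a 1 * L m u 1 k).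
    have /matrixP/(_ a k) := parallelE m Du.
    by rewrite [LHS]mxE => ->; rewrite !mxE sum_ord2.
  by rewrite -!pdE !eE.
rewrite !dg (pd_commute oD' 0 1 df Du).
have := str_L_sym S (D'D Du) 0 1 => Ls; rewrite !Ls.
generalize (pd 0 f u) (pd 1 f u) (pd 1 (pd 0 f) u) (pd 0 (pd 0 f) u) (pd 1 (pd 1 f) u).
by move=> a b c d e; ring.
Qed.

Definition moving_frame u : 'M[R]_3 := (col_mx (E u *m T u) (- eps *: y u) : 'M[R]_(2 + 1, 3)).
Local Notation Phi := moving_frame.

Lemma moving_frameE u j : (Phi u 0 j = (E u *m T u) 0 j) *
  (Phi u 1 j = (E u *m T u) 1 j) * (Phi u 2%:R j = - eps * y u 0 j).
Proof.
pose A := E u *m T u; pose B := - eps *: y u.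
have e (i : 'I_3) (k : 'I_(2 + 1)) : i = k -> Phi u i j = col_mx A B k j by move=> ->.
split; first split.
- by rewrite (e 0 (lshift 1 0)) ?col_mxEu //; apply/val_inj.
- by rewrite (e 1 (lshift 1 1)) ?col_mxEu //; apply/val_inj.
- by rewrite (e 2%:R (rshift 2 0)) ?col_mxEd ?[LHS]mxE //; apply/val_inj.
Qed.

Lemma moving_frame_unit u : D' u -> Phi u \in unitmx.
Proof.
move=> Du; have F := str_frame S (D'D Du).
have -> : Phi u = block_mx (E u) 0 0 (1%:M : 'M[R]_1) *m col_mx (T u) (- eps *: y u).
  by rewrite /moving_frame mul_block_col !mul0mx addr0 add0r mul1mx.
have : (block_mx (E u) 0 0 (1%:M : 'M[R]_1)) *m col_mx (T u) (- eps *: y u) \in unitmx.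
  rewrite unitmx_mul F andbT unitmxE det_ublock det1 mulr1 -unitmxE.
  exact: frame_mx_unit frameE _ Du.
by [].
Qed.

Lemma moving_frame_diff_upto n : mx_diff_upto D' n E -> mx_diff_upto D' n T ->
  mx_diff_upto D' n y -> mx_diff_upto D' n Phi.
Proof.
move=> dE' dT dy; have dW := mx_diff_upto_mul oD' dE' dT.
apply: ord3P => j.
- by apply: (diff_upto_eq oD') (dW 0 j) => u _; rewrite moving_frameE.
- by apply: (diff_upto_eq oD') (dW 1 j) => u _; rewrite moving_frameE.
- by apply: (diff_upto_eq oD') (diff_uptoZ oD' (- eps) (dy 0 j)) => u _; rewrite moving_frameE.
Qed.

Lemma diff_upto_moving_frame : mx_diff_upto D' 1 Phi.
Proof.
apply: moving_frame_diff_upto; first exact: diff_upto_parallel.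
  exact: mx_diff_upto_sub D'D (mx_diff_uptoS diff_upto_T).
exact: mx_diff_upto_sub D'D (mx_diff_uptoS (mx_diff_uptoS (str_diff_y S))).
Qed.

Lemma along_position a u : D' u -> along E a y u = row a (E u *m T u).
Proof.
move=> Du; rewrite /along !(str_dy S (D'D Du)).
by apply/rowP => c; rewrite [RHS]mxE mulmx2E !mxE.
Qed.

Lemma along_tangent a u : D' u -> along E a (fun w => E w *m T w) u =
  - 2^-1 *: (frame_cubic C E a u *m (E u *m T u)) - eps *: ((delta_mx 0 a)^T *m y u).
Proof.
move=> Du.
have dT : mx_diff_upto D' 0 T.
  exact: mx_diff_upto_sub D'D (mx_diff_uptoS (mx_diff_uptoS diff_upto_T)).
have dW m : mxd m (fun w => E w *m T w) u =
    - 2^-1 *: (E u *m C m u *m (E u)^T *m (E u *m T u))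
    - eps *: (E u *m (row m (H u))^T *m y u).
  rewrite (mxdM m dE dT Du) parallelE // (str_dT S (D'D Du)) mulmxBr -scalemxAr !mulmxA.
  rewrite mulmxDr mulmxDl !mulNmx ?mulmxA !addrA addNr add0r; congr (_ - _).
  have K (Z : 'M[R]_(2, 3)) : H u *m ((E u)^T *m (E u *m Z)) = Z.
    by rewrite !mulmxA (frame_dual frameE Du) mul1mx.
  have <- : E u *m N m u *m H u *m (E u)^T *m E u *m T u = E u *m N m u *m T u.
    by rewrite -!mulmxA K.
  by rewrite -[E u *m N m u *m H u]mulmxA (str_N S (D'D Du)) -scalemxAr -!scalemxAl.
rewrite /along !dW /frame_cubic !scalerBr !(scalerA _ (- 2^-1)) !(scalerA _ eps).
have -> : (delta_mx 0 a)^T = E u a 0 *: (E u *m (row 0 (H u))^T)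
                          + E u a 1 *: (E u *m (row 1 (H u))^T) :> 'cV[R]_2.
  rewrite !scalemxAr -mulmxDr.
  have -> : E u a 0 *: (row 0 (H u))^T + E u a 1 *: (row 1 (H u))^T = (row a (E u *m H u))^T.
    by apply/colP => c; rewrite [RHS]mxE [RHS]mxE mulmx2E !mxE.
  have [_ _ _ /(_ u Du) one] := frameE.
  rewrite -{1}[E u]trmxK -trmx_mul; congr (_^T).
  by rewrite -row_mul one row1.
rewrite !mulmxDl -!scalemxAl !scalerDr !scalerA ![eps * _]mulrC ![_ * E u a _]mulrC.
by rewrite opprD addrACA.
Qed.

(** On a parallel frame only the cubic form and the metric contribute to the Gauss
    formula, and both have constant components. *)
Lemma along_moving_frame u : D' u ->
  along E 0 Phi u = mult0 eps (- 2^-1 * k0) (- 2^-1 * k2) *m Phi u /\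
  along E 1 Phi u = mult1 eps (- 2^-1 * k2) (- 2^-1 * k3) *m Phi u.
Proof.
move=> Du; have [c0 c1] := cubicE Du.
have rowW i (j : 'I_3) a : along E a (fun w => E w *m T w) u i j =
    - 2^-1 * (frame_cubic C E a u i 0 * (E u *m T u) 0 j
            + frame_cubic C E a u i 1 * (E u *m T u) 1 j)
    - eps * ((i == a)%:R * y u 0 j).
  rewrite along_tangent //.
  move: (frame_cubic C E a u) (E u *m T u) => F W.
  by rewrite !mxE sum_ord2 big_ord1 !mxE eqxx.
have rowy a j : along E a (fun w => - eps *: y w) u 0 j = - eps * (E u *m T u) a j.
  have -> : (E u *m T u) a j = along E a y u 0 j by rewrite along_position // [RHS]mxE.
  have dy : mx_diff_upto D' 0 y.
    exact: mx_diff_upto_sub D'D (mx_diff_uptoS (mx_diff_uptoS (mx_diff_uptoS (str_diff_y S)))).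
  rewrite /along !(mxd_scale oD' _ _ dy Du); generalize (mxd 0 y u) (mxd 1 y u) => A B.
  by rewrite !mxE; ring.
have ext a (f g : plane -> R) : f =1 g ->
    E u a 0 * pd 0 f u + E u a 1 * pd 1 f u = E u a 0 * pd 0 g u + E u a 1 * pd 1 g u.
  by move=> /funext ->.
have P0 a (j : 'I_3) : along E a Phi u 0 j = along E a (fun w => E w *m T w) u 0 j.
  by rewrite !alongE; apply: ext => w; rewrite moving_frameE.
have P1 a (j : 'I_3) : along E a Phi u (1 : 'I_3) j = along E a (fun w => E w *m T w) u 1 j.
  by rewrite !alongE; apply: ext => w; rewrite moving_frameE.
have P2 a (j : 'I_3) : along E a Phi u 2%:R j = along E a (fun w => - eps *: y w) u 0 j.
  rewrite !alongE; apply: ext => w.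
  by rewrite moving_frameE [RHS]mxE.
split; apply: mx3P => j; rewrite ?P0 ?P1 ?P2 ?rowW ?rowy ?c0 ?c1 ?mx2E mulmx3E;
  rewrite !moving_frameE /mult0 /mult1 !mx3E ?eqxx /=; ring.
Qed.

End OneParallelFrame.

End ExponentialStructure.

Section LinearStructure.
Context {R : realType}.
Local Notation plane := 'rV[R]_2.
Variables (eps : R) (D : set plane) (y : plane -> 'rV[R]_3).
Variables (T : plane -> 'M[R]_(2, 3)) (H : plane -> 'M[R]_2).
Variables (L C N : 'I_2 -> plane -> 'M[R]_2).
Hypothesis S : structure_eqs eps D y T H L C N.
Local Notation frame := (orthonormal_frame D H).

Lemma alongM (D' : set plane) E a p q r (A : plane -> 'M[R]_(p, q))
    (B : plane -> 'M[R]_(q, r)) n u :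
  mx_diff_upto D' n A -> mx_diff_upto D' n B -> D' u ->
  along E a (fun w => A w *m B w) u = along E a A u *m B u + A u *m along E a B u.
Proof.
move=> dA dB Du; rewrite /along !(mxdM _ dA dB Du).
generalize (mxd 0 A u) (mxd 1 A u) (mxd 0 B u) (mxd 1 B u) (A u) (B u) => A0 A1 B0 B1 X Y.
by rewrite !scalerDr !mulmxDl !mulmxDr -!scalemxAl -!scalemxAr addrACA.
Qed.

Lemma along_cstM (D' : set plane) E a p q r (A : 'M[R]_(p, q))
    (B : plane -> 'M[R]_(q, r)) n u : open D' ->
  mx_diff_upto D' n B -> D' u ->
  along E a (fun w => A *m B w) u = A *m along E a B u.
Proof.
move=> oD' dB Du; rewrite (alongM _ _ (mx_diff_upto_cst oD' n A) dB Du).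
by rewrite /along !mxd_cst !scaler0 addr0 mul0mx add0r.
Qed.

Lemma along_Mcst (D' : set plane) E a p q r (A : plane -> 'M[R]_(p, q))
    (B : 'M[R]_(q, r)) n u : open D' ->
  mx_diff_upto D' n A -> D' u ->
  along E a (fun w => A w *m B) u = along E a A u *m B.
Proof.
move=> oD' dA Du; rewrite (alongM _ _ dA (mx_diff_upto_cst oD' n B) Du).
by rewrite /along !mxd_cst !scaler0 addr0 mulmx0 addr0.
Qed.

Lemma along_eq (D' : set plane) E a p q (A B : plane -> 'M[R]_(p, q)) u : open D' ->
  (forall w, D' w -> A w = B w) -> D' u -> along E a A u = along E a B u.
Proof. by move=> oD' AB Du; rewrite /along !(mxd_eq oD' _ AB Du). Qed.

Lemma mxd_along E m p q (A : plane -> 'M[R]_(p, q)) u : E u \in unitmx ->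
  mxd m A u = invmx (E u) m 0 *: along E 0 A u + invmx (E u) m 1 *: along E 1 A u.
Proof.
by move=> uE; exact: (frame_expansion m (fun k => mxd k A u) uE).
Qed.

Section ConstantCubic.
Variables (u0 : plane) (r : R) (E : plane -> 'M[R]_2) (k0 k2 k3 : R).
Hypothesis r0 : 0 < r.
Hypothesis frameE : frame (ball u0 r) E.
Hypothesis parallelE : forall u m, ball u0 r u -> mxd m E u = - (E u *m L m u).
Hypothesis cubicE : forall u, ball u0 r u -> frame_cubic C E 0 u = mx2 k0 0 0 k2 /\
                                             frame_cubic C E 1 u = mx2 0 k2 k2 k3.

Let la := - 2^-1 * k0.
Let mu := - 2^-1 * k2.
Let nu := - 2^-1 * k3.
Let ob : open (ball u0 r). Proof. exact: ball_open. Qed.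
Let u0r : ball u0 r u0. Proof. exact: ballxx. Qed.
Let dPhi := diff_upto_moving_frame S frameE parallelE.

Local Notation Phi := (moving_frame eps y T E).
Local Notation M0 := (mult0 eps la mu).
Local Notation M1 := (mult1 eps mu nu).

(** The coordinate fields of a parallel frame commute, hence so do the
    multiplication matrices: the algebra of the frame is associative. *)
Lemma mult_commute : M1 *m M0 = M0 *m M1.
Proof.
have along2 (M M' : 'M[R]_3) a b :
    (forall u, ball u0 r u -> along E a Phi u = M *m Phi u) ->
    (forall u, ball u0 r u -> along E b Phi u = M' *m Phi u) ->
    along E a (along E b Phi) u0 = M' *m (M *m Phi u0).
  move=> ha hb; rewrite (along_eq _ _ ob hb u0r) (along_cstM _ _ _ ob dPhi u0r).
  by rewrite ha.
have h0 u : ball u0 r u -> along E 0 Phi u = M0 *m Phi u.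
  by move=> ur; have [] := along_moving_frame S frameE parallelE cubicE ur.
have h1 u : ball u0 r u -> along E 1 Phi u = M1 *m Phi u.
  by move=> ur; have [] := along_moving_frame S frameE parallelE cubicE ur.
have comm : along E 0 (along E 1 Phi) u0 = along E 1 (along E 0 Phi) u0.
  apply/matrixP => i j.
  have := along_commute S frameE parallelE (dPhi i j) u0r.
  have gE a : (fun w => E w a 0 * pd 0 (fun w => Phi w i j) w
      + E w a 1 * pd 1 (fun w => Phi w i j) w) = (fun w => along E a Phi w i j).
    by apply/funext => w; rewrite alongE.
  by rewrite /= !gE -!alongE.
have uP := moving_frame_unit S frameE u0r.
rewrite (along2 _ _ _ _ h0 h1) (along2 _ _ _ _ h1 h0) !mulmxA in comm.
by rewrite -[LHS](mulmxK uP) comm mulmxK.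
Qed.

Lemma associativity_equation : mu * mu - la * mu + eps = 0.
Proof.
have /matrixP/(_ 0 1) := mult_commute.
rewrite !mulmx3E /mult0 /mult1 !mx3E => e.
rewrite !(mul0r, mulr0, mul1r, add0r, addr0) in e.
by rewrite e; ring.
Qed.

(** The conjugate of [M] is the expression, on the standard basis of the space, of the
    linear map that has the matrix [M] on the moving frame; it is constant because the
    derivatives of the frame commute with [M]. *)
Lemma conjugate_constant (M : 'M[R]_3) u : M *m M0 = M0 *m M -> M *m M1 = M1 *m M ->
  ball u0 r u -> invmx (Phi u) *m M *m Phi u = invmx (Phi u0) *m M *m Phi u0.
Proof.
move=> c0 c1; pose B u := invmx (Phi u) *m M *m Phi u.
have uP w : ball u0 r w -> Phi w \in unitmx by exact: (moving_frame_unit S frameE).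
have dB : mx_diff_upto (ball u0 r) 1 B.
  apply: mx_diff_upto_mul => //; apply: mx_diff_upto_mul => //.
    exact: mx_diff_upto_inv.
  exact: mx_diff_upto_cst.
apply: (mxd0_constant dB) => w wr m.
have a0 a (X : 'M[R]_3) : M *m X = X *m M ->
    (forall u, ball u0 r u -> along E a Phi u = X *m Phi u) -> along E a B w = 0.
  move=> cX hX.
  have PB v : ball u0 r v -> Phi v *m B v = M *m Phi v.
    by move=> vr; rewrite /B !mulmxA mulmxV ?uP // mul1mx.
  have := along_eq E a ob PB wr.
  rewrite (alongM _ _ dPhi dB wr) (along_cstM _ _ _ ob dPhi wr) hX // mulmxA cX.
  rewrite -[X *m M *m _]mulmxA -PB // !mulmxA => /eqP.
  rewrite -subr_eq0 addrAC subrr add0r => /eqP e.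
  by rewrite -[LHS](mulKmx (uP w wr)) e mulmx0.
rewrite (mxd_along _ _ (frame_mx_unit frameE wr)).
rewrite (a0 0 M0 c0) => [|v vr]; last by have [] := along_moving_frame S frameE parallelE cubicE vr.
rewrite (a0 1 M1 c1) => [|v vr]; last by have [] := along_moving_frame S frameE parallelE cubicE vr.
by rewrite !scaler0 addr0.
Qed.

(** Because [invmx Phi *m M *m Phi] is constant for both multiplication matrices, the
    derivative of the position vector is its image under a fixed linear map, which the
    change of coordinates turns into [N0] or [N1]. *)
Lemma linear_coordinates (P N0 N1 : 'M[R]_3) : P \in unitmx ->
  M0 *m P = P *m N0 -> M1 *m P = P *m N1 ->
  exists2 A : 'M[R]_3, A \in unitmx &
   (y u0 *m A = - eps *: row 2%:R P) /\
   forall u, ball u0 r u ->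
     along E 0 (fun w => y w *m A) u = y u *m A *m N0 /\
     along E 1 (fun w => y w *m A) u = y u *m A *m N1.
Proof.
move=> uPm e0 e1.
have uP w : ball u0 r w -> Phi w \in unitmx by exact: (moving_frame_unit S frameE).
have yE u : y u = - eps *: row 2%:R (Phi u).
  apply/rowP => j; rewrite [RHS]mxE [row _ _ _ _]mxE moving_frameE mulrA mulrNN (str_eps2 S).
  by rewrite mul1r.
exists (invmx (Phi u0) *m P); first by rewrite unitmx_mul unitmx_inv uP.
split.
  by rewrite yE -scalemxAl -row_mul mulmxA mulmxV ?uP // mul1mx.
have dy : mx_diff_upto (ball u0 r) 1 y.
  case: frameE => _ s _ _.
  exact: mx_diff_upto_sub s (mx_diff_uptoS (mx_diff_uptoS (str_diff_y S))).
have key a (M N' : 'M[R]_3) u : ball u0 r u -> M *m P = P *m N' ->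
    invmx (Phi u) *m M *m Phi u = invmx (Phi u0) *m M *m Phi u0 ->
    along E a Phi u = M *m Phi u ->
    along E a (fun w => y w *m (invmx (Phi u0) *m P)) u =
    y u *m (invmx (Phi u0) *m P) *m N'.
  move=> ur eP cst al.
  rewrite (along_Mcst _ _ _ ob dy ur).
  have -> : along E a y u = - eps *: row 2%:R (along E a Phi u).
    have yE' w : ball u0 r w -> y w = (- eps *: (delta_mx 0 2%:R : 'rV[R]_3)) *m Phi w.
      by move=> _; rewrite {1}yE -scalemxAl -rowE.
    by rewrite (along_eq E a ob yE' ur) (along_cstM _ _ _ ob dPhi ur) -scalemxAl -rowE.
  rewrite al yE -!scalemxAl; congr (_ *: _).
  rewrite -!row_mul; congr (row _ _).
  have -> : M *m Phi u = Phi u *m (invmx (Phi u0) *m M *m Phi u0).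
    by rewrite -cst !mulmxA mulmxV ?uP // mul1mx.
  rewrite -!mulmxA [Phi u0 *m (_ *m _)]mulmxA mulmxV ?uP // mul1mx.
  by rewrite eP.
move=> u ur; have [a0 a1] := along_moving_frame S frameE parallelE cubicE ur.
split; [apply: key a0|apply: key a1] => //; apply: conjugate_constant => //.
  by rewrite mult_commute.
by rewrite mult_commute.
Qed.

End ConstantCubic.

(** All that the classification needs to know of the geometry: three numbers with one
    relation, and a linear system with constant coefficients that they determine in any
    basis [P] of the algebra. *)
Lemma exponential_structure u0 : D u0 -> ~ (forall m, C m u0 = 0) ->
  exists r E la mu nu, [/\ 0 < r, ball u0 r `<=` D,
   forall u, ball u0 r u -> E u \in unitmx, mu * mu - la * mu + eps = 0 &
   forall P N0 N1 : 'M[R]_3, P \in unitmx ->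
     mult0 eps la mu *m P = P *m N0 -> mult1 eps mu nu *m P = P *m N1 ->
     exists2 A : 'M[R]_3, A \in unitmx &
     (y u0 *m A = - eps *: row 2%:R P) /\
     forall u, ball u0 r u ->
       along E 0 (fun w => y w *m A) u = y u *m A *m N0 /\
       along E 1 (fun w => y w *m A) u = y u *m A *m N1].
Proof.
move=> Du0 Cn.
have [r [E [k0 [k2 [k3 [r0 frE parE cubE]]]]]] := normal_parallel_frame S Du0 Cn.
exists r, E, (- 2^-1 * k0), (- 2^-1 * k2), (- 2^-1 * k3); split=> //.
- by case: frE.
- by move=> u ur; apply: frame_mx_unit frE _ ur.
- exact: associativity_equation r0 frE parE cubE.
- by move=> P N0 N1; apply: linear_coordinates r0 frE parE cubE P N0 N1.
Qed.

End LinearStructure.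

(** * Recognizing the models *)

Section PatchOnModel.
Context {R : realType}.
Local Notation plane := 'rV[R]_2.
Implicit Types (D : set plane) (y z : plane -> 'rV[R]_3) (Q : set 'rV[R]_3).

(** Near [u0], the map [z] is a homeomorphism onto a relatively open part of [Q]. *)
Definition embedded_in D z u0 Q : Prop :=
  exists2 r, 0 < r & [/\ ball u0 r `<=` D,
    forall a b, ball u0 r a -> ball u0 r b -> z a = z b -> a = b &
    forall O, open O -> O `<=` ball u0 r ->
      exists2 V, open V & z @` O = Q `&` V].

Definition coord_pair (j1 j2 : 'I_3) (v : 'rV[R]_3) : 'rV[R]_2 :=
  \row_(k < 2) v 0 (if k == 0 then j1 else j2).

Lemma coord_pair_continuous j1 j2 : continuous (coord_pair j1 j2).
Proof.
have -> : coord_pair j1 j2 =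
   (fun v => v *m \matrix_(i, k) (i == if k == 0 then j1 else j2)%:R).
  apply/funext => v; apply/rowP => k; rewrite !mxE.
  rewrite (bigD1 (if k == 0 then j1 else j2)) //= mxE eqxx mulr1 big1 ?addr0 // => i ni.
  by rewrite mxE (negPf ni) mulr0.
exact: mulmxr_continuous.
Qed.

(** When [Q] is locally a graph over two of the coordinates, the inverse of the
    pair of these coordinates gives the homeomorphism. *)
Lemma graph_embedded D z u0 Q (V0 : set 'rV[R]_3) j1 j2 :
  open D -> D u0 -> mx_diff_upto D 1 z -> (forall u, D u -> Q (z u)) ->
  open V0 -> V0 (z u0) ->
  (forall v w, Q v -> Q w -> V0 v -> V0 w ->
     v 0 j1 = w 0 j1 -> v 0 j2 = w 0 j2 -> v = w) ->
  jacobian_mx (coord_pair j1 j2 \o z) u0 \in unitmx ->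
  embedded_in D z u0 Q.
Proof.
move=> oD Du0 dz zQ oV0 V00 inj uJ.
have cz u : D u -> {for u, continuous z}.
  move=> Du B /nbhs_ballP[e /= e0 eB].
  have h i j : \forall w \near u, `|z u i j - z w i j| < e.
    have cf := differentiable_continuous (diff_upto_differentiable (dz i j) Du).
    by have /cvgrPdist_lt := cf; apply.
  apply: (@filterS _ _ _ (fun w => forall i j, `|z u i j - z w i j| < e)).
    by move=> w hw; apply: eB; split => // i j; apply: hw.
  apply: (@filter_forall _ _ (fun i w => forall j, `|z u i j - z w i j| < e) (nbhs u)) => i.
  by apply: (@filter_forall _ _ (fun j w => `|z u i j - z w i j| < e) (nbhs u)) => j; exact: h.
pose D1 := D `&` z @^-1` V0.
have oD1 : open D1.
  rewrite openE => u [Du Vu]; apply: filterI; first exact: open_nbhs_nbhs.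
  by apply: (cz u Du); apply: open_nbhs_nbhs.
have D1D : D1 `<=` D by move=> u [].
have dF : mx_diff_upto D1 1 (coord_pair j1 j2 \o z).
  move=> i k; apply: diff_upto_sub D1D _.
  by apply: (diff_upto_eq oD) (dz 0 (if k == 0 then j1 else j2)) => w _; rewrite !mxE.
have [r r0 [rD1 Finj Fopen]] := local_inversion oD1 (conj Du0 V00) dF uJ.
exists r => //; split.
- by move=> u /rD1[].
- by move=> a b ar br E; apply: Finj => //=; rewrite E.
move=> O oO Or; exists (V0 `&` coord_pair j1 j2 @^-1` ((coord_pair j1 j2 \o z) @` O)).
  apply: openI => //; apply: open_comp; last exact: Fopen.
  by move=> v _; apply: coord_pair_continuous.
apply/seteqP; split=> [_ [u Ou <-]|v [Qv [V0v /= [u Ou E]]]].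
  by have [Du Vu] := rD1 _ (Or _ Ou); split; [apply: zQ|split=> //; exists u].
have [Du Vu] := rD1 _ (Or _ Ou).
exists u => //; apply: inj => //; first exact: zQ.
  by move/rowP: E => /(_ 0); rewrite !mxE.
by move/rowP: E => /(_ 1); rewrite !mxE.
Qed.

End PatchOnModel.

Section ModelsFromEquations.
Context {R : realType}.
Local Notation plane := 'rV[R]_2.
Variables (D : set plane) (u0 : plane) (E : plane -> 'M[R]_2) (z : plane -> 'rV[R]_3).
Hypothesis oD : open D.
Hypothesis Du0 : D u0.
Hypothesis unitE : forall u, D u -> E u \in unitmx.
Hypothesis dz : mx_diff_upto D 1 z.

Definition frame_deriv a j (g : plane -> R) : Prop :=
  forall u, D u -> has_dir_deriv (fun w => z w 0 j) u (row a (E u)) (g u).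

Lemma frame_gradient0 (B : set plane) (f : plane -> R) u : B `<=` D -> B u ->
  (forall a, has_dir_deriv f u (row a (E u)) 0) ->
  differentiable f u /\ forall i, pd i f u = 0.
Proof.
move=> BD Bu h; have [df _] := h 0; split=> // i.
have e a : E u a 0 * pd 0 f u + E u a 1 * pd 1 f u = 0.
  by have [_] := h a; rewrite dir_deriv_linear // !mxE.
have : E u *m (\col_k pd k f u) = 0.
  by apply/colP => a; rewrite mulmx2E !mxE e.
move=> /(congr1 (mulmx (invmx (E u)))); rewrite mulKmx ?unitE //; last exact: BD.
by rewrite mulmx0 => /colP/(_ i); rewrite !mxE.
Qed.

Lemma frame_constant r (f : plane -> R) : ball u0 r `<=` D ->
  (forall u a, ball u0 r u -> has_dir_deriv f u (row a (E u)) 0) ->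
  forall u, ball u0 r u -> f u = f u0.
Proof.
move=> rD h; apply: gradient0_constant => w wr.
by apply: (frame_gradient0 rD wr) => a; apply: h.
Qed.

Lemma frame_jacobian_unit j1 j2 (g : 'I_2 -> 'I_3 -> plane -> R) :
  (forall a j, frame_deriv a j (g a j)) ->
  g 0 j1 u0 * g 1 j2 u0 - g 0 j2 u0 * g 1 j1 u0 != 0 ->
  jacobian_mx (coord_pair j1 j2 \o z) u0 \in unitmx.
Proof.
move=> h n0.
pose X : 'M[R]_2 := \matrix_(a, k) g a (if k == 0 then j1 else j2) u0.
have EJ : E u0 *m jacobian_mx (coord_pair j1 j2 \o z) u0 = X.
  apply/matrixP => a k; rewrite mulmx2E [RHS]mxE [X in _ * X + _]mxE [X in _ + _ * X]mxE.
  have -> : (fun w => (coord_pair j1 j2 \o z) w 0 k) =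
            (fun w => z w 0 (if k == 0 then j1 else j2)).
    by apply/funext => w; rewrite !mxE.
  have [df] := h a (if k == 0 then j1 else j2) u0 Du0.
  by rewrite dir_deriv_linear // !mxE.
have : X \in unitmx by rewrite unitmxE det_mx2 !mxE /= unitfE.
by rewrite -EJ unitmx_mul => /andP[].
Qed.

Lemma coord_differentiable j u : D u -> differentiable (fun w => z w 0 j) u.
Proof. exact: diff_upto_differentiable (dz 0 j). Qed.

Lemma coords_positive_near (J : pred 'I_3) : (forall j, J j -> 0 < z u0 0 j) ->
  exists2 r, 0 < r & ball u0 r `<=` D /\ forall u j, ball u0 r u -> J j -> 0 < z u 0 j.
Proof.
move=> pos; have : \forall u \near u0, D u /\ forall j, J j -> 0 < z u 0 j.
  apply: filterI; first exact: open_nbhs_nbhs.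
  apply: (@filter_forall _ _ (fun j w => J j -> 0 < z w 0 j) (nbhs u0)) => j.
  case Jj : (J j); last by apply: nearW.
  have cz := differentiable_continuous (coord_differentiable j Du0).
  by apply: filterS (cvgr_gt _ cz 0 (pos j Jj)) => w wj _.
by move=> /nbhs_ballP[r /= r0 h]; exists r => //; split=> [u /h[] //|u j /h[_]]; exact.
Qed.

Lemma embedded_in_sub (B : set plane) Q : B `<=` D ->
  embedded_in B z u0 Q -> embedded_in D z u0 Q.
Proof. by move=> BD [r r0 [rB i o]]; exists r => //; split=> // u /rB/BD. Qed.

Lemma graph_near r Q j1 j2 : 0 < r -> ball u0 r `<=` D ->
  (forall u, ball u0 r u -> Q (z u)) ->
  (forall v w, Q v -> Q w -> v 0 j1 = w 0 j1 -> v 0 j2 = w 0 j2 -> v = w) ->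
  jacobian_mx (coord_pair j1 j2 \o z) u0 \in unitmx -> embedded_in D z u0 Q.
Proof.
move=> r0 rD zQ inj uJ; apply: (embedded_in_sub rD).
apply: (graph_embedded (V0 := setT) (j1 := j1) (j2 := j2)) => //.
- exact: ball_open.
- exact: ballxx.
- exact: mx_diff_upto_sub rD dz.
- exact: openT.
by move=> v w Qv Qw _ _; exact: inj.
Qed.

Lemma has_dir_deriv_ln f u v (a : R) : 0 < f u -> has_dir_deriv f u v (a * f u) ->
  has_dir_deriv (fun w => ln (f w)) u v a.
Proof.
move=> f0 hf; apply: has_dir_deriv_eq (has_dir_deriv_comp (is_derive1_ln f0) hf) _.
by rewrite mulrCA mulVf ?mulr1 // gt_eqF.
Qed.

(** In each of the following lemmas the hypotheses make the derivative of the logarithm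
    of the defining function vanish along the frame, so that the surface stays in the
    model through the base point. *)
Lemma power_embedded (p q a : 'I_3 -> R) :
  (forall j, frame_deriv 0 j (fun u => p j * z u 0 j)) ->
  (forall j, frame_deriv 1 j (fun u => q j * z u 0 j)) ->
  (forall j, z u0 0 j = 1) ->
  a 0 * p 0 + a 1 * p 1 + a 2%:R * p 2%:R = 0 ->
  a 0 * q 0 + a 1 * q 1 + a 2%:R * q 2%:R = 0 ->
  a 2%:R != 0 -> p 0 * q 1 - p 1 * q 0 != 0 ->
  embedded_in D z u0 (model_power (a 0) (a 1) (a 2%:R)).
Proof.
move=> hp hq z1 ep eq a2 pq.
have [r r0 [rD P']] := coords_positive_near (J := predT) (fun j _ => ltac:(by rewrite z1)).
have P j u : ball u0 r u -> 0 < z u 0 j by move=> ur; exact: P'.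
pose g u := a 0 * ln (z u 0 0) + a 1 * ln (z u 0 1) + a 2%:R * ln (z u 0 2%:R).
have g0 u : ball u0 r u -> g u = 0.
  move=> ur; have -> : g u = g u0.
    apply: (frame_constant rD) ur => {}u b ur; have Du := rD u ur.
    pose s j := if b == 0 then p j else q j.
    have hs j : has_dir_deriv (fun w => ln (z w 0 j)) u (row b (E u)) (s j).
      apply: has_dir_deriv_ln; first exact: P.
      by rewrite /s; move: b {s}; apply: ord2P; [apply: hp|apply: hq].
    apply: has_dir_deriv_eq (has_dir_derivD (has_dir_derivD (has_dir_derivZ (a 0) (hs 0))
      (has_dir_derivZ (a 1) (hs 1))) (has_dir_derivZ (a 2%:R) (hs 2%:R))) _.
    by rewrite /s; case: ifP.
  by rewrite /g !z1 ln1 !mulr0 !addr0.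
apply: (graph_near (j1 := 0) (j2 := 1) _ rD) => //.
- move=> u ur; split; rewrite ?P //.
  have e j : z u 0 j `^ a j = expR (a j * ln (z u 0 j)) by rewrite /powR gt_eqF ?P.
  by rewrite /coord1 /coord2 /coord3 !e -!expRD -/(g u) g0 // expR0.
- move=> v w [v0 v1 v2 ve] [w0 w1 w2 we] e0 e1.
  apply/rowP; apply: ord3P => //.
  have : coord3 v `^ a 2%:R = coord3 w `^ a 2%:R.
    apply: (@mulfI _ (coord1 v `^ a 0 * coord2 v `^ a 1)).
      by rewrite mulf_neq0 // gt_eqF // powR_gt0.
    by rewrite ve /coord1 /coord2 e0 e1 -we.
  move/(congr1 (@ln R)); rewrite !ln_powR => /(mulfI a2).
  by move/ln_inj; apply.
- apply: (frame_jacobian_unit (g := fun b j u => (if b == 0 then p j else q j) * z u 0 j)).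
    by apply: ord2P => j; [apply: hp|apply: hq].
  by rewrite /= !z1 !mulr1.
Qed.

Lemma arctan_embedded (p c d : 'I_2 -> R) (a1 a2 a3 : R) :
  (forall b, frame_deriv b 0 (fun u => p b * z u 0 0)) ->
  (forall b, frame_deriv b 1 (fun u => c b * z u 0 1 + d b * z u 0 2%:R)) ->
  (forall b, frame_deriv b 2%:R (fun u => c b * z u 0 2%:R - d b * z u 0 1)) ->
  z u0 0 0 = 1 -> z u0 0 1 = 0 -> z u0 0 2%:R = 1 ->
  (forall b, a1 * p b + 2 * a2 * c b + a3 * d b = 0) ->
  a1 != 0 -> d 0 * c 1 - c 0 * d 1 != 0 ->
  embedded_in D z u0 (model_arctan a1 a2 a3).
Proof.
move=> h0 h1 h2 z0 z1 z2 rel a10 cd.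
have [|r rr0 [rD P]] := coords_positive_near (J := mem [:: 0; 2%:R]).
  by move=> j; rewrite !inE => /orP[] /eqP ->; rewrite ?z0 ?z2.
have P0 u : ball u0 r u -> 0 < z u 0 0 by move=> ur; exact: P.
have P2 u : ball u0 r u -> 0 < z u 0 2%:R by move=> ur; exact: P.
pose n u := z u 0 1 ^+ 2 + z u 0 2%:R ^+ 2.
have npos u : ball u0 r u -> 0 < n u.
  by move=> ur; apply: ltr_wpDl; [exact: sqr_ge0|apply: exprn_gt0; apply: P2].
pose g u := a1 * ln (z u 0 0) + a2 * ln (n u) + a3 * atan (z u 0 1 * (z u 0 2%:R)^-1).
have g0 u : ball u0 r u -> g u = 0.
  move=> ur; have -> : g u = g u0.
    apply: (frame_constant rD) ur => {}u b ur; have Du := rD u ur.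
    have x0 : z u 0 2%:R != 0 by rewrite gt_eqF // P2.
    have e0 := has_dir_deriv_ln (P0 u ur) (h0 b u Du).
    have e1 := h1 b u Du; have e2 := h2 b u Du.
    have en : has_dir_deriv n u (row b (E u)) (2 * c b * n u).
      apply: has_dir_deriv_eq (has_dir_derivD (has_dir_derivM e1 e1) (has_dir_derivM e2 e2)) _.
      by rewrite /n; ring.
    have el := has_dir_deriv_ln (npos u ur) en.
    have ea := has_dir_deriv_comp (is_derive1_atan _) (has_dir_derivM e1 (has_dir_derivV x0 e2)).
    have := npos u ur; rewrite /n => n0.
    apply: has_dir_deriv_eq (has_dir_derivD (has_dir_derivD (has_dir_derivZ a1 e0)
      (has_dir_derivZ a2 el)) (has_dir_derivZ a3 ea)) _.
    rewrite -(rel b) mulrA [a2 * 2]mulrC; congr (_ + _ + a3 * _).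
    by field; rewrite x0 addrC gt_eqF.
  by rewrite /g /n z0 z1 z2 mul0r atan0 expr0n expr1n add0r !ln1 !mulr0 !addr0.
apply: (graph_near (j1 := 1) (j2 := 2%:R) _ rD) => //.
- move=> u ur; split; first exact: P0.
    by rewrite gt_eqF // P2.
  rewrite /powR !gt_eqF; [|exact: npos|exact: P0].
  by rewrite -!expRD /coord1 /coord2 /coord3 -/(n u) -/(g u) g0 // expR0.
- move=> v w [v0 v2 ve] [w0 w2 we] e1 e2.
  apply/rowP; apply: ord3P => //.
  have : coord1 v `^ a1 = coord1 w `^ a1.
    apply: (@mulIf _ ((coord2 v ^+ 2 + coord3 v ^+ 2) `^ a2
       * expR (a3 * atan (coord2 v / coord3 v)))).
      rewrite mulf_neq0 // ?gt_eqF ?expR_gt0 // powR_gt0 // ltr_wpDl ?sqr_ge0 //.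
      by rewrite lt0r sqr_ge0 expf_neq0.
    by rewrite !mulrA ve /coord2 /coord3 e1 e2 -we.
  move/(congr1 (@ln R)); rewrite !ln_powR => /(mulfI a10).
  by move/ln_inj; apply.
- apply: (frame_jacobian_unit (g := fun b j u => if j == 0 then p b * z u 0 0 else
      if j == 1 then c b * z u 0 1 + d b * z u 0 2%:R else c b * z u 0 2%:R - d b * z u 0 1)).
    by move=> b; apply: ord3P; [apply: h0|apply: h1|apply: h2].
  by rewrite /= z1 z2 !mulr0 !mulr1 !add0r !subr0.
Qed.

Lemma log_embedded (p q : 'I_2 -> R) (a2 : R) :
  (forall b, frame_deriv b 0 (fun u => p b * z u 0 0)) ->
  (forall b, frame_deriv b 1 (fun u => q b * z u 0 1)) ->
  (forall b, frame_deriv b 2%:R (fun u => p b * z u 0 2%:R + (p b - a2 * q b) * z u 0 0)) ->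
  z u0 0 0 = 1 -> z u0 0 1 = 1 -> z u0 0 2%:R = 0 ->
  p 0 * q 1 - q 0 * p 1 != 0 ->
  embedded_in D z u0 (model_log a2).
Proof.
move=> h0 h1 h2 z0 z1 z2 pq.
have [|r rr0 [rD P]] := coords_positive_near (J := mem [:: 0; 1]).
  by move=> j; rewrite !inE => /orP[] /eqP ->; rewrite ?z0 ?z1.
have P0 u : ball u0 r u -> 0 < z u 0 0 by move=> ur; exact: P.
have P1 u : ball u0 r u -> 0 < z u 0 1 by move=> ur; exact: P.
pose g u := z u 0 2%:R * (z u 0 0)^-1 - (ln (z u 0 0) - a2 * ln (z u 0 1)).
have g0 u : ball u0 r u -> g u = 0.
  move=> ur; have -> : g u = g u0.
    apply: (frame_constant rD) ur => {}u b ur; have Du := rD u ur.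
    have z0p := P0 u ur.
    have z0n : z u 0 0 != 0 by rewrite gt_eqF.
    have e0 := h0 b u Du; have e2 := h2 b u Du.
    have l0 := has_dir_deriv_ln z0p e0.
    have l1 := has_dir_deriv_ln (P1 u ur) (h1 b u Du).
    apply: has_dir_deriv_eq (has_dir_derivB (has_dir_derivM e2 (has_dir_derivV z0n e0))
      (has_dir_derivB l0 (has_dir_derivZ a2 l1))) _.
    by field; rewrite z0n.
  by rewrite /g z0 z1 z2 !ln1; ring.
apply: (graph_near (j1 := 0) (j2 := 1) _ rD) => //.
- move=> u ur; have z0p := P0 u ur; split => //; first exact: P1.
  have /eqP := g0 u ur; rewrite subr_eq0 /coord1 /coord2 /coord3 => /eqP <-.
  by rewrite mulrC divfK // gt_eqF.
- move=> v w [_ _ ve] [_ _ we] e0 e1.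
  apply/rowP; apply: ord3P => //.
  by move: ve we; rewrite /coord1 /coord2 /coord3 e0 e1 => -> ->.
- apply: (frame_jacobian_unit (g := fun b j u => if j == 0 then p b * z u 0 0 else
      if j == 1 then q b * z u 0 1 else p b * z u 0 2%:R + (p b - a2 * q b) * z u 0 0)).
    by move=> b; apply: ord3P; [apply: h0|apply: h1|apply: h2].
  by rewrite /= z0 z1 !mulr1.
Qed.

Lemma parab_log_embedded (p q : 'I_2 -> R) :
  (forall b, frame_deriv b 0 (fun u => p b * z u 0 0)) ->
  (forall b, frame_deriv b 1 (fun u => p b * z u 0 1 + q b * z u 0 0)) ->
  (forall b, frame_deriv b 2%:R
     (fun u => p b * z u 0 2%:R + q b * z u 0 1 + p b * z u 0 0)) ->
  z u0 0 0 = 1 -> z u0 0 1 = 0 -> z u0 0 2%:R = 0 ->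
  p 0 * q 1 - q 0 * p 1 != 0 ->
  embedded_in D z u0 model_parab_log.
Proof.
move=> h0 h1 h2 z0 z1 z2 pq.
have [|r rr0 [rD P]] := coords_positive_near (J := pred1 0).
  by move=> j /eqP ->; rewrite z0.
have P0 u : ball u0 r u -> 0 < z u 0 0 by move=> ur; apply: P => /=.
pose k u := z u 0 1 * (z u 0 0)^-1.
pose g u := z u 0 2%:R * (z u 0 0)^-1 - 2^-1 * (k u * k u) - ln (z u 0 0).
have g0 u : ball u0 r u -> g u = 0.
  move=> ur; have -> : g u = g u0.
    apply: (frame_constant rD) ur => {}u b ur; have Du := rD u ur.
    have z0n : z u 0 0 != 0 by rewrite gt_eqF // P0.
    have e0 := h0 b u Du; have e1 := h1 b u Du; have e2 := h2 b u Du.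
    have l0 := has_dir_deriv_ln (P0 u ur) e0.
    have eV := has_dir_derivV z0n e0.
    have ek := has_dir_derivM e1 eV.
    apply: has_dir_deriv_eq (has_dir_derivB (has_dir_derivB (has_dir_derivM e2 eV)
      (has_dir_derivZ 2^-1 (has_dir_derivM ek ek))) l0) _.
    by field; rewrite z0n.
  by rewrite /g /k z0 z1 z2 !ln1; ring.
apply: (graph_near (j1 := 0) (j2 := 1) _ rD) => //.
- move=> u ur; have z0p := P0 u ur; split => //.
  have z0n : z u 0 0 != 0 by rewrite gt_eqF.
  have := g0 u ur; rewrite /g /k /coord1 /coord2 /coord3; move: (ln _) => l e.
  have -> : l = z u 0 2%:R * (z u 0 0)^-1
     - 2^-1 * (z u 0 1 * (z u 0 0)^-1 * (z u 0 1 * (z u 0 0)^-1)).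
    by apply/eqP; rewrite eq_sym -subr_eq0 e.
  by field.
- move=> v w [_ ve] [_ we] e0 e1.
  apply/rowP; apply: ord3P => //.
  by move: ve we; rewrite /coord1 /coord2 /coord3 e0 e1 => -> ->.
- apply: (frame_jacobian_unit (g := fun b j u => if j == 0 then p b * z u 0 0 else
      if j == 1 then p b * z u 0 1 + q b * z u 0 0
      else p b * z u 0 2%:R + q b * z u 0 1 + p b * z u 0 0)).
    by move=> b; apply: ord3P; [apply: h0|apply: h1|apply: h2].
  by rewrite /= z0 z1 !mulr0 !mulr1 !add0r.
Qed.

End ModelsFromEquations.

(** * Classification of the algebras and of the surfaces with nonzero cubic form *)

Definition nonquadric_model {R : realType} (Q : set 'rV[R]_3) : Prop :=
  (exists a1 a2 a3 : R,
     ((0 < a1 /\ 0 < a2 /\ 0 < a3) \/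
      (a1 < 0 /\ 0 < a2 /\ 0 < a3 /\ a1 + a2 + a3 < 0)) /\
     Q = model_power a1 a2 a3) \/
  (exists a1 a2 a3 : R, (a1 < 0 /\ 0 < a1 + 2 * a2) /\ Q = model_arctan a1 a2 a3) \/
  (exists a2 : R, (0 < a2 /\ a2 < 1) /\ Q = model_log a2) \/
  Q = model_parab_log.

Section NonquadricSurfaces.
Context {R : realType}.
Local Notation plane := 'rV[R]_2.
Variables (eps : R) (D : set plane) (y : plane -> 'rV[R]_3).
Variables (u0 : plane) (r : R) (E : plane -> 'M[R]_2) (la mu nu : R).
Hypothesis eps2 : eps * eps = 1.
Hypothesis dy : mx_diff_upto D 1 y.
Hypothesis r0 : 0 < r.
Hypothesis rD : ball u0 r `<=` D.
Hypothesis unitE : forall u, ball u0 r u -> E u \in unitmx.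
Hypothesis assoc : mu * mu - la * mu + eps = 0.
Hypothesis linear : forall P N0 N1 : 'M[R]_3, P \in unitmx ->
   mult0 eps la mu *m P = P *m N0 -> mult1 eps mu nu *m P = P *m N1 ->
   exists2 A : 'M[R]_3, A \in unitmx &
   (y u0 *m A = - eps *: row 2%:R P) /\
   forall u, ball u0 r u ->
     along E 0 (fun w => y w *m A) u = y u *m A *m N0 /\
     along E 1 (fun w => y w *m A) u = y u *m A *m N1.

Definition has_model (Q : set 'rV[R]_3) : Prop :=
  exists2 A : 'M[R]_3, A \in unitmx & embedded_in D (fun w => y w *m A) u0 Q.

(** The coordinates given by the basis [P] of the algebra carry the equations with the
    matrices [N0] and [N1]; it remains to recognize a model in them. *)
Lemma linear_model (P N0 N1 : 'M[R]_3) Q : P \in unitmx ->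
  mult0 eps la mu *m P = P *m N0 -> mult1 eps mu nu *m P = P *m N1 ->
  (forall z : plane -> 'rV[R]_3, mx_diff_upto (ball u0 r) 1 z ->
     (forall j, z u0 0 j = - eps * P 2%:R j) ->
     (forall b j, frame_deriv (ball u0 r) E z b j
        (fun u => let M := if b == 0 then N0 else N1 in
           z u 0 0 * M 0 j + z u 0 1 * M 1 j + z u 0 2%:R * M 2%:R j)) ->
     embedded_in (ball u0 r) z u0 Q) ->
  has_model Q.
Proof.
move=> uP e0 e1 h; have [A uA [zu0 al]] := linear uP e0 e1.
have ob : open (ball u0 r) by apply: ball_open.
exists A => //; apply: (embedded_in_sub rD); apply: h.
- apply: mx_diff_upto_mul => //; last exact: mx_diff_upto_cst.
  exact: mx_diff_upto_sub rD dy.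
- by move=> j; rewrite zu0 [LHS]mxE [row _ _ _ _]mxE.
have dz : mx_diff_upto (ball u0 r) 1 (fun w => y w *m A).
  apply: mx_diff_upto_mul => //; last exact: mx_diff_upto_cst.
  exact: mx_diff_upto_sub rD dy.
move=> b j u ur; have df := diff_upto_differentiable (dz 0 j) ur.
split=> //; rewrite dir_deriv_linear // ![row _ _ _ _]mxE.
have [a0 a1] := al u ur.
have -> : E u b 0 * pd 0 (fun w => (y w *m A) 0 j) u + E u b 1 * pd 1 (fun w => (y w *m A) 0 j) u
    = along E b (fun w => y w *m A) u 0 j by rewrite alongE.
rewrite /= -mulmx3E; congr (fun_of_matrix _ 0 j).
by move: b; apply: ord2P.
Qed.

Let ka := la - mu.

Let mu0 : mu != 0.
Proof.
apply/eqP => m0; move: assoc (sqr1_neq0 eps2); rewrite m0 !mulr0 subr0 add0r => ->.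
by rewrite eqxx.
Qed.

Let laE : la = mu + ka. Proof. by rewrite /ka addrC subrK. Qed.

Let kamu : ka * mu = eps.
Proof. by apply/eqP; rewrite -subr_eq0 /ka -oppr_eq0 -[X in _ == X]assoc; apply/eqP; ring. Qed.

Let ka0 : ka != 0.
Proof.
by apply/eqP => k0; move: kamu (sqr1_neq0 eps2); rewrite k0 mul0r => <-; rewrite eqxx.
Qed.

Lemma eps_cases : eps = 1 \/ eps = - 1.
Proof.
have : (eps - 1) * (eps + 1) == 0 by rewrite -subr_sqr expr2 eps2 expr1n subrr.
by rewrite mulf_eq0 subr_eq0 addr_eq0 => /orP[/eqP->|/eqP->]; [left|right].
Qed.

(** The pair [(p, q)] gives the values on the frame of a character of the algebra. *)
Definition is_character p q : Prop :=
  [/\ p * p = la * p - eps, p * q = mu * q & q * q = mu * p + nu * q - eps].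

Lemma character_ka : is_character ka 0.
Proof. by split; rewrite ?laE ?mulr0 // -kamu; ring. Qed.

Lemma character_mu s : s * s = mu * mu + nu * s - eps -> is_character mu s.
Proof. by move=> e; split=> //; rewrite laE -kamu; ring. Qed.

Lemma power_model (p q a : 'I_3 -> R) :
  (forall j, is_character (p j) (q j)) ->
  p 0 * (q 1 - q 2%:R) - p 1 * (q 0 - q 2%:R) + p 2%:R * (q 0 - q 1) != 0 ->
  a 0 * p 0 + a 1 * p 1 + a 2%:R * p 2%:R = 0 ->
  a 0 * q 0 + a 1 * q 1 + a 2%:R * q 2%:R = 0 ->
  a 2%:R != 0 -> p 0 * q 1 - p 1 * q 0 != 0 ->
  has_model (model_power (a 0) (a 1) (a 2%:R)).
Proof.
move=> ch dn ep eq an pq.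
pose P := mx3 (p 0) (p 1) (p 2%:R) (q 0) (q 1) (q 2%:R) (- eps) (- eps) (- eps).
pose diag (f : 'I_3 -> R) := mx3 (f 0) 0 0 0 (f 1) 0 0 0 (f 2%:R).
have [c00 c01 c02] := ch 0; have [c10 c11 c12] := ch 1; have [c20 c21 c22] := ch 2%:R.
apply: (@linear_model P (diag p) (diag q)).
- rewrite unitmxE det_mx3 unitfE /P !mx3E.
  rewrite (_ : _ + _ = - eps * (p 0 * (q 1 - q 2%:R) - p 1 * (q 0 - q 2%:R)
      + p 2%:R * (q 0 - q 1))); last by ring.
  by rewrite mulf_neq0 // oppr_eq0 sqr1_neq0.
- apply: mx3P; apply: ord3P; rewrite !mulmx3E /mult0 /P /diag !mx3E ?c00 ?c10 ?c20;
    rewrite ?[q _ * p _]mulrC ?c01 ?c11 ?c21 ?c00 ?c10 ?c20; ring: c00 c10 c20 c01 c11 c21.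
- apply: mx3P; apply: ord3P; rewrite !mulmx3E /mult1 /P /diag !mx3E;
    rewrite ?c01 ?c11 ?c21 ?c02 ?c12 ?c22; ring.
move=> z dz zu0 hz.
have z1 j : z u0 0 j = 1.
  by rewrite zu0 (_ : P 2%:R j = - eps) ?mulrNN //; move: j; apply: ord3P; rewrite /P mx3E.
have hzp b j : frame_deriv (ball u0 r) E z b j
    (fun u => (if b == 0 then p j else q j) * z u 0 j).
  move=> u ur; apply: has_dir_deriv_eq (hz b j u ur) _; rewrite /diag.
  by move: b j; apply: ord2P; apply: ord3P; rewrite /= !mx3E; ring.
by apply: (power_embedded (ball_open u0 r) (ballxx u0 r0) unitE dz (p := p) (q := q)).
Qed.

Lemma ring3 {T : Type} (a b c : T) (f := fun j : 'I_3 => nth a [:: a; b; c] j) :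
  (f 0 = a) * (f 1 = b) * (f 2%:R = c).
Proof. by []. Qed.

(** Three distinct real characters: [(ka, 0)], [(mu, s)] and [(mu, t)]. The exponents
    are the coefficients of the linear relation between them; the order of the
    coordinates and the sign of the relation are chosen to meet the sign conditions. *)
Lemma power_case s t : s + t = nu -> s * t = eps - mu * mu -> t < s ->
  mu * mu != eps -> exists2 Q, nonquadric_model Q & has_model Q.
Proof.
move=> st_sum st_prod ts muk.
have dst : 0 < s - t by rewrite subr_gt0.
have chs : is_character mu s.
  apply: character_mu; rewrite -st_sum mulrDl -[mu * mu]opprK.
  by have -> : - (mu * mu) = s * t - eps; [rewrite st_prod; ring|ring].
have cht : is_character mu t.
  apply: character_mu; rewrite -st_sum mulrDl -[mu * mu]opprK.
  by have -> : - (mu * mu) = s * t - eps; [rewrite st_prod; ring|ring].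
have chk := character_ka.
have kamun : ka != mu by apply/eqP => e; move: muk; rewrite -kamu e eqxx.
have st0 : s * t != 0 by rewrite st_prod subr_eq0 eq_sym.
have [s0 t0] : s != 0 /\ t != 0 by move: st0; rewrite mulf_eq0 negb_or => /andP.
have mu2 : 0 < mu * mu by rewrite -expr2 exprn_even_gt0.
have dn (a b c : R) : a - b != 0 -> c != 0 -> (a - b) * c != 0.
  by move=> *; rewrite mulf_neq0.
have nk : ka - mu != 0 by rewrite subr_eq0.
have nst : s - t != 0 by rewrite gt_eqF.
have kmm : ka * (mu * mu) = eps * mu by rewrite mulrA kamu.
have first (a0 : R) : a0 * ka = - mu * (s - t) ->
    has_model (model_power a0 (- t) s).
  move=> ra; pose p (j : 'I_3) := nth ka [:: ka; mu; mu] j.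
  pose q (j : 'I_3) := nth 0 [:: 0; s; t] j; pose a (j : 'I_3) := nth a0 [:: a0; - t; s] j.
  apply: (@power_model p q a); rewrite /p /q /a ?ring3 //=.
  - by apply: ord3P.
  - by rewrite (_ : _ + _ = (ka - mu) * (s - t)) ?mulf_neq0 //; ring.
  - by rewrite ra; ring.
  - by ring.
  - by rewrite mulr0 subr0 mulf_neq0.
have [e1|e1] := eps_cases.
  have [m1|m1|m1] := ltrgtP (mu * mu) 1; last by move: muk; rewrite e1 m1 eqxx.
    have stpos : 0 < s * t by rewrite st_prod e1 subr_gt0.
    have sumneg : mu * mu * (s - t) + t - s < 0.
      rewrite (_ : _ + _ - _ = (mu * mu - 1) * (s - t)); last by ring.
      by rewrite nmulr_rlt0 // subr_lt0.
    have rel : mu * mu * (s - t) * ka = mu * (s - t).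
      by rewrite mulrC mulrA kmm e1 mul1r.
    have [sp|sn|s00] := ltrgtP 0 s; last by move: s0; rewrite -s00 eqxx.
      have tp : 0 < t by rewrite -(pmulr_rgt0 t sp).
      exists (model_power (- s) (mu * mu * (s - t)) t).
        left; exists (- s), (mu * mu * (s - t)), t; split=> //; right.
        by split; [rewrite oppr_lt0|split; [rewrite mulr_gt0|split=> //; lra]].
      pose p (j : 'I_3) := nth mu [:: mu; ka; mu] j.
      pose q (j : 'I_3) := nth t [:: t; 0; s] j.
      pose a (j : 'I_3) := nth (- s) [:: - s; mu * mu * (s - t); t] j.
      apply: (@power_model p q a); rewrite /p /q /a ?ring3 //=.
      - by apply: ord3P.
      - by rewrite (_ : _ + _ = (ka - mu) * (s - t)) ?mulf_neq0 //; ring.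
      - by rewrite rel; ring.
      - by ring.
      - by rewrite mulr0 sub0r oppr_eq0 mulf_neq0.
    have tn : t < 0 by rewrite -(nmulr_rgt0 t sn).
    exists (model_power t (mu * mu * (s - t)) (- s)).
      left; exists t, (mu * mu * (s - t)), (- s); split=> //; right.
      by split=> //; split; [rewrite mulr_gt0|split; [rewrite oppr_gt0|lra]].
    pose p (j : 'I_3) := nth mu [:: mu; ka; mu] j.
    pose q (j : 'I_3) := nth s [:: s; 0; t] j.
    pose a (j : 'I_3) := nth t [:: t; mu * mu * (s - t); - s] j.
    apply: (@power_model p q a); rewrite /p /q /a ?ring3 //=.
    - by apply: ord3P.
    - by rewrite (_ : _ + _ = - ((ka - mu) * (s - t))) ?oppr_eq0 ?mulf_neq0 //; ring.
    - by rewrite rel; ring.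
    - by ring.
    - by rewrite oppr_eq0.
    - by rewrite mulr0 sub0r oppr_eq0 mulf_neq0.
  have stneg : s * t < 0 by rewrite st_prod e1 subr_lt0.
  have sp : 0 < s by rewrite ltNge; apply/negP => sle; nra.
  have tn : t < 0 by rewrite -(pmulr_rlt0 t sp).
  exists (model_power (- (mu * mu) * (s - t)) (- t) s).
    left; exists (- (mu * mu) * (s - t)), (- t), s; split=> //; right.
    split; first by rewrite mulNr oppr_lt0 mulr_gt0.
    split; first by rewrite oppr_gt0.
    split=> //; rewrite (_ : _ + _ = (1 - mu * mu) * (s - t)); last by ring.
    by rewrite nmulr_rlt0 // subr_lt0.
  by apply: first; rewrite mulrC !mulrA mulrN mulrA kamu e1 mul1r.
have stneg : s * t < 0 by rewrite st_prod e1; lra.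
have sp : 0 < s by rewrite ltNge; apply/negP => sle; nra.
have tn : t < 0 by rewrite -(pmulr_rlt0 t sp).
exists (model_power (mu * mu * (s - t)) (- t) s).
  left; exists (mu * mu * (s - t)), (- t), s; split=> //; left.
  by rewrite mulr_gt0 // oppr_gt0 sp tn.
by apply: first; rewrite mulrC !mulrA kamu e1 !mulN1r.
Qed.

(** A real character and a pair of complex conjugate ones. *)
Lemma arctan_case s t : 2 * s = nu -> 0 < t -> t * t = eps - mu * mu - s * s ->
  exists2 Q, nonquadric_model Q & has_model Q.
Proof.
move=> snu t0 tt.
have mu2 : 0 < mu * mu by rewrite -expr2 exprn_even_gt0.
have s2 : 0 <= s * s by rewrite -expr2 sqr_ge0.
have t2 : 0 < t * t by rewrite mulr_gt0.
have e1 : eps = 1 by case: eps_cases => // e; exfalso; move: tt; rewrite e; lra.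
have m1 : mu * mu < 1 by move: tt; rewrite e1; lra.
have km : ka * mu = 1 by rewrite kamu.
have tn : t != 0 by rewrite gt_eqF.
have nk : ka - mu != 0.
  by rewrite subr_eq0; apply/eqP => e; move: m1; rewrite -{1}e km ltxx.
have tt1 : t * t = 1 - mu * mu - s * s by rewrite tt e1.
exists (model_arctan (- (mu * mu)) 2^-1 (- s / t)).
  right; left; exists (- (mu * mu)), 2^-1, (- s / t); split=> //.
  by rewrite oppr_lt0 mulfV ?pnatr_eq0 // addrC subr_gt0.
pose P := mx3 ka 0 mu 0 t s (- 1) 0 (- 1).
pose N0 := mx3 ka 0 0 0 mu 0 0 0 mu.
pose N1 := mx3 0 0 0 0 s (- t) 0 t s.
apply: (@linear_model P N0 N1).
- rewrite unitmxE det_mx3 unitfE /P !mx3E.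
  by rewrite (_ : _ + _ = - ((ka - mu) * t)) ?oppr_eq0 ?mulf_neq0 //; ring.
- apply: mx3P; apply: ord3P; rewrite !mulmx3E /mult0 /P /N0 !mx3E ?laE ?e1; ring: km.
- apply: mx3P; apply: ord3P; rewrite !mulmx3E /mult1 /P /N1 !mx3E ?e1 -?snu;
    ring: km tt1.
move=> z dz zu0 hz.
pose p (b : 'I_2) := if b == 0 then ka else 0.
pose c (b : 'I_2) := if b == 0 then mu else s.
pose d (b : 'I_2) := if b == 0 then 0 else t.
apply: (arctan_embedded (ball_open u0 r) (ballxx u0 r0) unitE dz (p := p) (c := c) (d := d)).
- move=> b u ur; apply: has_dir_deriv_eq (hz b 0 u ur) _.
  by move: b; apply: ord2P; rewrite /= /N0 /N1 !mx3E /p /=; ring.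
- move=> b u ur; apply: has_dir_deriv_eq (hz b 1 u ur) _.
  by move: b; apply: ord2P; rewrite /= /N0 /N1 !mx3E /c /d /=; ring.
- move=> b u ur; apply: has_dir_deriv_eq (hz b 2%:R u ur) _.
  by move: b; apply: ord2P; rewrite /= /N0 /N1 !mx3E /c /d /=; ring.
- by rewrite zu0 /P mx3E ?e1 mulrNN mulr1.
- by rewrite zu0 /P mx3E mulr0.
- by rewrite zu0 /P mx3E ?e1 mulrNN mulr1.
- apply: ord2P; rewrite /p /c /d /=.
    by rewrite mulNr -[mu * mu * ka]mulrA [mu * ka]mulrC km; field.
  by field.
- by rewrite oppr_eq0 gt_eqF.
- by rewrite /c /d /= mul0r sub0r oppr_eq0 mulf_neq0.
Qed.

(** A double real character that differs from a simple one. *)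
Lemma log_case (p q : 'I_2 -> R) a2 : is_character (p 0) (p 1) ->
  is_character (q 0) (q 1) -> eps = 1 -> 0 < a2 -> a2 < 1 ->
  let w b := p b - a2 * q b in
  la * w 0 = p 0 * w 0 + w 0 * p 0 -> mu * w 1 = p 0 * w 1 + w 0 * p 1 ->
  mu * w 1 = p 1 * w 0 + w 1 * p 0 -> mu * w 0 + nu * w 1 = p 1 * w 1 + w 1 * p 1 ->
  p 0 * q 1 - q 0 * p 1 != 0 ->
  exists2 Q, nonquadric_model Q & has_model Q.
Proof.
move=> [p00 p01 p11] [q00 q01 q11] e1 a20 a21 w w00 w01 w10 w11 pq.
exists (model_log a2); first by right; right; left; exists a2.
pose P := mx3 (p 0) (q 0) (w 0) (p 1) (q 1) (w 1) (- 1) (- 1) 0.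
pose N b := mx3 (p b) 0 (w b) 0 (q b) 0 0 0 (p b).
apply: (@linear_model P (N 0) (N 1)).
- rewrite unitmxE det_mx3 unitfE /P !mx3E /w.
  rewrite (_ : _ + _ = (1 - a2) * (p 0 * q 1 - q 0 * p 1)); last by ring.
  by rewrite mulf_neq0 // subr_eq0 gt_eqF.
- apply: mx3P; apply: ord3P; rewrite !mulmx3E /mult0 /P /N !mx3E ?e1.
  all: rewrite ?p00 ?q00 ?w00 ?w01 ?e1 ?[p 1 * p 0]mulrC ?[q 1 * q 0]mulrC ?p01 ?q01; try ring.
- apply: mx3P; apply: ord3P; rewrite !mulmx3E /mult1 /P /N !mx3E ?e1.
  all: rewrite ?p01 ?q01 ?p11 ?q11 ?w10 ?w11 ?e1; try ring.
move=> z dz zu0 hz.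
apply: (log_embedded (ball_open u0 r) (ballxx u0 r0) unitE dz (p := p) (q := q)) => //.
- move=> b u ur; apply: has_dir_deriv_eq (hz b 0 u ur) _.
  by move: b; apply: ord2P; rewrite /= /N !mx3E; ring.
- move=> b u ur; apply: has_dir_deriv_eq (hz b 1 u ur) _.
  by move: b; apply: ord2P; rewrite /= /N !mx3E; ring.
- move=> b u ur; apply: has_dir_deriv_eq (hz b 2%:R u ur) _.
  by move: b; apply: ord2P; rewrite /= /N !mx3E /w; ring.
- by rewrite zu0 /P mx3E ?e1 mulrNN mulr1.
- by rewrite zu0 /P mx3E ?e1 mulrNN mulr1.
- by rewrite zu0 /P mx3E mulr0.
Qed.

(** A single character: the algebra is local, generated by a nilpotent element of
    order three. *)
Lemma parab_log_case : eps = 1 -> ka = mu -> nu = 0 ->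
  exists2 Q, nonquadric_model Q & has_model Q.
Proof.
move=> e1 km nu0; exists model_parab_log; first by right; right; right.
have mm : mu * mu = 1 by rewrite -{1}km kamu.
pose P := mx3 mu 0 mu 0 1 0 (- 1) 0 0.
pose N0 := mx3 mu 0 mu 0 mu 0 0 0 mu.
pose N1 : 'M[R]_3 := mx3 0 1 0 0 0 1 0 0 0.
apply: (@linear_model P N0 N1).
- by rewrite unitmxE det_mx3 unitfE /P !mx3E (_ : _ + _ = mu) //; ring.
- apply: mx3P; apply: ord3P; rewrite !mulmx3E /mult0 /P /N0 !mx3E ?laE ?km ?e1; ring: mm.
- apply: mx3P; apply: ord3P; rewrite !mulmx3E /mult1 /P /N1 !mx3E ?nu0 ?e1; ring: mm.
move=> z dz zu0 hz.
pose p (b : 'I_2) := if b == 0 then mu else 0.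
pose q (b : 'I_2) : R := if b == 0 then 0 else 1.
apply: (parab_log_embedded (ball_open u0 r) (ballxx u0 r0) unitE dz (p := p) (q := q)).
- move=> b u ur; apply: has_dir_deriv_eq (hz b 0 u ur) _.
  by move: b; apply: ord2P; rewrite /= /N0 /N1 !mx3E /p /=; ring.
- move=> b u ur; apply: has_dir_deriv_eq (hz b 1 u ur) _.
  by move: b; apply: ord2P; rewrite /= /N0 /N1 !mx3E /p /q /=; ring.
- move=> b u ur; apply: has_dir_deriv_eq (hz b 2%:R u ur) _.
  by move: b; apply: ord2P; rewrite /= /N0 /N1 !mx3E /p /q /=; ring.
- by rewrite zu0 /P mx3E ?e1 mulrNN mulr1.
- by rewrite zu0 /P mx3E mulr0.
- by rewrite zu0 /P mx3E mulr0.
- by rewrite /p /q /= mulr1 mul0r subr0.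
Qed.

(** The characters of the form [(mu, s)] are given by the roots of
    [s ^ 2 = mu ^ 2 + nu * s - eps], to which [(ka, 0)] is added; the latter is one of
    the former exactly if [mu ^ 2 = eps]. The case is decided by the discriminant. *)
Lemma nonquadric_cases : exists2 Q, nonquadric_model Q & has_model Q.
Proof.
have mu2 : 0 < mu * mu by rewrite -expr2 exprn_even_gt0.
have [me|mn] := eqVneq (mu * mu) eps.
  have e1 : eps = 1 by case: eps_cases => // e; exfalso; move: mu2; rewrite me e; lra.
  have km : ka = mu by apply: (mulIf mu0); rewrite kamu me.
  have mm : mu * mu = 1 by rewrite me.
  have [n0|nn] := eqVneq nu 0; first exact: parab_log_case.
  have n2 : 0 < nu * nu by rewrite -expr2 exprn_even_gt0.
  have n1 : 1 + nu * nu != 0 by rewrite gt_eqF // ltr_pwDl // ltW.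
  pose a2 := (1 + nu * nu)^-1.
  have a2n : a2 * (nu * nu) = 1 - a2 by rewrite /a2; field.
  pose p (b : 'I_2) := if b == 0 then mu else 0.
  pose q (b : 'I_2) := if b == 0 then mu else nu.
  have chp : is_character mu 0 by rewrite -{1}km; apply: character_ka.
  have chq : is_character mu nu by apply: character_mu; rewrite me; ring.
  apply: (@log_case p q a2) => //; rewrite /p /q /=.
  - by rewrite /a2 invr_gt0 ltr_pwDl // ltW.
  - rewrite /a2 invf_lt1; first by rewrite ltrDl.
    by rewrite ltr_pwDl // ltW.
  - by rewrite laE km; ring.
  - by ring.
  - by ring.
  - have -> : mu * (mu - a2 * mu) + nu * (0 - a2 * nu) = mu * mu * (1 - a2) - a2 * (nu * nu) by ring.
    by rewrite mm a2n; ring.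
  - by rewrite mulr0 subr0 mulf_neq0.
pose s := nu / 2; pose d := s * s + (mu * mu - eps).
have snu : 2 * s = nu by rewrite /s; field.
have [dneg|dpos|d0] := ltrgtP d 0.
- have sq : Num.sqrt (- d) * Num.sqrt (- d) = - d.
    by rewrite -expr2 sqr_sqrtr // oppr_ge0 ltW.
  apply: (@arctan_case s (Num.sqrt (- d))) => //.
    by rewrite sqrtr_gt0 oppr_gt0.
  by rewrite sq /d; ring.
- have sq : Num.sqrt d * Num.sqrt d = d by rewrite -expr2 sqr_sqrtr // ltW.
  apply: (@power_case (s + Num.sqrt d) (s - Num.sqrt d)) => //.
  + by rewrite -snu; ring.
  + have -> : (s + Num.sqrt d) * (s - Num.sqrt d) = s * s - Num.sqrt d * Num.sqrt d by ring.
    by rewrite sq /d; ring.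
  + have : 0 < Num.sqrt d by rewrite sqrtr_gt0.
    by move: (Num.sqrt d) => x x0; lra.
have ss : s * s = eps - mu * mu.
  by apply/eqP; rewrite -subr_eq0 -[X in _ == X]d0 /d; apply/eqP; ring.
have s0 : s != 0.
  by apply/eqP => s0; move: ss mn; rewrite s0 mul0r => /esym/eqP; rewrite subr_eq0 eq_sym => ->.
have s2 : 0 < s * s by rewrite -expr2 exprn_even_gt0.
have e1 : eps = 1 by case: eps_cases => // e; exfalso; move: ss; rewrite e; lra.
pose p (b : 'I_2) := if b == 0 then mu else s.
pose q (b : 'I_2) := if b == 0 then ka else 0.
have chp : is_character mu s.
  by apply: character_mu; rewrite -snu -mulrA ss; ring.
have kmm : mu * mu * ka = mu by rewrite -mulrA [mu * ka]mulrC kamu e1 mulr1.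
apply: (@log_case p q (mu * mu)) => //; rewrite /p /q /=.
- exact: character_ka.
- by move: ss; rewrite e1; lra.
- by rewrite kmm subrr !mulr0 mul0r addr0.
- by rewrite kmm; ring.
- by rewrite kmm; ring.
- by rewrite kmm -snu; ring.
- by rewrite mulr0 sub0r oppr_eq0 mulf_neq0.
Qed.

End NonquadricSurfaces.

(** * Surfaces with vanishing cubic form *)

Definition sphere_form {R : pzRingType} (eps : R) : 'M[R]_3 := mx3 eps 0 0 0 eps 0 0 0 1.

Definition standard_quadric {R : realType} (eps : R) : 'M[R]_(3 + 1) :=
  block_mx (sphere_form eps) 0 0 (- 1)%:M.

Lemma sphere_form_sym {R : pzRingType} (eps : R) : (sphere_form eps)^T = sphere_form eps.
Proof. by apply: mx3P; apply: ord3P; rewrite mxE /sphere_form !mx3E. Qed.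

Section QuadricModel.
Context {R : realType}.
Implicit Types (eps : R) (v : 'rV[R]_3).

Lemma sphere_formE eps v : (v *m sphere_form eps *m v^T) 0 0 =
  eps * v 0 0 ^+ 2 + eps * v 0 1 ^+ 2 + v 0 2%:R ^+ 2.
Proof. by rewrite mulmx3E !mulmx3E /sphere_form !mx3E !mxE; ring. Qed.

Lemma standard_quadricE eps v : quadric (standard_quadric eps) v <->
  (v *m sphere_form eps *m v^T) 0 0 = 1.
Proof.
rewrite /quadric /= /standard_quadric mul_row_block !mulmx0 addr0 add0r.
rewrite tr_row_mx mul_row_col mul1mx trmx1 mulmx1 mxE [(- 1)%:M 0 0]mxE eqxx mulr1n.
split=> [/eqP|->]; last by rewrite subrr.
by rewrite subr_eq0 => /eqP.
Qed.

Lemma standard_quadric_nondegenerate eps : eps * eps = 1 ->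
  nondegenerate_sym (standard_quadric eps).
Proof.
move=> e2; split.
  by rewrite /standard_quadric tr_block_mx !trmx0 tr_scalar_mx sphere_form_sym.
rewrite unitmxE det_ublock det_scalar1 det_mx3 /sphere_form !mx3E unitfE.
rewrite (_ : _ * _ = - (eps * eps)); last by ring.
by rewrite e2 oppr_eq0 oner_eq0.
Qed.

End QuadricModel.

Section QuadricSurfaces.
Context {R : realType}.
Local Notation plane := 'rV[R]_2.
Variables (eps : R) (D : set plane) (y : plane -> 'rV[R]_3).
Variables (T : plane -> 'M[R]_(2, 3)) (H : plane -> 'M[R]_2).
Variables (L C N : 'I_2 -> plane -> 'M[R]_2).
Hypothesis S : structure_eqs eps D y T H L C N.
Variables (u0 : plane) (r : R).
Hypothesis r0 : 0 < r.
Hypothesis rD : ball u0 r `<=` D.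
Hypothesis C0 : forall u, ball u0 r u -> forall m, C m u = 0.
Variable E : plane -> 'M[R]_2.
Hypothesis frameE : orthonormal_frame D H (ball u0 r) E.

Local Notation Phi := (moving_frame eps y T E).
Local Notation tau := (rotation_form H L E).
Let ob : open (ball u0 r). Proof. exact: ball_open. Qed.
Let dE : mx_diff_upto (ball u0 r) 0 E. Proof. by case: frameE. Qed.
Let dT : mx_diff_upto (ball u0 r) 0 T.
Proof. exact: mx_diff_upto_sub rD (mx_diff_uptoS (mx_diff_uptoS (diff_upto_T S))). Qed.
Let dy : mx_diff_upto (ball u0 r) 1 y.
Proof. exact: mx_diff_upto_sub rD (mx_diff_uptoS (mx_diff_uptoS (str_diff_y S))). Qed.

Lemma difference_vanishes u m : ball u0 r u -> N m u = 0.
Proof.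
move=> ur; have := str_N S (rD ur) m; rewrite (C0 ur) scaler0 => NH.
have uH' : H u \in unitmx.
  have := frame_dual frameE ur; rewrite -mulmxA => /mulmx1_unit[].
  by [].
by rewrite -[LHS](mulmxK uH') NH mul0mx.
Qed.

Let dPhi : mx_diff_upto (ball u0 r) 0 Phi.
Proof. apply: (moving_frame_diff_upto eps frameE dE dT); exact: mx_diff_uptoS dy. Qed.

(** The moving frame satisfies the equations of a frame that is orthonormal for the
    constant form [sphere_form eps]. *)
Lemma mxd_moving_frame m u : ball u0 r u ->
  let a := (E u *m H u) 0 m in let b := (E u *m H u) 1 m in
  mxd m Phi u = mx3 0 (tau m u) a (- tau m u) 0 b (- eps * a) (- eps * b) 0 *m Phi u.
Proof.
move=> ur a b; have Du := rD ur.
have EH i : (E u *m (row m (H u))^T) i 0 = (E u *m H u) i m.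
  rewrite !mulmx2E !mxE.
  by have /matrixP h := str_H_sym S Du; rewrite -(h 0 m) -(h 1 m) !mxE.
have dW : mxd m (fun w => E w *m T w) u =
    tau m u *: (quarter_turn *m (E u *m T u)) - eps *: (E u *m (row m (H u))^T *m y u).
  rewrite (mxdM m dE dT ur) (frame_connection S frameE m ur) (str_dT S Du) difference_vanishes //.
  rewrite addr0 mulmxBl mulmxBr -scalemxAl -scalemxAr !mulmxA addrA.
  by rewrite subrK.
have dy' : mxd m (fun w => - eps *: y w) u = - eps *: row m (T u).
  by rewrite (mxd_scale ob _ _ dy ur) (str_dy S Du).
have Ha i : (H u *m (E u)^T) m i = (E u *m H u) i m.
  by rewrite -{1}[H u](str_H_sym S Du) -trmx_mul mxE.
have rowT j : T u m j = a * (E u *m T u) 0 j + b * (E u *m T u) 1 j.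
  rewrite /a /b -!Ha -mulmx2E.
  by rewrite [RHS](congr1 (fun X : 'M[R]_(2, 3) => X m j) (mulmxA _ _ _)) (frame_dual frameE ur) mul1mx.
have Wj i j : mxd m (fun w => E w *m T w) u i j =
    tau m u * (quarter_turn i 0 * (E u *m T u) 0 j + quarter_turn i 1 * (E u *m T u) 1 j)
    - eps * ((E u *m H u) i m * y u 0 j).
  rewrite dW -EH; move: (E u *m T u) (E u *m (row m (H u))^T) => W X.
  by move: quarter_turn => J; rewrite !mxE sum_ord2 big_ord1.
have row_of (f g : plane -> R) : f =1 g -> pd m f u = pd m g u by move=> /funext ->.
apply: mx3P => j; rewrite mulmx3E !moving_frameE !mx3E.
- have -> : mxd m Phi u 0 j = mxd m (fun w => E w *m T w) u 0 j.
    by rewrite [LHS]mxE [RHS]mxE; apply: row_of => w; rewrite moving_frameE.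
  by rewrite Wj /quarter_turn !mx2E -/a; ring.
- have -> : mxd m Phi u 1 j = mxd m (fun w => E w *m T w) u 1 j.
    by rewrite [LHS]mxE [RHS]mxE; apply: row_of => w; rewrite moving_frameE.
  by rewrite Wj /quarter_turn !mx2E -/b; ring.
have -> : mxd m Phi u 2%:R j = mxd m (fun w => - eps *: y w) u 0 j.
  by rewrite [LHS]mxE [RHS]mxE; apply: row_of => w; rewrite moving_frameE [RHS]mxE.
by rewrite dy' [LHS]mxE [row _ _ _ _]mxE rowT; ring.
Qed.

(** The form that has the matrix [sphere_form eps] in the moving frame is the same at
    all points, since the connection matrix is skew for it. *)
Lemma quadric_form_constant u : ball u0 r u ->
  let K w := invmx (Phi w) *m sphere_form eps *m (invmx (Phi w))^T in K u = K u0.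
Proof.
move=> ur K; have uP w : ball u0 r w -> Phi w \in unitmx.
  exact: (moving_frame_unit S frameE).
have dI : mx_diff_upto (ball u0 r) 0 (fun w => invmx (Phi w)).
  by apply: mx_diff_upto_inv => //; exact: dPhi.
have dK : mx_diff_upto (ball u0 r) 0 K.
  apply: mx_diff_upto_mul => //; last exact: mx_diff_upto_tr.
  by apply: mx_diff_upto_mul => //; apply: mx_diff_upto_cst.
have PK w : ball u0 r w -> Phi w *m K w *m (Phi w)^T = sphere_form eps.
  move=> wr; rewrite /K !mulmxA mulmxV ?uP // mul1mx -mulmxA -trmx_mul mulmxV ?uP //.
  by rewrite trmx1 mulmx1.
apply: (mxd0_constant dK) ur => w wr m.
have := mxd_eq ob m PK wr; rewrite mxd_cst.
rewrite (mxdM m (mx_diff_upto_mul ob dPhi dK) (mx_diff_upto_tr ob dPhi) wr) (mxdM m dPhi dK wr).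
rewrite mxd_tr mxd_moving_frame //.
move: (tau m w) ((E w *m H w) 0 m) ((E w *m H w) 1 m) => t a b.
set O := mx3 _ _ _ _ _ _ _ _ _ => e.
have skew : O *m sphere_form eps + sphere_form eps *m O^T = 0.
  have OT i j : O^T i j = O j i by move: (O) => O'; rewrite mxE.
  have e2 := str_eps2 S.
  apply: mx3P; apply: ord3P;
    rewrite [LHS]mxE !mulmx3E !OT [RHS]mxE /O /sphere_form !mx3E; ring: e2.
move: e; rewrite mulmxDl trmx_mul !mulmxA.
have uPt : (Phi w)^T \in unitmx by rewrite unitmx_tr uP.
rewrite mulmxK ?uP // mulmxV ?uP // mul1mx trmx_inv !mulmxKV // addrAC skew add0r => e'.
rewrite -[LHS](mulKmx (uP w wr)) -[Phi w *m _](mulmxK uPt) e'.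
by rewrite mul0mx mulmx0.
Qed.

Lemma form_scale n p (s : R) (v : 'M[R]_(n, p)) (G : 'M[R]_p) : s * s = 1 ->
  (s *: v) *m G *m (s *: v)^T = v *m G *m v^T.
Proof.
by move=> s2; rewrite linearZ /= -!scalemxAl -scalemxAr scalerA s2 scale1r.
Qed.

(** The position vector is, up to sign, the third vector of the moving frame, on which
    the constant form has the value one. *)
Lemma quadric_embedded : exists2 A : 'M[R]_3, A \in unitmx &
  embedded_in (ball u0 r) (fun w => y w *m A) u0 (quadric (standard_quadric eps)).
Proof.
have u0r : ball u0 r u0 by apply: ballxx.
have uP w : ball u0 r w -> Phi w \in unitmx by exact: (moving_frame_unit S frameE).
have e2 := str_eps2 S.
have en : - eps != 0 by rewrite oppr_eq0 sqr1_neq0.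
pose A := - eps *: invmx (Phi u0).
have uA : A \in unitmx.
  by rewrite unitmxZ ?unitfE // unitmx_inv uP.
exists A => //.
have yE u : y u = - eps *: row 2%:R (Phi u).
  apply/rowP => j; rewrite [RHS]mxE [row _ _ _ _]mxE moving_frameE mulrA mulrNN e2.
  by rewrite mul1r.
have dz : mx_diff_upto (ball u0 r) 1 (fun w => y w *m A).
  by apply: mx_diff_upto_mul => //; exact: mx_diff_upto_cst.
have z0 : y u0 *m A = delta_mx 0 2%:R.
  rewrite yE /A -scalemxAl -scalemxAr scalerA mulrNN e2 scale1r rowE -mulmxA.
  by rewrite mulmxV ?uP // mulmx1.
apply: (graph_embedded (V0 := [set v : 'rV[R]_3 | 0 < v 0 2%:R]) (j1 := 0) (j2 := 1)) => //.
- move=> u ur; apply/standard_quadricE.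
  have -> : y u *m A *m sphere_form eps *m (y u *m A)^T =
     y u *m (invmx (Phi u0) *m sphere_form eps *m (invmx (Phi u0))^T) *m (y u)^T.
    by rewrite /A -scalemxAr form_scale ?mulrNN // trmx_mul !mulmxA.
  rewrite -(quadric_form_constant ur) yE form_scale ?mulrNN //.
  rewrite tr_row rowE.
  rewrite (_ : _ *m _ = row 2%:R (Phi u *m (invmx (Phi u) *m sphere_form eps *m (invmx (Phi u))^T) *m (Phi u)^T) *m (delta_mx 2%:R 0)).
    rewrite !mulmxA mulmxV ?uP // mul1mx -mulmxA -trmx_mul mulmxV ?uP // trmx1 mulmx1.
    by rewrite mulmx3E !mxE /=; ring.
  by rewrite !rowE colE !mulmxA.
- rewrite (_ : [set v | _] = (fun v : 'rV[R]_3 => v 0 2%:R) @^-1` [set x | 0 < x]) //.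
  by apply: open_comp; [move=> v _; apply: coord_continuous|apply: open_gt].
- by rewrite /= z0 mxE.
- move=> v w /standard_quadricE + /standard_quadricE + /= v2 w2 e0 e1.
  rewrite !sphere_formE e0 e1 => <- /addrI e.
  apply/rowP; apply: ord3P => //; apply/eqP.
  by rewrite -(eqrXn2 (n := 2)) // ?ltW // e.
- apply: (frame_jacobian_unit u0r (E := E) (z := fun w => y w *m A) _
     (g := fun a j u => (E u *m T u *m A) a j)).
  + move=> a j u ur; have df := diff_upto_differentiable (dz 0 j) ur.
    split=> //; rewrite dir_deriv_linear // ![row _ _ _ _]mxE.
    have d m : pd m (fun w => (y w *m A) 0 j) u = (T u *m A) m j.
      have -> : pd m (fun w => (y w *m A) 0 j) u = mxd m (fun w => y w *m A) u 0 j by rewrite mxE.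
      rewrite (mxdM m dy (mx_diff_upto_cst ob 1 A) ur) mxd_cst mulmx0 addr0 (str_dy S (rD ur)).
      by rewrite -row_mul mxE.
    by rewrite !d -mulmx2E mulmxA.
  have W a j : (E u0 *m T u0 *m A) a j = - eps * (a == j :> nat)%:R.
    have -> : (E u0 *m T u0 *m A) a j = (Phi u0 *m A) (widen_ord (leqnSn 2) a) j.
      rewrite !mulmx3E.
      by move: a; apply: ord2P; [rewrite (_ : widen_ord _ _ = 0)|rewrite (_ : widen_ord _ _ = 1)];
        rewrite ?moving_frameE //; apply/val_inj.
    by rewrite /A -scalemxAr mulmxV ?uP // !mxE.
  by rewrite !W /= !mulr1 !mulr0 subr0 mulf_neq0.
Qed.

End QuadricSurfaces.

Section SurfaceInQuadric.
Context {R : realType}.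
Local Notation plane := 'rV[R]_2.
Variables (eps : R) (D : set plane) (y : plane -> 'rV[R]_3).
Variables (T : plane -> 'M[R]_(2, 3)) (H : plane -> 'M[R]_2).
Variables (L C N : 'I_2 -> plane -> 'M[R]_2).
Hypothesis S : structure_eqs eps D y T H L C N.
Variable K : 'M[R]_3.
Hypothesis K_sym : K^T = K.
Hypothesis yK : forall u, D u -> (y u *m K *m (y u)^T) 0 0 = 1.

Let oD : open D. Proof. exact: str_open S. Qed.
Let dy : mx_diff_upto D 0 y.
Proof. exact: mx_diff_uptoS (mx_diff_uptoS (mx_diff_uptoS (str_diff_y S))). Qed.
Let dT : mx_diff_upto D 0 T.
Proof. exact: mx_diff_uptoS (mx_diff_uptoS (diff_upto_T S)). Qed.
Let dH : mx_diff_upto D 0 H.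
Proof. exact: mx_diff_uptoS (mx_diff_uptoS (str_diff_H S)). Qed.

Let mxd_form n p (X : plane -> 'M[R]_(n, 3)) (Z : plane -> 'M[R]_(p, 3)) m u :
  mx_diff_upto D 0 X -> mx_diff_upto D 0 Z -> D u ->
  mxd m (fun w => X w *m K *m (Z w)^T) u =
  mxd m X u *m K *m (Z u)^T + X u *m K *m (mxd m Z u)^T.
Proof.
move=> dX dZ Du; have dK := mx_diff_upto_cst oD 0 K.
rewrite (mxdM m (mx_diff_upto_mul oD dX dK) (mx_diff_upto_tr oD dZ) Du).
by rewrite (mxdM m dX dK Du) mxd_cst mulmx0 addr0 mxd_tr.
Qed.

Let yKy u : D u -> y u *m K *m (y u)^T = 1%:M.
Proof. by move=> Du; rewrite [LHS]mx11_scalar yK. Qed.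

Lemma tangent_orthogonal u : D u -> T u *m K *m (y u)^T = 0.
Proof.
move=> Du; apply/row_matrixP => m; rewrite !row_mul row0.
have := mxd_eq oD m yKy Du; rewrite mxd_cst mxd_form // (str_dy S Du).
have -> : y u *m K *m (row m (T u))^T = row m (T u) *m K *m (y u)^T.
  rewrite [LHS]mx11_scalar [RHS]mx11_scalar; congr (_%:M).
  have -> : y u *m K *m (row m (T u))^T = (row m (T u) *m K *m (y u)^T)^T.
    by rewrite !trmx_mul trmxK K_sym mulmxA.
  by rewrite mxE.
move: (row m (T u) *m K *m (y u)^T) => X e.
apply/matrixP => i j; have /matrixP/(_ i j) := e; rewrite !mxE; lra.
Qed.

Let gauss_form p (Z : 'M[R]_(p, 3)) m u :
  ((L m u + N m u) *m T u - eps *: ((row m (H u))^T *m y u)) *m K *m Z^T =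
  (L m u + N m u) *m (T u *m K *m Z^T) - eps *: ((row m (H u))^T *m (y u *m K *m Z^T)).
Proof. by rewrite !mulmxBl -!scalemxAl !mulmxA. Qed.

Lemma metric_restricted_form u : D u -> T u *m K *m (T u)^T = eps *: H u.
Proof.
move=> Du; apply/matrixP => i m.
have := mxd_eq oD m tangent_orthogonal Du; rewrite mxd_cst mxd_form // (str_dy S Du) (str_dT S Du).
rewrite gauss_form yKy // mulmx1 tangent_orthogonal // mulmx0 sub0r => /matrixP/(_ i 0).
have : (T u *m K *m (row m (T u))^T) i 0 = (T u *m K *m (T u)^T) i m.
  by rewrite !mulmx3E; move: (T u *m K) (T u) => X Z; rewrite !mxE.
move: (T u *m K *m (row m (T u))^T) (T u *m K *m (T u)^T) => X Z <-.
rewrite -{2}[H u](str_H_sym S Du) !mxE => e.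
by apply/eqP; rewrite -subr_eq0 addrC e.
Qed.

(** On a quadric [form K v v = 1] the metric is the restriction of [eps K], and the
    induced connection, being the tangential part of the flat one, preserves it. *)
Lemma cubic_vanishes_in_quadric u m : D u -> C m u = 0.
Proof.
have eps0 := sqr1_neq0 (str_eps2 S).
move=> Du; have := mxd_eq oD m metric_restricted_form Du.
rewrite mxd_form // (mxd_scale oD _ _ dH Du) (str_dT S Du) gauss_form.
have yT : y u *m K *m (T u)^T = 0.
  by have := congr1 trmx (tangent_orthogonal Du); rewrite !trmx_mul trmxK K_sym mulmxA trmx0.
have -> : T u *m K *m ((L m u + N m u) *m T u - eps *: ((row m (H u))^T *m y u))^T =
   (((L m u + N m u) *m T u - eps *: ((row m (H u))^T *m y u)) *m K *m (T u)^T)^T.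
  by rewrite [RHS]trmx_mul trmxK trmx_mul K_sym mulmxA.
rewrite gauss_form yT mulmx0 scaler0 subr0 metric_restricted_form // (str_dH S Du).
rewrite -scalemxAr [(eps *: _)^T]linearZ /= trmx_mul (str_H_sym S Du).
rewrite -scalerDr => /(scalerI eps0).
rewrite mulmxDl linearD mulmxDr addrACA => /eqP; rewrite eq_sym addrC -subr_eq subrr eq_sym => /eqP.
have -> : H u *m (N m u)^T = (N m u *m H u)^T by rewrite trmx_mul (str_H_sym S Du).
rewrite (str_N S Du) linearZ /=.
have -> : (C m u)^T = C m u.
  by apply/matrixP => j k; rewrite mxE; have [_ ->] := str_C_sym S Du m j k.
rewrite -scalerDl -opprD (_ : 2^-1 + 2^-1 = 1); last by field.
by rewrite scaleN1r => /eqP; rewrite oppr_eq0 => /eqP.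
Qed.

End SurfaceInQuadric.

(** * Homogeneity of the models *)

Section Homogeneity.
Context {R : realType}.
Implicit Types (z w v : 'rV[R]_3) (Q : set 'rV[R]_3).

(** The map has to preserve [Q] only near [z]: the multiplication by a complex number
    changes the argument by the same amount everywhere, but its arctangent form jumps. *)
Definition homogeneous Q : Prop := forall z w, Q z -> Q w ->
  exists (G : 'M[R]_3) (N : set 'rV[R]_3),
    [/\ G \in unitmx, open N, N z, z *m G = w & forall v, N v -> (Q v <-> Q (v *m G))].

Lemma mul_mx3 v (G : 'M[R]_3) j :
  (v *m G) 0 j = v 0 0 * G 0 j + v 0 1 * G 1 j + v 0 2%:R * G 2%:R j.
Proof. exact: mulmx3E. Qed.

Lemma rV3P v w : v 0 0 = w 0 0 -> v 0 1 = w 0 1 -> v 0 2%:R = w 0 2%:R -> v = w.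
Proof. by move=> *; apply/rowP; apply: ord3P. Qed.

(** Comparison of the values at [z] and [z *m G] shows that the factor is one. *)
Lemma relative_invariant (f : 'rV[R]_3 -> R) (N : set 'rV[R]_3) (k : R) (G : 'M[R]_3) z :
  (forall v, N v -> f (v *m G) = k * f v) -> N z -> f z = 1 -> f (z *m G) = 1 ->
  forall v, N v -> f (v *m G) = f v.
Proof. by move=> fk Nz fz fw v Nv; move: fw; rewrite !fk // fz mulr1 => ->; rewrite mul1r. Qed.

Lemma homogeneous_power a1 a2 a3 : homogeneous (model_power a1 a2 a3 : set 'rV[R]_3).
Proof.
move=> z w [z1 z2 z3 fz] [w1 w2 w3 fw].
pose l1 := coord1 w / coord1 z; pose l2 := coord2 w / coord2 z.
pose l3 := coord3 w / coord3 z.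
have [l10 l20 l30] : [/\ 0 < l1, 0 < l2 & 0 < l3] by rewrite !divr_gt0.
pose G : 'M[R]_3 := mx3 l1 0 0 0 l2 0 0 0 l3.
have G1 v : coord1 (v *m G) = l1 * coord1 v.
  by rewrite /coord1 mul_mx3 /G !mx3E !mulr0 !addr0 mulrC.
have G2 v : coord2 (v *m G) = l2 * coord2 v.
  by rewrite /coord2 mul_mx3 /G !mx3E !mulr0 addr0 add0r mulrC.
have G3 v : coord3 (v *m G) = l3 * coord3 v.
  by rewrite /coord3 mul_mx3 /G !mx3E !mulr0 !add0r mulrC.
have zG : z *m G = w.
  have dK (a b : R) : 0 < b -> a / b * b = a by move=> b0; rewrite divfK // gt_eqF.
  by apply: rV3P; [have := G1 z|have := G2 z|have := G3 z]; rewrite dK.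
pose P := [set v : 'rV[R]_3 | [/\ 0 < coord1 v, 0 < coord2 v & 0 < coord3 v]].
pose f (v : 'rV[R]_3) := coord1 v `^ a1 * coord2 v `^ a2 * coord3 v `^ a3.
have fG := @relative_invariant f P (l1 `^ a1 * l2 `^ a2 * l3 `^ a3) G z.
exists G, setT; split => //.
- rewrite unitmxE det_mx3 /G !mx3E unitfE [X in X != 0](_ : _ = l1 * l2 * l3); last by ring.
  exact: lt0r_neq0 (mulr_gt0 (mulr_gt0 l10 l20) l30).
- exact: openT.
have PG v : P v <-> P (v *m G) by rewrite /P /= G1 G2 G3 (pmulr_rgt0 _ l10) (pmulr_rgt0 _ l20) (pmulr_rgt0 _ l30).
move=> v _; suff h : P v -> f (v *m G) = f v.
  split=> [[v1 v2 v3 e]|[v1 v2 v3 e]].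
    have Pv : P v by split.
    by have [? ? ?] := (PG v).1 Pv; split => //; rewrite -e; exact: h.
  have Pv : P (v *m G) by split.
  by have [? ? ?] := (PG v).2 Pv; split => //; rewrite -e; apply/esym/h/PG.
apply: fG => //; last by rewrite zG.
move=> u [u1 u2 u3]; rewrite /f G1 G2 G3 (powRM _ (ltW l10) (ltW u1)) (powRM _ (ltW l20) (ltW u2)).
rewrite (powRM _ (ltW l30) (ltW u3)).
move: (l1 `^ a1) (l2 `^ a2) (l3 `^ a3) => ? ? ?.
by move: (_ `^ a1) (_ `^ a2) (_ `^ a3) => ? ? ?; ring.
Qed.

Lemma homogeneous_log a2 : homogeneous (model_log a2 : set 'rV[R]_3).
Proof.
move=> z w [z1 z2 fz] [w1 w2 fw].
pose l := coord1 w / coord1 z; pose m := coord2 w / coord2 z.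
have [l0 m0] : 0 < l /\ 0 < m by rewrite !divr_gt0.
pose k := ln l - a2 * ln m.
pose G : 'M[R]_3 := mx3 l 0 (l * k) 0 m 0 0 0 l.
have G1 v : coord1 (v *m G) = l * coord1 v.
  by rewrite /coord1 mul_mx3 /G !mx3E !mulr0 !addr0 mulrC.
have G2 v : coord2 (v *m G) = m * coord2 v.
  by rewrite /coord2 mul_mx3 /G !mx3E !mulr0 addr0 add0r mulrC.
have G3 v : coord3 (v *m G) = l * (coord3 v + k * coord1 v).
  by rewrite /coord3 mul_mx3 /coord1 /G !mx3E; ring.
have QG v : model_log a2 v <-> model_log a2 (v *m G).
  rewrite /model_log /= G1 G2 G3 (pmulr_rgt0 _ l0) (pmulr_rgt0 _ m0).
  have e : 0 < coord1 v -> 0 < coord2 v ->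
      l * coord1 v * (ln (l * coord1 v) - a2 * ln (m * coord2 v)) =
      l * (coord1 v * (ln (coord1 v) - a2 * ln (coord2 v)) + k * coord1 v).
    by move=> v1 v2; rewrite (@lnM _ l) // (@lnM _ m) // /k; ring.
  split=> -[v1 v2 h]; split => //; first by rewrite e // h.
  by move: h; rewrite e // => /mulfI; rewrite gt_eqF // => /(_ isT)/addIr.
have zG : z *m G = w.
  have dK (a b : R) : 0 < b -> a / b * b = a by move=> b0; rewrite divfK // gt_eqF.
  have e1 : coord1 (z *m G) = coord1 w by rewrite G1 dK.
  have e2 : coord2 (z *m G) = coord2 w by rewrite G2 dK.
  apply: rV3P => //; have [_ _] := (QG z).1 (And3 z1 z2 fz).
  by rewrite e1 e2 -fw.
exists G, setT; split => //; last exact: openT.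
rewrite unitmxE det_mx3 /G !mx3E unitfE [X in X != 0](_ : _ = l * m * l); last by ring.
exact: lt0r_neq0 (mulr_gt0 (mulr_gt0 l0 m0) l0).
Qed.

Lemma homogeneous_parab_log : homogeneous (model_parab_log : set 'rV[R]_3).
Proof.
move=> z w [z1 fz] [w1 fw].
pose l := coord1 w / coord1 z; have l0 : 0 < l by rewrite divr_gt0.
pose c := coord2 w / coord1 w - coord2 z / coord1 z.
pose G : 'M[R]_3 := mx3 l (l * c) (l * (c ^+ 2 / 2 + ln l)) 0 l (l * c) 0 0 l.
have G1 v : coord1 (v *m G) = l * coord1 v.
  by rewrite /coord1 mul_mx3 /G !mx3E !mulr0 !addr0 mulrC.
have G2 v : coord2 (v *m G) = l * (coord2 v + c * coord1 v).
  by rewrite /coord2 mul_mx3 /coord1 /G !mx3E; ring.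
have G3 v : coord3 (v *m G) =
    l * (coord3 v + (c * coord2 v + (c ^+ 2 / 2 + ln l) * coord1 v)).
  by rewrite /coord3 mul_mx3 /coord1 /coord2 /G !mx3E; ring.
have QG v : model_parab_log v <-> model_parab_log (v *m G).
  rewrite /model_parab_log /= G1 G2 G3 (pmulr_rgt0 _ l0).
  have e : 0 < coord1 v ->
      (2 * (l * coord1 v))^-1 * (l * (coord2 v + c * coord1 v)) ^+ 2 +
        l * coord1 v * ln (l * coord1 v) =
      l * ((2 * coord1 v)^-1 * coord2 v ^+ 2 + coord1 v * ln (coord1 v) +
        (c * coord2 v + (c ^+ 2 / 2 + ln l) * coord1 v)).
    move=> v1; rewrite (@lnM _ l) //; have := lt0r_neq0 v1; have := lt0r_neq0 l0.
    by move: (ln l) (ln _) (coord1 v) (coord2 v) => ? ? ? ? ? ?; field; apply/andP.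
  split=> -[v1 h]; split => //; first by rewrite e // h.
  by move: h; rewrite e // => /mulfI; rewrite gt_eqF // => /(_ isT)/addIr.
have zG : z *m G = w.
  have e1 : coord1 (z *m G) = coord1 w by rewrite G1 /l divfK // gt_eqF.
  have e2 : coord2 (z *m G) = coord2 w.
    rewrite G2 /l /c; have := lt0r_neq0 z1; have := lt0r_neq0 w1.
    by move: (coord1 z) (coord1 w) => ? ? ? ?; field; apply/andP.
  apply: rV3P => //; have [_] := (QG z).1 (conj z1 fz).
  by rewrite e1 e2 -fw.
exists G, setT; split => //; last exact: openT.
rewrite unitmxE det_mx3 /G !mx3E unitfE [X in X != 0](_ : _ = l * l * l); last by ring.
exact: lt0r_neq0 (mulr_gt0 (mulr_gt0 l0 l0) l0).
Qed.

Lemma atan_sub (a b : R) : 0 < 1 + a * b -> atan a - atan b = atan ((a - b) / (1 + a * b)).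
Proof.
move=> ab0; have cos0 x : cos (atan x) != 0 :> R.
  by rewrite gt_eqF // cos_gt0_pihalf // atan_gtNpi2 atan_ltpi2.
have cosB0 (x y : R) : 0 < 1 + x * y -> 0 < cos (atan x - atan y).
  move=> xy; rewrite cosB.
  have sE (t : R) : sin (atan t) = t * cos (atan t) by rewrite -[X in X * _]atanK /tan divfK ?cos0.
  rewrite !sE (_ : _ + _ = cos (atan x) * cos (atan y) * (1 + x * y)); last by ring.
  by rewrite !mulr_gt0 // cos_gt0_pihalf // atan_gtNpi2 atan_ltpi2.
(* The difference lies in the interval of length 2 pi where positivity of the cosine
   means being less than pi / 2 in absolute value. *)
have lt_pihalf (x y : R) : 0 < 1 + x * y -> atan x - atan y < pi / 2.
  move=> xy; rewrite ltNge; apply/negP => ge.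
  have p0 := pi_gt0 R.
  have lepi : atan x - atan y <= pi.
    by have := atan_ltpi2 x; have := atan_gtNpi2 y; lra.
  have : cos (atan x - atan y) <= 0.
    have i1 : atan x - atan y \in `[0, pi] by rewrite in_itv /=; apply/andP; split; lra.
    have i2 : pi / 2 \in `[0 : R, pi] by rewrite in_itv /=; apply/andP; split; lra.
    by rewrite -(@cos_pihalf R) leNgt ltr_cos // -leNgt.
  by rewrite leNgt cosB0.
have dab : -(pi / 2) < atan a - atan b < pi / 2.
  by rewrite lt_pihalf // andbT ltrNl opprB lt_pihalf // mulrC.
rewrite -[LHS]tanK ?in_itv //; congr atan.
by rewrite tanD ?cosN // tanN !atanK mulrN opprK.
Qed.

Lemma open_halfspace (B : 'cV[R]_3) : open [set v : 'rV[R]_3 | 0 < (v *m B) 0 0].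
Proof.
rewrite (_ : [set v | _] = (fun v : 'rV[R]_3 => (v *m B) 0 0) @^-1` [set x | 0 < x]) //.
apply: open_comp; last exact: open_gt.
move=> v _.
apply: (@continuous_comp _ _ _ (fun v : 'rV[R]_3 => v *m B) (fun c : 'M[R]_1 => c 0 0)).
  exact: mulmxr_continuous.
exact: coord_continuous.
Qed.

Lemma atan_sub_quotient (a b c d : R) : b != 0 -> d != 0 -> 0 < b * d -> 0 < b * d + a * c ->
  atan (a / b) - atan (c / d) = atan ((a * d - b * c) / (b * d + a * c)).
Proof.
move=> b0 d0 bd s0.
have e : 1 + a / b * (c / d) = (b * d + a * c) / (b * d) by field; apply/andP.
rewrite atan_sub e ?divr_gt0 //; congr atan.
by field; rewrite b0 d0 gt_eqF.
Qed.

(** The required map multiplies the complex number [coord3 + i coord2] by the quotient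
    of its values at the two points; near the first of them, the argument grows by the
    same amount everywhere. *)
Lemma homogeneous_arctan a1 a2 a3 : homogeneous (model_arctan a1 a2 a3 : set 'rV[R]_3).
Proof.
move=> z w [z1 z3 fz] [w1 w3 fw].
pose l := coord1 w / coord1 z; have l0 : 0 < l by rewrite divr_gt0.
pose n := coord2 z ^+ 2 + coord3 z ^+ 2.
have n0 : 0 < n by rewrite ltr_wpDl ?sqr_ge0 // lt_neqAle eq_sym sqrf_eq0 z3 sqr_ge0.
(* The quotient is [p + i q]. *)
pose p := (coord3 z * coord3 w + coord2 z * coord2 w) / n.
pose q := (coord2 w * coord3 z - coord3 w * coord2 z) / n.
pose s := p ^+ 2 + q ^+ 2.
have n0' : n != 0 by rewrite gt_eqF.
have sE : s = (coord2 w ^+ 2 + coord3 w ^+ 2) / n by rewrite /s /p /q /n in n0' *; field.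
have s0 : 0 < s.
  by rewrite sE divr_gt0 // ltr_wpDl ?sqr_ge0 // lt_neqAle eq_sym sqrf_eq0 w3 sqr_ge0.
pose G : 'M[R]_3 := mx3 l 0 0 0 p (- q) 0 q p.
have G1 v : coord1 (v *m G) = l * coord1 v.
  by rewrite /coord1 mul_mx3 /G !mx3E !mulr0 !addr0 mulrC.
have G2 v : coord2 (v *m G) = p * coord2 v + q * coord3 v.
  by rewrite /coord2 mul_mx3 /coord3 /G !mx3E; ring.
have G3 v : coord3 (v *m G) = p * coord3 v - q * coord2 v.
  by rewrite /coord3 mul_mx3 /coord2 /G !mx3E; ring.
have zG : z *m G = w.
  apply: rV3P; first by have := G1 z; rewrite /l divfK // gt_eqF.
    rewrite -[LHS]/(coord2 (z *m G)) -[RHS]/(coord2 w) G2 /p /q.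
    by rewrite /n in n0' *; field.
  rewrite -[LHS]/(coord3 (z *m G)) -[RHS]/(coord3 w) G3 /p /q.
  by rewrite /n in n0' *; field.
(* The points at which the arctangent is the argument, up to one constant, both of the
   point and of its image, and at which the difference of two such arguments is less
   than a right angle. *)
pose N := [set v | 0 < coord3 v * coord3 z] `&` [set v | 0 < coord3 (v *m G) * coord3 w]
  `&` [set v | 0 < coord3 v * coord3 z + coord2 v * coord2 z].
have oN : open N.
  have half (g : 'rV[R]_3 -> R) (B : 'cV[R]_3) : (forall v, g v = (v *m B) 0 0) ->
      open [set v | 0 < g v].
    by move=> /funext ->; exact: open_halfspace.
  pose col3 (a b c : R) : 'cV[R]_3 := \col_i (if i == 0 then a else if i == 1 then b else c).
  apply: openI; [apply: openI|].
  - apply: (half _ (col3 0 0 (coord3 z))) => v.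
    by rewrite mulmx3E !mxE /=; rewrite !mulr0 !add0r.
  - apply: (half _ (col3 0 (- q * coord3 w) (p * coord3 w))) => v.
    by rewrite G3 mulmx3E !mxE /= /coord2 /coord3; ring.
  apply: (half _ (col3 0 (coord2 z) (coord3 z))) => v.
  by rewrite mulmx3E !mxE /= /coord2 /coord3; ring.
pose t := atan (coord2 w / coord3 w) - atan (coord2 z / coord3 z).
have atanG v : N v ->
    atan (coord2 (v *m G) / coord3 (v *m G)) = atan (coord2 v / coord3 v) + t.
  case=> -[/= h1 h2 h3].
  have nz (a b : R) : 0 < a * b -> a != 0 by case: eqP => // ->; rewrite mul0r ltxx.
  have e2 : coord2 w = p * coord2 z + q * coord3 z by rewrite -{1}zG G2.
  have e3 : coord3 w = p * coord3 z - q * coord2 z by rewrite -{1}zG G3.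
  have den : coord3 (v *m G) * coord3 w + coord2 (v *m G) * coord2 w =
      s * (coord3 v * coord3 z + coord2 v * coord2 z) by rewrite G2 G3 e2 e3 /s; ring.
  have num : coord2 (v *m G) * coord3 w - coord3 (v *m G) * coord2 w =
      s * (coord2 v * coord3 z - coord3 v * coord2 z) by rewrite G2 G3 e2 e3 /s; ring.
  suff h : atan (coord2 (v *m G) / coord3 (v *m G)) - atan (coord2 w / coord3 w) =
      atan (coord2 v / coord3 v) - atan (coord2 z / coord3 z).
    by rewrite /t addrCA -h addrC subrK.
  rewrite !atan_sub_quotient //; try exact: (nz _ _ h1); try exact: (nz _ _ h2).
    by rewrite num den -mulf_div divff ?mul1r // gt_eqF.
  by rewrite den mulr_gt0.
have Nz : N z.
  split; first split => /=; rewrite ?zG -?expr2.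
  + by rewrite lt_neqAle eq_sym sqrf_eq0 z3 sqr_ge0.
  + by rewrite lt_neqAle eq_sym sqrf_eq0 w3 sqr_ge0.
  + by rewrite /= -!expr2 addrC.
exists G, N; split => //.
  rewrite unitmxE det_mx3 /G !mx3E unitfE [X in X != 0](_ : _ = l * s); last by rewrite /s; ring.
  exact: lt0r_neq0 (mulr_gt0 l0 s0).
pose f (v : 'rV[R]_3) := coord1 v `^ a1 * (coord2 v ^+ 2 + coord3 v ^+ 2) `^ a2
  * expR (a3 * atan (coord2 v / coord3 v)).
have fG := @relative_invariant f [set v | N v /\ 0 < coord1 v]
  (l `^ a1 * s `^ a2 * expR (a3 * t)) G z.
have fN v : N v -> 0 < coord1 v -> f (v *m G) = f v.
  move=> Nv v1; apply: fG => //=; last by rewrite zG.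
    move=> u [Nu u1]; rewrite /f atanG // G1 mulrDr expRD.
    have -> : coord2 (u *m G) ^+ 2 + coord3 (u *m G) ^+ 2 = s * (coord2 u ^+ 2 + coord3 u ^+ 2).
      by rewrite G2 G3 /s; ring.
    rewrite (powRM _ (ltW l0) (ltW u1)) (powRM _ (ltW s0) (addr_ge0 (sqr_ge0 _) (sqr_ge0 _))).
    move: (expR _) (expR _) (l `^ a1) (s `^ a2) => ? ? ? ?.
    by move: (_ `^ a1) (_ `^ a2) => ? ?; ring.
move=> v Nv; have [[/= h1 h2] h3] := Nv.
have nz (a b : R) : 0 < a * b -> a != 0 by case: eqP => // ->; rewrite mul0r ltxx.
split=> [[v1 v3 e]|[vG1 _ e]].
  by split; [rewrite G1 mulr_gt0|exact: nz h2|rewrite -e; exact: fN].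
move: vG1; rewrite G1 (pmulr_rgt0 _ l0) => v1.
by split => //; [exact: nz h1|exact: etrans (esym (fN v Nv v1)) e].
Qed.

Lemma homogeneous_nonquadric (Q : set 'rV[R]_3) : nonquadric_model Q -> homogeneous Q.
Proof.
case=> [[a1 [a2 [a3 [_ ->]]]]|[[a1 [a2 [a3 [_ ->]]]]|[[a2 [_ ->]]|->]]].
- exact: homogeneous_power.
- exact: homogeneous_arctan.
- exact: homogeneous_log.
exact: homogeneous_parab_log.
Qed.

Local Notation form S v w := ((v *m S *m w^T) 0 0).

Lemma form_sym (S : 'M[R]_3) v w : S^T = S -> form S v w = form S w v.
Proof.
move=> S_sym; have -> : w *m S *m v^T = (v *m S *m w^T)^T.
  by rewrite !trmx_mul trmxK S_sym mulmxA.
by rewrite [RHS]mxE.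
Qed.

Lemma formDl (S : 'M[R]_3) u v w k : form S (u + k *: v) w = form S u w + k * form S v w.
Proof.
rewrite !mulmxDl -!scalemxAl.
by move: (u *m S *m _) (v *m S *m _) => X Y; rewrite !mxE.
Qed.

Lemma form_line (S : 'M[R]_3) v n k : S^T = S ->
  form S (v + k *: n) (v + k *: n) = form S v v + 2 * k * form S v n + k ^+ 2 * form S n n.
Proof.
move=> S_sym; rewrite formDl (form_sym v _ S_sym) (form_sym n _ S_sym) !formDl.
by rewrite (form_sym n v S_sym); ring.
Qed.

Lemma reflection (S : 'M[R]_3) n : S^T = S -> form S n n != 0 ->
  exists2 G : 'M[R]_3, G \in unitmx &
    (forall v, v *m G = v + (- 2 * form S v n / form S n n) *: n) /\
    (forall v, form S (v *m G) (v *m G) = form S v v).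
Proof.
move=> S_sym n0; set c := form S n n in n0 *.
pose G : 'M[R]_3 := 1%:M - (2 / c) *: (S *m n^T *m n).
have vG v : v *m G = v + (- 2 * form S v n / c) *: n.
  rewrite mulmxBr mulmx1 -scalemxAr !mulmxA {1}[v *m S *m n^T]mx11_scalar mul_scalar_mx.
  rewrite scalerA -scaleNr; congr (_ + _ *: _).
  by move: (form S v n) => t; ring.
exists G; last first.
  split=> // v; rewrite vG form_line // -/c.
  by move: (form S v v) (form S v n) => s t; field.
have GG v : v *m G *m G = v.
  rewrite (vG (_ *m _)) vG formDl -/c -addrA -scalerDl.
  rewrite [X in X *: _](_ : _ = 0) ?scale0r ?addr0 //.
  by move: (form S v n) => t; field.
have /mulmx1_unit[] // : G *m G = 1%:M.
by apply/row_matrixP => i; rewrite row_mul {1}rowE -mulmxA mulmxA GG rowE mulmx1.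
Qed.

(** Of two points with [form S v v = 1], one is mapped to the other by the reflection
    in their difference or, if this difference is isotropic, by the opposite of the
    reflection in their sum. *)
Lemma unit_sphere_homogeneous (S : 'M[R]_3) : S^T = S -> homogeneous [set v | form S v v = 1].
Proof.
move=> S_sym z w /= z1 w1.
have [d0|d0] := eqVneq (form S (z + (- 1) *: w) (z + (- 1) *: w)) 0.
  have zw : form S z w = 1.
    by move: d0; rewrite form_line // z1 w1; move: (form S z w) => t h; lra.
  have n4 : form S (z + 1 *: w) (z + 1 *: w) = 4.
    by rewrite form_line // z1 w1 zw; ring.
  have n0 : form S (z + 1 *: w) (z + 1 *: w) != 0 by rewrite n4 pnatr_eq0.
  have [G uG [vG fG]] := reflection S_sym n0.
  exists (- 1 *: G), setT; split => //; first by rewrite unitmxZ ?unitrN1.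
  - exact: openT.
  - rewrite -scalemxAr vG n4 (form_sym z _ S_sym) formDl z1 (form_sym w _ S_sym) zw.
    rewrite (_ : _ / _ = - 1); last by field.
    by rewrite scale1r !scaleN1r opprD opprK addrA addNr add0r.
  move=> v _; rewrite /= -scalemxAr; have := form_line 0 (v *m G) (- 1) S_sym.
  have -> : form S (0 : 'rV[R]_3) (v *m G) = 0 by rewrite !mul0mx mxE.
  rewrite add0r !mul0mx => ->; rewrite fG [X in X + _ + _]mxE.
  by rewrite mulr0 !add0r sqrrN expr1n mul1r.
have [G uG [vG fG]] := reflection S_sym d0.
exists G, setT; split => //; first exact: openT.
- rewrite vG (form_sym z _ S_sym) formDl form_line // z1 w1 (form_sym w _ S_sym).
  move: d0; rewrite form_line // z1 w1; move: (form S z w) => t h.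
  rewrite (_ : _ / _ = - 1).
    by rewrite !scaleN1r opprD opprK addrA addrN add0r.
  by field; apply: contra_neq h => e; rewrite -e; ring.
by move=> v _; rewrite /= fG.
Qed.

Lemma homogeneous_quadric eps : homogeneous (quadric (standard_quadric eps)).
Proof.
have -> : quadric (standard_quadric eps) = [set v | form (sphere_form eps) v v = 1].
  by apply/seteqP; split=> v /standard_quadricE.
exact: unit_sphere_homogeneous (sphere_form_sym eps).
Qed.

End Homogeneity.

(** * From charts to the surface *)

Section LocalToGlobal.
Context {R : realType}.

Lemma open_inter_preimage (X Z : topologicalType) (D : set X) (f : X -> Z) (O : set Z) :
  open D -> (forall q, D q -> {for q, continuous f}) -> open O -> open (D `&` f @^-1` O).
Proof.
move=> oD cf oO; rewrite openE => q [Dq Oq]; apply: filterI.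
  exact: open_nbhs_nbhs.
exact: cf Dq _ (open_nbhs_nbhs (conj oO Oq)).
Qed.

Variable M : smooth_surface R.
Variable x : M -> 'rV[R]_3.

(** On [U], the map [x] followed by [A] is a homeomorphism onto a relatively open
    part of [Q]. *)
Definition maps_onto_part (A : 'M[R]_3) (U : set M) Q : Prop :=
  [/\ A \in unitmx, open U, (forall p q, U p -> U q -> x p = x q -> p = q) &
    forall O, open O -> O `<=` U -> exists2 V, open V & (fun q => x q *m A) @` O = Q `&` V].

Definition modelled (p : M) Q : Prop := exists A U, U p /\ maps_onto_part A U Q.

Lemma modelled_equivalent (W : set M) Q : (forall p, W p -> modelled p Q) ->
  locally_equivalent_on W x Q.
Proof.
move=> h p /h[A [U [Up [uA oU inj parts]]]].
have [V oV e] := parts U oU (@subset_refl _ U).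
exists A, U, V; split=> //; split=> //.
by move=> a b /set_mem aU /set_mem bU; exact: inj.
Qed.

Lemma modelled_in_chart c p A Q : atlas c -> chart_dom c p -> A \in unitmx ->
  embedded_in (chart_img c) (fun w => (x \o chart_inv c) w *m A) (chart_map c p) Q ->
  modelled p Q.
Proof.
move=> ac cp uA [r r0 [rD inj parts]].
pose U := chart_dom c `&` chart_map c @^-1` ball (chart_map c p) r.
exists A, U; split; first by split=> //; exact: ballxx.
split=> //.
- apply: open_inter_preimage; [exact: chart_dom_open|exact: chart_map_cont|exact: ball_open].
- move=> q q' [dq bq] [dq' bq'] xq.
  have e : chart_map c q = chart_map c q' by apply: inj => //=; rewrite !chart_mapK // xq.
  by rewrite -(chart_mapK dq) e chart_mapK.
move=> O oO OU; pose O' := chart_img c `&` chart_inv c @^-1` O.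
have oO' : open O'.
  by apply: open_inter_preimage => //; [exact: chart_img_open|exact: chart_inv_cont].
have [|V oV e] := parts O' oO'.
  by move=> w [Dw /OU[_]] /=; rewrite chart_invK.
exists V => //; rewrite -e; apply/seteqP; split=> _ [q qO <-].
  have [dq _] := OU _ qO; exists (chart_map c q); last by rewrite /= chart_mapK.
  by split; [exact: chart_map_img|rewrite /= chart_mapK].
by case: qO => _ qO; exists (chart_inv c q).
Qed.

Hypothesis x_cont : continuous x.

(** The neighbourhood in [U] of [q] is moved onto one of [p] by the linear map that
    the homogeneity of [Q] provides, and [p] has a neighbourhood that is part of [Q'];
    so all points of [U] are modelled on the same sets. *)
Lemma modelled_transfer A U Q Q' p q : maps_onto_part A U Q -> homogeneous Q ->
  U p -> U q -> modelled p Q' -> modelled q Q'.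
Proof.
move=> [uA oU inj parts] homQ Up Uq [A1 [U1 [U1p [uA1 oU1 inj1 parts1]]]].
have contA (B : 'M[R]_3) : continuous (fun r => x r *m B).
  move=> r; apply: (@continuous_comp _ _ _ x (fun v => v *m B)); first exact: x_cont.
  exact: mulmxr_continuous.
have inQ r : U r -> Q (x r *m A).
  move=> Ur; have [V _ e] := parts U oU (@subset_refl _ U).
  by have [] : (Q `&` V) (x r *m A) by rewrite -e; exists r.
have [G [N [uG oN Nq qG QG]]] := homQ _ _ (inQ q Uq) (inQ p Up).
have [V1 oV1 e1] := parts (U `&` U1) (openI oU oU1) (@subIsetl _ U U1).
pose Uq' := U `&` ((fun r => x r *m A) @^-1` N `&` (fun r => x r *m (A *m G)) @^-1` V1).
have oUq : open Uq'.
  apply: openI => //; apply: openI; apply: open_comp => // r _; exact: contA.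
have subU : Uq' `<=` U by move=> r [].
exists (A *m G *m (invmx A *m A1)), Uq'; split.
  split => //; split => //=; rewrite mulmxA qG.
  by have [] : (Q `&` V1) (x p *m A) by rewrite -e1; exists p.
split=> //.
- by rewrite !unitmx_mul uA uG unitmx_inv uA uA1.
- by move=> a b /subU Ua /subU Ub; exact: inj.
move=> O oO OUq; have [V oV e] := parts O oO (subset_trans OUq subU).
pose O' := (U `&` U1) `&` (fun r => x r *m (A *m invmx G)) @^-1` (V `&` N).
have oO' : open O'.
  by apply: openI; [exact: openI|apply: open_comp; [move=> r _; exact: contA|exact: openI]].
have [|V' oV' e'] := parts1 O' oO'; first by move=> r [[]].
exists V' => //; rewrite -e'.
have back (a b : M) : x b *m A = x a *m A *m G ->
    x a *m (A *m G *m (invmx A *m A1)) = x b *m A1.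
  by move=> ab; rewrite !mulmxA -ab -(mulmxA (x b)) mulmxV // mulmx1.
apply/seteqP; split=> _ [a aO <-].
  have [Ua [/= Na V1a]] := OUq _ aO.
  have : (Q `&` V1) (x a *m A *m G).
    by split; [apply/(QG _ Na)/inQ|rewrite -mulmxA].
  rewrite -e1 => -[b [Ub U1b] ab]; exists b; last exact: esym (back a b ab).
  split=> //=; rewrite mulmxA ab mulmxK //; split=> //.
  by have [] : (Q `&` V) (x a *m A) by rewrite -e; exists a.
have [[Ua U1a] [/= Va Na]] := aO; rewrite mulmxA in Va Na.
have : (Q `&` V) (x a *m A *m invmx G).
  split=> //; apply/(QG _ Na); rewrite mulmxKV //; exact: inQ.
by rewrite -e => -[b bO ab]; exists b => //; apply: back; rewrite ab mulmxKV.
Qed.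

(** The points modelled on [Q] form an open and closed set. *)
Lemma modelled_connected (W : set M) p0 Q : connected W -> W p0 -> modelled p0 Q ->
  (forall p, exists2 Q', homogeneous Q' & modelled p Q') ->
  forall p, W p -> modelled p Q.
Proof.
move=> cW Wp0 mp0 hom p Wp; pose Z := [set p | modelled p Q].
have local q : \forall r \near q, Z r <-> Z q.
  have [Q' hQ' [A [U [Uq mU]]]] := hom q; have [_ oU _ _] := mU.
  apply: filterS (open_nbhs_nbhs (conj oU Uq)) => r Ur.
  by split; apply: modelled_transfer mU hQ' _ _.
have oZ : open Z.
  by rewrite openE => q Zq; apply: filterS (local q) => r h; apply/h.
have cZ : closed Z.
  rewrite -openC openE => q Zq; apply: filterS (local q) => r h /h; exact: Zq.
have e : W `&` Z = W.
  apply: cW; first by exists p0.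
  - by exists Z.
  - by exists Z.
by have [] : (W `&` Z) p by rewrite e.
Qed.

End LocalToGlobal.

Section Classification.
Context {R : realType}.

Lemma patch_sub eps (D D' : set 'rV[R]_2) y : open D' -> D' `<=` D ->
  convex_patch eps D y -> convex_patch eps D' y.
Proof.
move=> oD' sD [e2 oD sy fr tr cv]; split=> //.
- by move=> s u /sD; exact: sy.
- by move=> u /sD; exact: fr.
- by move=> u /sD; exact: tr.
- by move=> u /sD; exact: cv.
Qed.

Lemma patch_model eps (D : set 'rV[R]_2) y u0 : convex_patch eps D y -> D u0 ->
  (forall u, D u -> forall m i j k, dcubic eps y m i j k u = 0) ->
  exists2 Q, nonquadric_model Q \/ Q = quadric (standard_quadric eps) &
    exists2 A : 'M[R]_3, A \in unitmx & embedded_in D (fun w => y w *m A) u0 Q.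
Proof.
move=> patch Du0 par; have S := patch_structure_eqs patch par.
have [C0|Cn] := pselect (forall m, cubic_mx eps y m u0 = 0).
  have [r r0 [rD C0']] := cubic_vanishes_near S Du0 C0.
  have [E frE] := gram_schmidt S.
  have frB := frame_sub (ball_open u0 r) rD frE.
  exists (quadric (standard_quadric eps)); first by right.
  have [A uA emb] := quadric_embedded S r0 rD C0' frB.
  by exists A => //; apply: embedded_in_sub emb.
have [r [E [la [mu [nu [r0 rD unitE assoc linear]]]]]] := exponential_structure S Du0 Cn.
have dy := mx_diff_uptoS (mx_diff_uptoS (str_diff_y S)).
have [Q nQ mQ] := nonquadric_cases (patch_eps2 patch) dy r0 rD unitE assoc linear.
by exists Q => //; left.
Qed.

Variables (M : smooth_surface R) (x : M -> 'rV[R]_3) (eps : R).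
Hypothesis eps2 : eps * eps = 1.
Hypothesis hx : centroaffine_surface x.
Hypothesis hconv : locally_strongly_convex eps x.
Hypothesis hpar : parallel_cubic_form eps x.

Lemma chart_patch c : atlas c -> convex_patch eps (chart_img c) (x \o chart_inv c).
Proof.
move=> ac; have [imm tr] := hx; have [sm fr] := imm c ac; split=> //.
- exact: chart_img_open.
- by move=> u cu; exact: tr.
- by move=> u cu; exact: hconv.
Qed.

Lemma surface_continuous : continuous x.
Proof.
move=> q; have [c ac cq] := atlas_cover q; have [imm _] := hx; have [sm _] := imm c ac.
have cont : {for q, continuous ((x \o chart_inv c) \o chart_map c)}.
  apply: continuous_comp; first exact: chart_map_cont.
  apply: differentiable_continuous; exact: (sm [::] _ (chart_map_img cq)).
move=> B Bx; have : nbhs q (((x \o chart_inv c) \o chart_map c) @^-1` B).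
  by apply: cont; rewrite /= chart_mapK.
have : nbhs q (chart_dom c) by apply: open_nbhs_nbhs; split=> //; exact: chart_dom_open.
by apply: filterS2 => r cr /=; rewrite chart_mapK.
Qed.

Lemma surface_model p :
  exists2 Q, nonquadric_model Q \/ Q = quadric (standard_quadric eps) & modelled x p Q.
Proof.
have [c ac cp] := atlas_cover p.
have [|Q hQ [A uA emb]] := patch_model (chart_patch ac) (chart_map_img cp).
  by move=> u cu; exact: hpar.
by exists Q => //; apply: modelled_in_chart ac cp uA emb.
Qed.

Lemma model_homogeneous Q :
  nonquadric_model Q \/ Q = quadric (standard_quadric eps) -> homogeneous Q.
Proof. by case=> [/homogeneous_nonquadric//|->]; exact: homogeneous_quadric. Qed.

(** Being in a quadric is a condition on the values of the immersion, hence holds in all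
    charts, which gives the vanishing of the cubic form in all of them. *)
Lemma cubic_vanishes_on_quadric (W : set M) :
  (forall p, W p -> modelled x p (quadric (standard_quadric eps))) ->
  cubic_form_vanishes_on eps x W.
Proof.
move=> mW c u ac cu Wu i j k.
have [A [U [Uu [uA oU _ parts]]]] := mW _ Wu.
have [V _ e] := parts U oU (@subset_refl _ U).
pose D := chart_img c `&` chart_inv c @^-1` U.
have oD : open D.
  by apply: open_inter_preimage => //; [exact: chart_img_open|exact: chart_inv_cont].
have patch : convex_patch eps D (x \o chart_inv c).
  by apply: patch_sub (chart_patch ac) => // w [].
have S := patch_structure_eqs patch (fun w (Dw : D w) => hpar ac Dw.1).
pose K := A *m sphere_form eps *m A^T.
have K_sym : K^T = K.
  by rewrite /K !trmx_mul trmxK sphere_form_sym mulmxA.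
have yK w : D w -> ((x \o chart_inv c) w *m K *m ((x \o chart_inv c) w)^T) 0 0 = 1.
  case=> _ /= Uw; have : (quadric (standard_quadric eps) `&` V) (x (chart_inv c w) *m A).
    by rewrite -e; exists (chart_inv c w).
  by case=> /standard_quadricE + _; rewrite trmx_mul /K !mulmxA.
have := cubic_vanishes_in_quadric S K_sym yK i (conj cu Uu : D u).
by move=> /matrixP/(_ j k); rewrite [LHS]mxE [RHS]mxE.
Qed.

End Classification.

Theorem theorem6p1 (R : realType) (M : smooth_surface R)
    (x : M -> 'rV[R]_3) (eps : R)
    (heps : eps = 1 \/ eps = -1)
    (hx : centroaffine_surface x)
    (hconv : locally_strongly_convex eps x)
    (hpar : parallel_cubic_form eps x)
    (W : set M) (hW : connected W) :
  (exists B : 'M[R]_(3 + 1),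
     nondegenerate_sym B /\ cubic_form_vanishes_on eps x W /\
     locally_equivalent_on W x (quadric B))
  \/
  (exists a1 a2 a3 : R,
     ((0 < a1 /\ 0 < a2 /\ 0 < a3) \/
      (a1 < 0 /\ 0 < a2 /\ 0 < a3 /\ a1 + a2 + a3 < 0)) /\
     locally_equivalent_on W x (model_power a1 a2 a3))
  \/
  (exists a1 a2 a3 : R,
     (a1 < 0 /\ 0 < a1 + 2 * a2) /\
     locally_equivalent_on W x (model_arctan a1 a2 a3))
  \/
  (exists a2 : R,
     (0 < a2 /\ a2 < 1) /\
     locally_equivalent_on W x (model_log a2))
  \/
  locally_equivalent_on W x model_parab_log.
Proof.
have eps2 : eps * eps = 1 by case: heps => ->; rewrite ?mulrNN mulr1.
have [[p0 Wp0]|W0] := pselect (exists p, W p); last first.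
  by do 4! right; move=> p Wp; case: W0; exists p.
have [Q hQ mQ] := surface_model eps2 hx hconv hpar p0.
have mW : forall p, W p -> modelled x p Q.
  apply: (modelled_connected (surface_continuous hx) hW Wp0 mQ) => p.
  have [Q' hQ' mQ'] := surface_model eps2 hx hconv hpar p.
  by exists Q' => //; exact: model_homogeneous hQ'.
have eqQ := modelled_equivalent mW.
case: hQ => [[[a1 [a2 [a3 [ha e]]]]|[[a1 [a2 [a3 [ha e]]]]|[[a2 [ha e]]|e]]]|e].
- by right; left; exists a1, a2, a3; rewrite -e.
- by right; right; left; exists a1, a2, a3; rewrite -e.
- by right; right; right; left; exists a2; rewrite -e.
- by right; right; right; right; rewrite -e.
left; exists (standard_quadric eps); split; first exact: standard_quadric_nondegenerate.
split; last by rewrite -e.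
by apply: (cubic_vanishes_on_quadric eps2 hx hconv hpar) => p /mW; rewrite e.
Qed.
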